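(* For every $n\ge 2$ and $2<p<\infty$, with $G=G_{B_p^n}$, $G_{\max}=\max_{x\in\partial B_p^n}G(x)$ and $G_{\min}=\min_{x\in\partial B_p^n}G(x)$, we have $$\lim_{\delta\to 0^+}\frac{\mathtt{d}_p(\delta)-1}{\delta^{\frac{2}{n+1}}}=G\big((n^{-1/p},\dots,n^{-1/p})\big)=G_{\max}=G_{\max}-G_{\min}.$$
   Context: $|\cdot|_k$ denotes $k$-dimensional volume; $B_p^{m}=\{x\in\mathbb{R}^m:\sum_i|x_i|^p\le 1\}$. The polar of $K$ is $K^\circ=\{y:\langle x,y\rangle\le 1\ \forall x\in K\}$. Floating body of a convex body $K\subset\mathbb{R}^n$: for $\delta\ge 0$, $K_\delta=\bigcap\{H^+ : |K\cap H^-|_n\le\delta|K|_n\}$, where $H$ ranges over hyperplanes and $H^+,H^-$ are the two corresponding closed halfspaces (in either labelling). Illumination body: for $\delta\ge 0$, $K^\delta=\{x\in\mathbb{R}^n: |\mathrm{conv}[K,x]|_n\le(1+\delta)|K|_n\}$, where $\mathrm{conv}[K,x]$ is the convex hull of $K\cup\{x\}$. For a centrally symmetric convex body $C$ put $\langle C\rangle^{\delta}=\left([C^\circ]^{\delta}\right)^\circ$. Distance of centrally symmetric convex bodies: $\mathtt{d}(C_1,C_2)=\inf\{a\ge 1:\frac1a C_1\subseteq C_2\subseteq aC_1\}$. For $0<\delta<\frac12$ put $\mathtt{d}_C(\delta)=\inf_{\delta'>0}\mathtt{d}\left(C_\delta,\langle C\rangle^{\delta'}\right)$ and $\mathtt{d}_p(\delta)=\mathtt{d}_{B_p^n}(\delta)$.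 For $x\in\partial C$ with unique outer unit normal $u(x)$ and Gauss curvature $\kappa(x)$ (product of the principal curvatures of $\partial C$ at $x$), $$G_C(x)=c(C,n)\frac{\kappa(x)^{\frac1{n+1}}}{\langle x,u(x)\rangle},\qquad c(C,n)=\frac{(n+1)^{\frac2{n+1}}}{2}\left(\frac{|C|_n}{|B_2^{n-1}|_{n-1}}\right)^{\frac2{n+1}}.$$ *)

(* Defs.v *)
From HB Require Import structures.
From mathcomp Require Import all_boot all_order all_algebra.
From mathcomp Require Import all_classical all_reals all_analysis.

Set Implicit Arguments.
Unset Strict Implicit.
Unset Printing Implicit Defensive.

Import Order.TTheory GRing.Theory Num.Theory.
Import numFieldNormedType.Exports.

Local Open Scope classical_set_scope.
Local Open Scope ring_scope.

(** ** Lebesgue measure on R^n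

    The library has no n-dimensional Lebesgue measure; it is obtained here as
    the n-fold product of [lebesgue_measure], carried by ((unit * R) * ...) * R
    and transported to ['rV[R]_n] along the obvious bijection. *)

Record measure_space (R : realType) := MeasureSpace {
  ms_disp : measure_display ;
  ms_sort : measurableType ms_disp ;
  ms_measure : {measure set ms_sort -> \bar R} }.

Fixpoint lebesgue_space (R : realType) (n : nat) : measure_space R :=
  match n with
  | 0 => @MeasureSpace R _ unit (@dirac _ unit tt R)
  | m.+1 =>
      let X := lebesgue_space R m in
      @MeasureSpace R _ (ms_sort X * measurableTypeR R)%type
        (ms_measure X \x @lebesgue_measure R)%E
  end.

Fixpoint lebesgue_point (R : realType) (n : nat) :
    'rV[R]_n -> ms_sort (lebesgue_space R n) :=
  match n with
  | 0 => fun=> tt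
  | m.+1 => fun x =>
      (lebesgue_point (\row_(i < m) x ord0 (widen_ord (leqnSn m) i)),
       x ord0 ord_max)
  end.

Definition volume (R : realType) (n : nat) (A : set 'rV[R]_n) : \bar R :=
  ms_measure (lebesgue_space R n) (@lebesgue_point R n @` A).

(** ** Convex geometry *)

Section ConvexGeometry.
Context {R : realType} {n : nat}.
Implicit Types (C K : set 'rV[R]_n) (x y u : 'rV[R]_n).

Definition dot x y : R := \sum_(i < n) x ord0 i * y ord0 i.

Definition boundary C : set 'rV[R]_n := closure C `\` interior C.

Definition polar K : set 'rV[R]_n :=
  [set y | forall x, K x -> dot x y <= 1].

Definition dilate (a : R) C : set 'rV[R]_n := [set a *: x | x in C].

Definition convex_hull (A : set 'rV[R]_n) : set 'rV[R]_n :=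
  smallest (@convex_set R 'rV[R]_n) A.

(* A hyperplane together with a labelling of its two sides is a pair (u, a)
   with u != 0; H^- is {dot u y >= a} and H^+ is {dot u y <= a}. *)
Definition floating_body (delta : R) K : set 'rV[R]_n :=
  [set x | forall (u : 'rV[R]_n) (a : R), u != 0 ->
     (volume (K `&` [set y | (a <= dot u y)%R]) <= delta%:E * volume K)%E ->
     dot u x <= a].

Definition illumination_body (delta : R) K : set 'rV[R]_n :=
  [set x | (volume (convex_hull (K `|` [set x])) <=
            (1 + delta)%R%:E * volume K)%E].

Definition polar_illumination_body (delta : R) C : set 'rV[R]_n :=
  polar (illumination_body delta (polar C)).

(* Both infima are taken in the extended reals; the infimum of the empty set
   is +oo. *)
Definition body_distance C1 C2 : \bar R :=
  ereal_inf [set a%:E | a in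
    [set a : R | [/\ 1 <= a, dilate a^-1 C1 `<=` C2 & C2 `<=` dilate a C1]]].

Definition floating_illumination_distance C (delta : R) : \bar R :=
  ereal_inf [set body_distance (floating_body delta C)
                               (polar_illumination_body delta' C)
            | delta' in [set delta' : R | 0 < delta']].

Definition outer_unit_normals C x : set 'rV[R]_n :=
  [set u | dot u u = 1 /\ forall y, C y -> dot y u <= dot x u].

(* 0 when there is not exactly one outer unit normal at x. *)
Definition outer_normal C x : 'rV[R]_n :=
  xget 0 [set u | outer_unit_normals C x = [set u]].

End ConvexGeometry.

Definition lp_ball (R : realType) (n : nat) (p : R) : set 'rV[R]_n :=
  [set x | \sum_(i < n) `|x ord0 i| `^ p <= 1].
Arguments lp_ball {R} n p.

(** ** Curvature *)

Definition hessian (R : realType) (m : nat) (f : 'rV[R]_m -> R)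
    (y : 'rV[R]_m) : 'M[R]_m :=
  \matrix_(i, j) 'D_(delta_mx ord0 i) (fun z => 'D_(delta_mx ord0 j) f z) y.

Definition twice_differentiable (R : realType) (m : nat) (f : 'rV[R]_m -> R)
    (y : 'rV[R]_m) : Prop :=
  (\forall z \near y, differentiable f z) /\
  forall j, differentiable (fun z => 'D_(delta_mx ord0 j) f z : R) y.

Section Curvature.
Context {R : realType} {n : nat}.
Implicit Types (C : set 'rV[R]_n) (x : 'rV[R]_n).

(* The rows of E form an orthonormal basis of the tangent hyperplane at x.
   Near x, the boundary of C is {x + y *m E - f y *: u}, the graph of f over
   that hyperplane in the direction of the inner normal -u.  The differential
   of f vanishes at 0, so the second fundamental form at x is the Hessian of f
   at 0; its eigenvalues, with multiplicity, are the k i. *)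
Definition principal_curvatures C x (k : 'I_n.-1 -> R) : Prop :=
  exists (E : 'M[R]_(n.-1, n)) (f : 'rV[R]_n.-1 -> R),
    let u := outer_normal C x in
    [/\ E *m E^T = 1%:M,
        E *m u^T = 0,
        twice_differentiable f 0,
        \forall z \near x,
          boundary C z <-> dot (x - z) u = f ((z - x) *m E^T)
      & char_poly (hessian f 0) = \prod_(i < n.-1) ('X - (k i)%:P)].

(* 0 when the principal curvatures do not exist. *)
Definition gauss_curvature C x : R :=
  xget 0 [set \prod_(i < n.-1) k i | k in principal_curvatures C x].

Definition G_const C : R :=
  n.+1%:R `^ (2 / n.+1%:R) / 2 *
  (fine (volume C) / fine (volume (lp_ball n.-1 (2 : R)))) `^ (2 / n.+1%:R).

Definition G_fun C x : R :=
  G_const C * (gauss_curvature C x `^ n.+1%:R^-1 / dot x (outer_normal C x)).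

End Curvature.

Definition is_maximum (R : realType) (S : set R) (M : R) : Prop :=
  S M /\ ubound S M.

Definition is_minimum (R : realType) (S : set R) (m : R) : Prop :=
  S m /\ lbound S m.

(* Main.v *)
(* Let K be the polar of B = B_p^n, i.e. the ball of the dual exponent q < 2, and
   let s = delta^(2/(n+1)). At a boundary point x, the cap of B of height tau, measured
   along lpdual p x, lies between the bodies
     {w : sum_i d_i w_i^2 / 2 <= - <lpdual p x, w> <= tau}
   for weights d_i close to (p-1)|x_i|^(p-2); scaling and a rotation turn such a body into
   a paraboloid cap. By AM-GM the product of the weights, so the width of the
   floating body, is extremal at the diagonal point x0, whence
     (1 - (G(x0) + eps) s) B <= B_delta <= B,   and B_delta is cut at x0 by G(x0) s.
   Upper bound: for delta' small enough <B>^delta' is as close to B as we please.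
   Lower bound: if <B>^delta' shrinks by eps s at x0, where K is smooth and curved, then
   delta' >= c delta. But at e_1 the ball K has infinite curvature, so adding to K a spike
   of height M s costs only o(delta) volume; hence <B>^delta' is cut at e_1 by
   M s for every M, while B_delta is not.
   The curvature of the sphere at x is (p-1)^(n-1) prod_i |x_i|^(p-2) / |grad|^(n+1), with
   grad = lpdual p x and <x, u(x)> = 1 / |grad|, so that G(x) is a constant times
   ((p-1)^(n-1) prod_i |x_i|^(p-2))^(1/(n+1)): maximal at x0 and 0 at e_1. *)

Require Import Defs.
From HB Require Import structures.
From mathcomp Require Import all_boot all_order all_algebra.
From mathcomp Require Import all_classical all_reals all_analysis.
From mathcomp Require Import measurable_realfun ring lra.

Set Implicit Arguments.
Unset Strict Implicit.
Unset Printing Implicit Defensive.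

Import Order.TTheory GRing.Theory Num.Theory.
Import numFieldNormedType.Exports.

Local Open Scope classical_set_scope.
Local Open Scope ring_scope.

(** * Volume of solids *)

(** The estimates are asymmetric. Cap volumes must be bounded below at every boundary point,
    uniformly, including points with a vanishing coordinate, where the curvature is 0; this forces
    weights regularised by a small [r]. They are bounded above only at the diagonal point, whose
    coordinates stay away from 0. On the dual ball no sharp constant is required: some positive
    constant at the point dual to [x0], and at [e_1] an exponent exceeding that of ordinary caps.
    With [n = m + 1] that ordinary exponent is [e = m/2 + 1 = (n+1)/2]: a cap of height [tau] has
    volume of order [tau^e], hence [delta = s^e]. Convex hulls are compared by inclusion with
    measurable sets, so their own measurability never has to be established. The curvature is
    defined through an existential. The product formula is derived for an arbitrary admissible
    graph, while a graph is constructed only at [x0]. Elsewhere either the formula or the default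
    value 0 applies, and both obey the bounds on [G]; at [e_1] both are 0. *)

Section ProductMeasure.
Context d1 d2 (T1 : measurableType d1) (T2 : measurableType d2) (R : realType).
Variables (m1 : {measure set T1 -> \bar R}) (m2 : {sigma_finite_measure set T2 -> \bar R}).
Hypothesis sm1 : sigma_finite setT m1.

(** The measures in [lebesgue_space] are bundled without sigma-finiteness. It enters as the
    hypothesis [sm1] and is attached to a local copy, to which the Tonelli-type results then
    apply. *)
Let m1' : set T1 -> \bar R := m1.
HB.instance Definition _ := Measure.on m1'.
HB.instance Definition _ := Measure_isSigmaFinite.Build _ _ _ m1' sm1.

Lemma sigma_finite_product : sigma_finite setT (m1 \x m2)%E.
Proof.
have /sigma_finiteP[F [TF ndF Foo]] := sm1.
have /sigma_finiteP[G [TG ndG Goo]] := sigma_finiteT m2.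
exists (fun k => F k `*` G k) => [|k].
  rewrite -setXTT TF TG; apply/seteqP; split => -[x y] /=; last first.
    by move=> [k _ [? ?]]; split; exists k.
  move=> [[i _ Fi] [j _ Gj]]; exists (maxn i j) => //; split => /=.
    by move: (ndF _ _ (leq_maxl i j)) => /subsetPset; exact.
  by move: (ndG _ _ (leq_maxr i j)) => /subsetPset; exact.
have [[? ?] [? ?]] := (Foo k, Goo k); split; first exact: measurableX.
by rewrite product_measure1E // lte_mul_pinfty // ge0_fin_numE.
Qed.

Lemma measurable_fun_measure_ysection (A : set (T1 * T2)) : measurable A ->
  measurable_fun setT (fun y => m1 (ysection A y)).
Proof. exact: (@measurable_fun_ysection _ _ _ _ _ m1'). Qed.

(** [\x] integrates the sections over the first factor and [\x^] those over the second; they agree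
    on rectangles, hence everywhere by uniqueness. *)
Lemma product_measure_ysection (A : set (T1 * T2)) : measurable A ->
  (m1 \x m2)%E A = (\int[m2]_y m1 (ysection A y))%E.
Proof.
move=> mA; rewrite -[RHS]/((m1' \x^ m2)%E A).
apply: (@product_measure_unique _ _ _ _ _ m1' m2) => //= A1 A2 mA1 mA2.
exact: product_measure2E.
Qed.

End ProductMeasure.

(** * Volume by slicing; monotonicity *)

Section Volume.
Context {R : realType}.
Implicit Types n m : nat.

(** Coordinates are split off at the end because [lebesgue_space] adds its factors on the right. *)
Definition rsnoc m (v : 'rV[R]_m) (t : R) : 'rV[R]_m.+1 :=
  \row_i (if unlift ord_max i is Some j then v ord0 j else t).

Lemma rsnocE_max m (v : 'rV[R]_m) t : rsnoc v t ord0 ord_max = t.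
Proof. by rewrite mxE unlift_none. Qed.

Lemma widen_lift m (i : 'I_m) : widen_ord (leqnSn m) i = lift ord_max i.
Proof. by apply: val_inj; rewrite /= /bump leqNgt ltn_ord. Qed.

Lemma rsnocE_lift m (v : 'rV[R]_m) t i : rsnoc v t ord0 (lift ord_max i) = v ord0 i.
Proof. by rewrite mxE liftK. Qed.

Definition rbelast m (x : 'rV[R]_m.+1) : 'rV[R]_m := \row_i x ord0 (lift ord_max i).

Lemma rbelastK m (x : 'rV[R]_m.+1) : rsnoc (rbelast x) (x ord0 ord_max) = x.
Proof.
apply/rowP => i; rewrite mxE; case: unliftP => [j ->|->] //.
by rewrite mxE.
Qed.

Lemma rsnocK m (v : 'rV[R]_m) t : rbelast (rsnoc v t) = v.
Proof. by apply/rowP => i; rewrite mxE rsnocE_lift. Qed.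

Fixpoint vec n : ms_sort (lebesgue_space R n) -> 'rV[R]_n :=
  match n with
  | 0 => fun=> 0
  | m.+1 => fun z => rsnoc (vec z.1) z.2
  end.

Lemma vecK n : cancel (@vec n) (@lebesgue_point R n).
Proof.
elim: n => [|n IH] /=; first by case.
move=> [z t] /=; rewrite rsnocE_max; congr (_, _).
rewrite -[RHS]IH; congr lebesgue_point; apply/rowP => i.
by rewrite mxE widen_lift rsnocE_lift.
Qed.

Lemma lebesgue_pointK n : cancel (@lebesgue_point R n) (@vec n).
Proof.
elim: n => [|n IH] /= x; first by apply/rowP; case.
rewrite IH -[RHS]rbelastK; congr rsnoc; apply/rowP => i.
by rewrite !mxE widen_lift.
Qed.

Notation mu n := (ms_measure (lebesgue_space R n)).

Lemma volumeE n (A : set 'rV[R]_n) : volume A = mu n (@vec n @^-1` A).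
Proof.
rewrite /volume; congr (mu n _); apply/seteqP; split => [_ [x Ax <-]|z Az] /=.
  by rewrite lebesgue_pointK.
by exists (vec z) => //; rewrite vecK.
Qed.

Definition vmeas n (A : set 'rV[R]_n) := measurable (@vec n @^-1` A).
Definition vmfun n (f : 'rV[R]_n -> R) := measurable_fun setT (f \o @vec n).

Lemma sigma_finite_lebesgue n : sigma_finite setT (mu n).
Proof.
elim: n => [|n IH]; last exact: sigma_finite_product.
exists (fun=> setT); first by rewrite bigcup_const.
by move=> i; split => //=; rewrite diracT ltry.
Qed.

Lemma volume_rsnoc n (A : set 'rV[R]_n.+1) : vmeas A ->
  volume A = (\int[lebesgue_measure]_t volume [set v | A (rsnoc v t)])%E.
Proof.
move=> mA; rewrite volumeE /= product_measure_ysection //; last exact: sigma_finite_lebesgue.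
apply: eq_integral => t _; rewrite volumeE; congr (mu n _).
by apply/seteqP; split => z /=; rewrite /ysection /= inE.
Qed.

Lemma vmeas_rsnocl n (A : set 'rV[R]_n.+1) t : vmeas A -> vmeas [set v | A (rsnoc v t)].
Proof.
move=> mA; rewrite /vmeas (_ : _ @^-1` _ = ysection (@vec n.+1 @^-1` A) t).
  exact: measurable_ysection.
by apply/seteqP; split => z /=; rewrite /ysection /= inE.
Qed.

Lemma measurable_volume_rsnoc n (A : set 'rV[R]_n.+1) : vmeas A ->
  measurable_fun setT (fun t => volume [set v | A (rsnoc v t)]).
Proof.
move=> mA; rewrite (_ : (fun t => _) = fun t => mu n (ysection (@vec n.+1 @^-1` A) t)).
  by apply: measurable_fun_measure_ysection => //; exact: sigma_finite_lebesgue.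
apply/funext => t; rewrite volumeE; congr (mu n _).
by apply/seteqP; split => z /=; rewrite /ysection /= inE.
Qed.

(** This holds for arbitrary sets, since [\x] is by definition the integral of these sections;
    [le_volume] relies on that. *)
Lemma volume_line n (A : set 'rV[R]_n.+1) :
  volume A = (\int[mu n]_z lebesgue_measure [set t | A (rsnoc (vec z) t)])%E.
Proof.
rewrite volumeE /=; apply: eq_integral => z _ /=; congr (lebesgue_measure _).
by apply/seteqP; split => t /=; rewrite /xsection /= inE.
Qed.

Lemma measurable_volume_line n (A : set 'rV[R]_n.+1) : vmeas A ->
  measurable_fun setT (fun z : ms_sort (lebesgue_space R n) =>
    lebesgue_measure [set t | A (rsnoc (vec z) t)]).
Proof.
move=> mA; rewrite (_ : (fun z => _) =
   lebesgue_measure \o xsection (@vec n.+1 @^-1` A)); first exact: measurable_fun_xsection.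
apply/funext => z /=; congr (lebesgue_measure _).
by apply/seteqP; split => t /=; rewrite /xsection /= inE.
Qed.

Lemma volume_ge0 n (A : set 'rV[R]_n) : (0 <= volume A)%E.
Proof. exact: measure_ge0. Qed.

Lemma volume0 n : volume (set0 : set 'rV[R]_n) = 0%E.
Proof. by rewrite volumeE preimage_set0 measure0. Qed.

Lemma volumeU n (A B : set 'rV[R]_n) : vmeas A -> vmeas B -> A `&` B = set0 ->
  volume (A `|` B) = (volume A + volume B)%E.
Proof.
move=> mA mB AB; rewrite !volumeE preimage_setU measureU //.
by rewrite -preimage_setI AB preimage_set0.
Qed.

Lemma le_nnintegral_mono d (T : measurableType d) (m : {measure set T -> \bar R})
    (f g : T -> \bar R) : (forall x, 0 <= f x)%E -> (forall x, f x <= g x)%E ->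
  (\int[m]_x f x <= \int[m]_x g x)%E.
Proof.
move=> f0 fg; have g0 x : (0 <= g x)%E by exact: le_trans (f0 x) (fg x).
rewrite !ge0_integralTE //; apply: ereal_sup_le => _ /= [h hf <-].
by exists h => // x; apply: le_trans (fg x).
Qed.

(* [lebesgue_measure] is an outer measure and the integral of a nonnegative
   function is a supremum, so monotonicity does not need measurability. *)
Lemma le_volume n (A B : set 'rV[R]_n) : A `<=` B -> (volume A <= volume B)%E.
Proof.
elim: n A B => [|n IH] A B AB.
  rewrite !volumeE /= !diracE lee_fin ler_nat.
  by case: (boolP (tt \in _)) => //; rewrite inE => /AB h; rewrite mem_set.
rewrite !volume_line; apply: le_nnintegral_mono => z; first exact: measure_ge0.
by apply: le_mu_ext => t; exact: AB.
Qed.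

End Volume.

(** * Cavalieri's principle along a coordinate axis *)

Section Linear.
Context {R : realType}.

Lemma vmfun_coord n (i : 'I_n) : vmfun (fun x : 'rV[R]_n => x ord0 i).
Proof.
elim: n i => [[]//|n IH] i; rewrite /vmfun.
case: (unliftP ord_max i) => [j ->|->].
  rewrite (_ : _ \o _ = (fun z => vec z ord0 j) \o fst); last first.
    by apply/funext => z /=; rewrite rsnocE_lift.
  by apply: measurableT_comp; [exact: IH|exact: measurable_fst].
rewrite (_ : _ \o _ = snd); first exact: measurable_snd.
by apply/funext => z /=; rewrite rsnocE_max.
Qed.

Lemma measurable_vec_preimage d (T : measurableType d) n (F : T -> 'rV[R]_n) (A : set 'rV[R]_n) :
  (forall i, measurable_fun setT (fun z => F z ord0 i)) -> vmeas A -> measurable (F @^-1` A).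
Proof.
move=> mF mA; rewrite (_ : F @^-1` A = (@lebesgue_point R n \o F) @^-1` (@vec R n @^-1` A)).
  rewrite -[_ @^-1` _]setTI.
  suff mp : measurable_fun setT (@lebesgue_point R n \o F) by exact: mp.
  elim: n F {A mA} mF => [|n IH] F mF /=; first exact: measurable_cst.
  apply: (@measurable_fun_pair _ _ _ T (ms_sort (lebesgue_space R n)) (measurableTypeR R)
    (fun z => lebesgue_point (\row_(i < n) F z ord0 (widen_ord (leqnSn n) i)))
    (fun z => F z ord0 ord_max)); last exact: mF.
  by apply: (IH (fun z => \row_(i < n) F z ord0 (widen_ord (leqnSn n) i))) => i;
     under eq_fun do rewrite mxE; exact: mF.
by apply/seteqP; split => z /=; rewrite lebesgue_pointK.
Qed.

Lemma vmeas_preimage n m (F : 'rV[R]_n -> 'rV[R]_m) (A : set 'rV[R]_m) :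
  (forall i, vmfun (fun x => F x ord0 i)) -> vmeas A -> vmeas (F @^-1` A).
Proof. by move=> mF mA; exact: (@measurable_vec_preimage _ _ m (F \o @vec R n)). Qed.

Definition upd n (x : 'rV[R]_n) (i : 'I_n) (t : R) : 'rV[R]_n :=
  \row_j (if j == i then t else x ord0 j).

Lemma upd_rsnoc_max n (v : 'rV[R]_n) s t : upd (rsnoc v s) ord_max t = rsnoc v t.
Proof.
apply/rowP => j; rewrite mxE; case: (unliftP ord_max j) => [k ->|->].
  by rewrite eq_sym (negbTE (neq_lift _ _)) !rsnocE_lift.
by rewrite eqxx rsnocE_max.
Qed.

Lemma upd_rsnoc_lift n (v : 'rV[R]_n) s t j :
  upd (rsnoc v s) (lift ord_max j) t = rsnoc (upd v j t) s.
Proof.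
apply/rowP => k; rewrite mxE; case: (unliftP ord_max k) => [l ->|->].
  by rewrite (inj_eq lift_inj) !rsnocE_lift mxE.
by rewrite (negbTE (neq_lift _ _)) !rsnocE_max.
Qed.

(** Induction on the dimension. If [i] is not the last index, fix the last coordinate and use the
    induction hypothesis on the hyperplane slices; if it is, integrate over the lines in that
    direction. *)
Lemma cavalieri n (i : 'I_n) (c : R) (A B : set 'rV[R]_n) : 0 <= c ->
  vmeas A -> vmeas B ->
  (forall x, lebesgue_measure [set t | B (upd x i t)] =
             c%:E * lebesgue_measure [set t | A (upd x i t)])%E ->
  (volume B = c%:E * volume A)%E.
Proof.
move=> c0; elim: n i A B => [[]//|n IH] i A B mA mB.
case: (unliftP ord_max i) => [j ->|->] H.
  rewrite !volume_rsnoc // -ge0_integralZl //; last exact: measurable_volume_rsnoc.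
  apply: eq_integral => t _; apply: (IH j [set v | A (rsnoc v t)] [set v | B (rsnoc v t)]).
  - exact: vmeas_rsnocl.
  - exact: vmeas_rsnocl.
  - move=> v; have := H (rsnoc v t).
    suff E (C : set 'rV[R]_n.+1) : [set s | C (upd (rsnoc v t) (lift ord_max j) s)] =
      [set s | C (rsnoc (upd v j s) t)] by rewrite !E.
    by apply/funext => s /=; rewrite upd_rsnoc_lift.
rewrite !volume_line -ge0_integralZl //; last exact: measurable_volume_line.
apply: eq_integral => z _; have := H (rsnoc (vec z) 0).
suff E (C : set 'rV[R]_n.+1) : [set t | C (upd (rsnoc (vec z) 0) ord_max t)] =
  [set t | C (rsnoc (vec z) t)] by rewrite !E.
by apply/funext => s /=; rewrite upd_rsnoc_max.
Qed.

(** Uniqueness of Lebesgue measure: [c] times its image under the affine map has the right value on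
    the intervals []a, d]]. *)
Lemma lebesgue_measure_pos_affine (c b : R) (A : set (measurableTypeR R)) : 0 < c ->
  measurable A ->
  (lebesgue_measure [set t : R | A (c * t + b)%R] = c^-1%:E * lebesgue_measure A)%E.
Proof.
move=> c0 mA; pose f := (fun t : measurableTypeR R => c * t + b : measurableTypeR R).
have mf : measurable_fun setT f by apply: measurable_funD => //; exact: measurable_funM.
pose m0 : {measure set (measurableTypeR R) -> \bar R} :=
  mscale (NngNum (ltW c0)) (pushforward (@lebesgue_measure R) f).
pose m' := m0 mf.
suff -> : lebesgue_measure A = m' A.
  by rewrite /m' /m0 /= /mscale /= muleA -EFinM mulVf ?gt_eqF // mul1e.
apply: lebesgue_measure_unique => //= _ [[a d]] _ <-.
rewrite /m' /m0 /= /mscale /= /pushforward /=.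
rewrite (_ : f @^-1` `]a, d] = `](a - b) / c, (d - b) / c]%classic); last first.
  apply/seteqP; split => t /=; rewrite /f !in_itv /= ltr_pdivrMr // ler_pdivlMr //;
  by rewrite ltrBlDr lerBrDr mulrC.
rewrite !lebesgue_measure_itv /= !lte_fin ltr_pM2r ?invr_gt0 // ltrD2r.
case: ifP => _; last by rewrite mule0.
by rewrite -!EFinB -EFinM; congr (_%:E); field; rewrite gt_eqF.
Qed.

Lemma lebesgue_measure_affine (c b : R) (A : set (measurableTypeR R)) : c != 0 ->
  measurable A ->
  (lebesgue_measure [set t : R | A (c * t + b)%R] = `|c|^-1%:E * lebesgue_measure A)%E.
Proof.
move=> c0 mA; have [cp|cn|/eqP] := ltgtP c 0; last by rewrite (negbTE c0).
  rewrite -(lebesgue_measureN mA) ltr0_norm // -(@lebesgue_measure_pos_affine (- c) (- b)).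
  - rewrite /pushforward; congr lebesgue_measure; apply/funext => t /=.
    by rewrite mulNr -opprD opprK.
  - by rewrite oppr_gt0.
  - rewrite -[_ @^-1` _]setTI.
    have : measurable_fun setT (fun t : measurableTypeR R => - t : measurableTypeR R).
      exact: measurable_funN.
    exact.
by rewrite gtr0_norm // lebesgue_measure_pos_affine.
Qed.

End Linear.

(** * Maps that rescale volume; plane rotations and isometries *)

Section VolumeScaling.
Context {R : realType}.

(** For an invertible affine map [c] is the inverse of the absolute determinant. Preimages make both
    measurability and composition immediate. *)
Definition vscale n (f : 'rV[R]_n -> 'rV[R]_n) (c : R) := forall A, vmeas A ->
  vmeas (f @^-1` A) /\ (volume (f @^-1` A) = c%:E * volume A)%E.

Lemma vscale_id n : vscale (@id 'rV[R]_n) 1.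
Proof. by move=> A mA; rewrite mul1e. Qed.

Lemma vscale_comp n (f g : 'rV[R]_n -> 'rV[R]_n) c d :
  vscale f c -> vscale g d -> vscale (f \o g) (d * c).
Proof.
move=> hf hg A mA; have [mf vf] := hf _ mA; have [mg vg] := hg _ mf.
by split => //; rewrite comp_preimage vg vf muleA -EFinM.
Qed.

(** As [g] ignores coordinate [i], the map is affine on each line in that direction and [cavalieri]
    applies. Diagonal maps, translations and shears are all obtained from this one. *)
Lemma vscale_upd n (i : 'I_n) (c : R) (g : 'rV[R]_n -> R) : c != 0 -> vmfun g ->
  (forall x t, g (upd x i t) = g x) ->
  vscale (fun x => upd x i (c * x ord0 i + g x)) `|c|^-1.
Proof.
move=> c0 mg gi A mA.
have mfA : vmeas ((fun x => upd x i (c * x ord0 i + g x)) @^-1` A).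
  apply: vmeas_preimage => // j; rewrite /vmfun.
  have [->|ij] := eqVneq j i.
    rewrite (_ : _ \o _ = (fun x : 'rV[R]_n => c * x ord0 i + g x) \o @vec R n); last first.
      by apply/funext => z /=; rewrite mxE eqxx.
    by apply: measurable_funD => //; apply: measurable_funM => //; exact: vmfun_coord.
  rewrite (_ : _ \o _ = (fun x : 'rV[R]_n => x ord0 j) \o @vec R n); last first.
    by apply/funext => z /=; rewrite mxE (negbTE ij).
  exact: vmfun_coord.
split => //; apply: (@cavalieri _ _ i) => // x.
have mAx : measurable [set t : measurableTypeR R | A (upd x i t)].
  apply: (@measurable_vec_preimage _ _ (measurableTypeR R) _ (fun t => upd x i t)) => // j.
  by under eq_fun do rewrite mxE; case: (j == i); [exact: measurable_id|exact: measurable_cst].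
rewrite -(@lebesgue_measure_affine _ c (g x)) //; congr lebesgue_measure.
apply/funext => t /=; congr A; apply/rowP => j; rewrite !mxE gi eqxx.
by case: eqP => // _.
Qed.

Lemma vscale_diag n (s b : 'I_n -> R) : (forall i, s i != 0) ->
  vscale (fun x => \row_i (s i * x ord0 i + b i)) (\prod_i `|s i|^-1).
Proof.
move=> s0.
pose F k (x : 'rV[R]_n) : 'rV[R]_n :=
  \row_(i < n) (if (i < k)%N then s i * x ord0 i + b i else x ord0 i).
suff H k : (k <= n)%N -> vscale (F k) (\prod_(i < n | (i < k)%N) `|s i|^-1).
  have := H n (leqnn n).
  rewrite (_ : F n = fun x => \row_i (s i * x ord0 i + b i)).
    suff -> : \prod_(i < n) `|s i|^-1 = \prod_(i < n | (i < n)%N) `|s i|^-1 by [].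
    by apply: eq_bigl => i; rewrite ltn_ord.
  by apply/funext => x; apply/rowP => i; rewrite !mxE ltn_ord.
elim: k => [_|k IH kn].
  rewrite big_pred0 // (_ : F 0 = id); first exact: vscale_id.
  by apply/funext => x; apply/rowP => i; rewrite !mxE.
pose i := Ordinal kn.
rewrite (bigD1 i) //= mulrC (eq_bigl (fun j : 'I_n => (j < k)%N)); last first.
  by move=> j; rewrite -(inj_eq val_inj) /= ltnS ltn_neqAle andbC.
rewrite (_ : F k.+1 = (fun x => upd x i (s i * x ord0 i + b i)) \o F k); last first.
  apply/funext => x; apply/rowP => j; rewrite !mxE ltnS -(inj_eq val_inj) /=.
  rewrite ltnn; have [jk|kj|jk] := ltngtP j k => //.
  by rewrite (_ : j = i) //; exact: val_inj.
apply: vscale_comp; last exact: IH (ltnW kn).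
by apply: (@vscale_upd _ i (s i) (fun=> b i)) => //; exact: measurable_cst.
Qed.

Lemma vscale_translate n (b : 'rV[R]_n) : vscale (fun x => x + b) 1.
Proof.
rewrite (_ : (fun x => _) = fun x : 'rV[R]_n => \row_i (1 * x ord0 i + b ord0 i)).
  have := @vscale_diag n (fun=> 1) (fun i => b ord0 i) (fun=> oner_neq0 _).
  by rewrite big1 // => i _; rewrite normr1 invr1.
by apply/funext => x; apply/rowP => i; rewrite !mxE mul1r.
Qed.

Lemma vscale_homothety n (s : R) (b : 'rV[R]_n) : s != 0 ->
  vscale (fun x => s *: x + b) (`|s|^-1 ^+ n).
Proof.
move=> s0; rewrite (_ : (fun x => _) = fun x : 'rV[R]_n => \row_i (s * x ord0 i + b ord0 i)).
  have := @vscale_diag n (fun=> s) (fun i => b ord0 i) (fun=> s0).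
  by rewrite prodr_const card_ord.
by apply/funext => x; apply/rowP => i; rewrite !mxE.
Qed.

Definition shear n (i j : 'I_n) (c : R) (x : 'rV[R]_n) : 'rV[R]_n :=
  upd x i (x ord0 i + c * x ord0 j).

Lemma vscale_shear n (i j : 'I_n) c : i != j -> vscale (shear i j c) 1.
Proof.
move=> ij; have := @vscale_upd n i 1 (fun x => c * x ord0 j) (oner_neq0 _).
rewrite normr1 invr1 (_ : (fun x => upd x i _) = shear i j c); last first.
  by apply/funext => x; rewrite /shear mul1r.
apply; first by apply: measurable_funM => //; exact: vmfun_coord.
by move=> x t; rewrite mxE eq_sym (negbTE ij).
Qed.

Definition rotation n (i j : 'I_n) (c s : R) (x : 'rV[R]_n) : 'rV[R]_n :=
  \row_k (if k == i then c * x ord0 i - s * x ord0 j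
          else if k == j then s * x ord0 i + c * x ord0 j else x ord0 k).

(* A rotation is a product of three shears, with parameters
   -tan(t/2), sin(t), -tan(t/2). *)
Lemma vscale_rotation n (i j : 'I_n) (c s : R) : i != j -> s != 0 ->
  c ^+ 2 + s ^+ 2 = 1 -> vscale (rotation i j c s) 1.
Proof.
move=> ij s0 cs; pose t := (1 - c) / s.
have ji : j == i = false by rewrite eq_sym; exact/negbTE.
have -> : rotation i j c s = shear i j (- t) \o (shear j i s \o shear i j (- t)).
  apply/funext => x; apply/rowP => k; rewrite !mxE /=.
  have st : s * t = 1 - c by rewrite /t mulrC divfK.
  have ct : (1 + c) * t = s.
    by apply: (mulfI s0); rewrite mulrCA st; move: cs; lra.
  have cE : c = 1 - s * t by rewrite st; ring.
  have s2 : s = 2 * t - s * t * t by rewrite -{1}ct cE; ring.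
  rewrite !eqxx ji (negbTE ij); case: ifP => ki; last case: ifP => // kj.
  - by rewrite {1}s2 cE; ring.
  - by rewrite cE; ring.
have := vscale_comp (vscale_shear (- t) ij)
  (vscale_comp (vscale_shear s (negbT ji)) (vscale_shear (- t) ij)).
by rewrite !mulr1.
Qed.

Lemma dotC n (x y : 'rV[R]_n) : dot x y = dot y x.
Proof. by apply: eq_bigr => i _; rewrite mulrC. Qed.

Lemma dotD n (x y z : 'rV[R]_n) : dot x (y + z) = dot x y + dot x z.
Proof. by rewrite -big_split; apply: eq_bigr => i _; rewrite mxE mulrDr. Qed.

Lemma dotZ n (x y : 'rV[R]_n) c : dot x (c *: y) = c * dot x y.
Proof. by rewrite mulr_sumr; apply: eq_bigr => i _; rewrite mxE mulrCA. Qed.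

Lemma dotN n (x y : 'rV[R]_n) : dot x (- y) = - dot x y.
Proof. by rewrite -scaleN1r dotZ mulN1r. Qed.

Lemma dotB n (x y z : 'rV[R]_n) : dot x (y - z) = dot x y - dot x z.
Proof. by rewrite dotD dotN. Qed.

Lemma dotDl n (x y z : 'rV[R]_n) : dot (y + z) x = dot y x + dot z x.
Proof. by rewrite dotC dotD !(dotC x). Qed.

Lemma dotZl n (x y : 'rV[R]_n) c : dot (c *: y) x = c * dot y x.
Proof. by rewrite dotC dotZ (dotC x). Qed.

Lemma dotNl n (x y : 'rV[R]_n) : dot (- x) y = - dot x y.
Proof. by rewrite dotC dotN dotC. Qed.

Lemma dotBl n (x y z : 'rV[R]_n) : dot (y - z) x = dot y x - dot z x.
Proof. by rewrite dotC dotB !(dotC x). Qed.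

Lemma dot_ge0 n (x : 'rV[R]_n) : 0 <= dot x x.
Proof. by apply: sumr_ge0 => i _; rewrite -expr2 sqr_ge0. Qed.

Lemma dot_eq0 n (x : 'rV[R]_n) : (dot x x == 0) = (x == 0).
Proof.
apply/idP/idP => [|/eqP ->]; last by rewrite /dot big1 // => i _; rewrite mxE mul0r.
rewrite psumr_eq0 => [/allP h|i _]; last by rewrite -expr2 sqr_ge0.
apply/eqP/rowP => i; rewrite mxE; apply/eqP.
by have := h i (mem_index_enum i); rewrite /= mulf_eq0 orbb.
Qed.

Lemma dot_rotation n (i j : 'I_n) (c s : R) : i != j -> c ^+ 2 + s ^+ 2 = 1 ->
  forall x y, dot (rotation i j c s x) (rotation i j c s y) = dot x y.
Proof.
move=> ij cs x y; rewrite /dot.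
have ji : j == i = false by rewrite eq_sym; exact/negbTE.
rewrite (bigD1 i) // [in RHS](bigD1 i) //= (bigD1 j) ?ji //= [in RHS](bigD1 j) ?ji //=.
rewrite !mxE !eqxx ji !addrA; congr (_ + _).
  rewrite -[RHS]mul1r -cs; ring.
by apply: eq_bigr => k /andP[ki kj]; rewrite !mxE (negbTE ki) (negbTE kj).
Qed.

(** Givens rotations, each in the plane of one axis and the last one, annihilate the coordinates in
    turn; a final sign change makes the last coordinate nonnegative. *)
Lemma orthogonal_to_last n (a : 'rV[R]_n.+1) : exists f : 'rV[R]_n.+1 -> 'rV[R]_n.+1,
  [/\ vscale f 1, forall x y, dot (f x) (f y) = dot x y &
      exists2 t, 0 <= t & f a = rsnoc 0 t].
Proof.
have step k : (k <= n)%N -> exists f : 'rV[R]_n.+1 -> 'rV[R]_n.+1,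
  [/\ vscale f 1, forall x y, dot (f x) (f y) = dot x y &
      forall i : 'I_n.+1, (i < k)%N -> f a ord0 i = 0].
  elim: k => [_|k IH kn]; first by exists id; split => //; exact: vscale_id.
  have [f [vf df f0]] := IH (ltnW kn).
  have kn' : (k < n.+1)%N by exact: leqW.
  pose i := Ordinal kn'.
  have iM : i != ord_max by rewrite -(inj_eq val_inj) /= ltn_eqF.
  (* The three shears of a rotation divide by its sine; a coordinate that already vanishes is left
     alone. *)
  have [z|nz] := eqVneq (f a ord0 i) 0.
    exists f; split => // j; rewrite ltnS leq_eqVlt => /orP[/eqP jk|]; last exact: f0.
    by rewrite (_ : j = i) //; exact: val_inj.
  set x := f a ord0 i in nz; set y := f a ord0 ord_max.
  pose r := Num.sqrt (x ^+ 2 + y ^+ 2).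
  have r2 : r ^+ 2 = x ^+ 2 + y ^+ 2 by rewrite sqr_sqrtr // addr_ge0 // sqr_ge0.
  have r0 : r != 0.
    by rewrite -sqrf_eq0 r2 gt_eqF // ltr_pwDl ?sqr_ge0 // exprn_even_gt0.
  have cs : (y / r) ^+ 2 + (x / r) ^+ 2 = 1.
    by rewrite !expr_div_n -mulrDl addrC -r2 divff // sqrf_eq0.
  exists (rotation i ord_max (y / r) (x / r) \o f); split.
  - rewrite -[1](mulr1 1); apply: vscale_comp => //; apply: vscale_rotation => //.
    by rewrite mulf_neq0 // invr_neq0.
  - by move=> u v /=; rewrite dot_rotation.
  - move=> j; rewrite ltnS /= mxE -/x -/y => jk.
    have [_|ji] := eqVneq j i; first by field.
    have jk' : (j < k)%N.
      by rewrite ltn_neqAle jk andbT; move: ji; rewrite -(inj_eq val_inj).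
    by rewrite -(inj_eq val_inj) /= ltn_eqF ?f0 // (ltn_trans jk').
have [f [vf df f0]] := step n (leqnn n).
have fa : f a = rsnoc 0 (f a ord0 ord_max).
  apply/rowP => i; rewrite mxE; case: unliftP => [j ->|-> //].
  by rewrite f0; [rewrite mxE|rewrite -widen_lift /=].
have [t0|t0] := leP 0 (f a ord0 ord_max).
  by exists f; split => //; exists (f a ord0 ord_max).
pose s (i : 'I_n.+1) : R := if i == ord_max then -1 else 1.
have ns i : `|s i| = 1 by rewrite /s; case: ifP; rewrite ?normrN normr1.
exists ((fun x => \row_i (s i * x ord0 i + 0)) \o f); split.
- rewrite -[1](mulr1 1); apply: (@vscale_comp _ (fun x => \row_i (s i * x ord0 i + 0)) f 1 1) => //.
  have s0 i : s i != 0 by rewrite -normr_eq0 ns oner_eq0.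
  have := @vscale_diag _ s (fun=> 0) s0; rewrite big1 //.
  by move=> i _; rewrite ns invr1.
- move=> x y; rewrite -[RHS]df; apply: eq_bigr => i _; rewrite !mxE !addr0.
  rewrite mulrACA (_ : s i * s i = 1) ?mul1r //.
  by rewrite -expr2 -real_normK ?num_real // ns expr1n.
- exists (- f a ord0 ord_max); first by rewrite oppr_ge0 ltW.
  apply/rowP => i; rewrite /= fa !mxE addr0 /s; case: unliftP => [j ->|->].
    by rewrite !mxE mulr0.
  by rewrite unlift_none eqxx mulN1r.
Qed.

End VolumeScaling.

(** * Cubes, Euclidean balls and paraboloid caps *)

Section Solids.
Context {R : realType}.

Lemma powR_derivable_oo (a T : R) : 0 < a -> 0 < T ->
  derivable_oo_LRcontinuous (fun t : R => t `^ a) 0 T.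
Proof.
move=> a0 T0; split.
- by move=> t; rewrite in_itv /= => /andP[t0 _]; apply: derivable_powR; rewrite in_itv /= t0.
- by rewrite powR0 ?gt_eqF //; exact: powR_cvg0.
- have cT : {for T, continuous (fun t : R => t `^ a)}.
    apply: differentiable_continuous; apply/derivable1_diffP.
    by apply: derivable_powR; rewrite in_itv /= T0.
  exact: cvg_at_left_filter cT.
Qed.

Lemma integral_powR (a T : R) : 0 < a -> 0 < T ->
  (\int[lebesgue_measure]_(t in `[0%R, T]) (t `^ a)%:E = (T `^ (a + 1) / (a + 1))%:E)%E.
Proof.
move=> a0 T0; have a10 : 0 < a + 1 by rewrite addr_gt0.
pose F (t : R) := (a + 1)^-1 *: (t `^ (a + 1)).
have dF : derivable_oo_LRcontinuous F 0 T.
  have [h1 h2 h3] := powR_derivable_oo a10 T0; split.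
  - by move=> t /h1 h; apply: derivableZ.
  - by apply: cvgZl_tmp.
  - by apply: cvgZl_tmp.
rewrite (@continuous_FTC2 _ _ F) //.
- by rewrite /F powR0 ?gt_eqF // scaler0 sube0 [_ *: _]mulrC.
- exact: derivable_oo_LRcontinuous_within (powR_derivable_oo _ _).
- move=> t; rewrite in_itv /= => /andP[t0 _].
  rewrite derive1E deriveZ; last by apply: derivable_powR; rewrite in_itv /= t0.
  rewrite -derive1E powR_derive1 ?in_itv /= ?t0 // addrK.
  by rewrite [_ *: _]mulrA mulVf ?mul1r // gt_eqF.
Qed.

Lemma vmeas_le n (f g : 'rV[R]_n -> R) : vmfun f -> vmfun g -> vmeas [set x | f x <= g x].
Proof.
move=> mf mg; rewrite /vmeas (_ : _ @^-1` _ = setT `&` ((g \o @vec R n) \- (f \o @vec R n)) @^-1` `[0, +oo[).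
  by apply: measurable_funB => //.
by apply/seteqP; split => z /=; rewrite in_itv /= andbT subr_ge0 //; case.
Qed.

Lemma vmeasI n (A B : set 'rV[R]_n) : vmeas A -> vmeas B -> vmeas (A `&` B).
Proof. by move=> mA mB; rewrite /vmeas preimage_setI; exact: measurableI. Qed.

Lemma vmeasC n (A : set 'rV[R]_n) : vmeas A -> vmeas (~` A).
Proof. by move=> mA; rewrite /vmeas preimage_setC; exact: measurableC. Qed.

Lemma vmfun_cst n (c : R) : vmfun (fun _ : 'rV[R]_n => c).
Proof. exact: measurable_cst. Qed.

Lemma vmfunM n (f g : 'rV[R]_n -> R) : vmfun f -> vmfun g -> vmfun (fun x => f x * g x).
Proof. by move=> mf mg; exact: measurable_funM. Qed.

Lemma vmfun_sum n (I : finType) (f : I -> 'rV[R]_n -> R) :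
  (forall i, vmfun (f i)) -> vmfun (fun x => \sum_i f i x).
Proof. by move=> mf; apply: measurable_sum. Qed.

Lemma vmfun_dotr n (u : 'rV[R]_n) : vmfun (dot u).
Proof.
by apply: vmfun_sum => i; apply: vmfunM; [exact: vmfun_cst|exact: vmfun_coord].
Qed.

Lemma vmfun_sqnorm n : vmfun (fun x : 'rV[R]_n => dot x x).
Proof. by apply: vmfun_sum => i; apply: vmfunM; exact: vmfun_coord. Qed.

Lemma vmfun_lp n (p : R) : vmfun (fun x : 'rV[R]_n => \sum_(i < n) `|x ord0 i| `^ p).
Proof.
apply: vmfun_sum => i.
have mn : measurable_fun setT (fun t : R => `|t| `^ p).
  by apply: (measurableT_comp (measurable_powR _)); exact: normr_measurable.
exact: (measurableT_comp mn (vmfun_coord i)).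
Qed.

Lemma volume_cube n : vmeas [set x : 'rV[R]_n | forall i, `|x ord0 i| <= 1] /\
  volume [set x : 'rV[R]_n | forall i, `|x ord0 i| <= 1] = (2 ^+ n)%:E.
Proof.
elim: n => [|n [mI vI]].
  rewrite (_ : [set x | _] = setT); last by apply/seteqP; split => // x _ [].
  split; first exact: measurableT.
  by rewrite volumeE /= diracT expr0.
have E : @vec R n.+1 @^-1` [set x | forall i, `|x ord0 i| <= 1] =
    (@vec R n @^-1` [set x | forall i, `|x ord0 i| <= 1]) `*` `[-1, 1].
  apply/seteqP; split => -[z t] /=.
    move=> h; split => [i|]; first by have := h (lift ord_max i); rewrite rsnocE_lift.
    by have := h ord_max; rewrite rsnocE_max in_itv /= ler_norml.
  rewrite in_itv /= -ler_norml => -[h t1] i; case: (unliftP ord_max i) => [j ->|->].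
    by rewrite rsnocE_lift.
  by rewrite rsnocE_max.
split; first by rewrite /vmeas E; apply: measurableX.
rewrite volumeE E /= product_measure1E // -volumeE vI.
transitivity ((2 ^+ n)%:E * 2%:E : \bar R)%E; last by rewrite -EFinM exprSr.
congr (_ * _)%E; have := @lebesgue_measure_itv R `[-1, 1].
rewrite /= lte_fin (_ : (-1 < 1 :> R)); last by lra.
by move=> ->; rewrite -EFinB; congr (_%:E); ring.
Qed.

Lemma vol_bounded n (A : set 'rV[R]_n) (c : R) : 0 < c ->
  A `<=` [set x | forall i, `|x ord0 i| <= c] ->
  (volume A <= ((2 * c) ^+ n)%:E)%E.
Proof.
move=> c0 Ac; apply: le_trans (le_volume Ac) _.
have [mI vI] := volume_cube n.
have ci0 : c^-1 != 0 by rewrite invr_eq0 gt_eqF.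
have [_] := vscale_homothety 0 ci0 mI.
rewrite vI normfV invrK gtr0_norm // -EFinM exprMn mulrC => <-.
apply: le_volume => x /= h i; rewrite !mxE addr0 normrM normfV (gtr0_norm c0).
by rewrite mulrC ler_pdivrMr // mul1r.
Qed.

(** Kept symbolic: sections of caps in dimension [m + 1] are balls of dimension [m], which is how
    this number comes to be the denominator in [G_const]. *)
Definition omega m : R := fine (volume (lp_ball m (2 : R) : set 'rV[R]_m)).

Lemma lp_ball2 m : lp_ball m (2 : R) = [set v : 'rV[R]_m | dot v v <= 1].
Proof.
apply/funext => v; rewrite /lp_ball /dot /=; congr (_ <= _ : Prop).
by apply: eq_bigr => i _; rewrite powR_mulrn // real_normK ?num_real // expr2.
Qed.

Lemma vmeas_ball m (c : R) : vmeas [set v : 'rV[R]_m | dot v v <= c].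
Proof. by apply: vmeas_le; [exact: vmfun_sqnorm|exact: vmfun_cst]. Qed.

Lemma sqr_coord_le_dot m (v : 'rV[R]_m) i : v ord0 i ^+ 2 <= dot v v.
Proof.
rewrite /dot (bigD1 i) //= expr2 lerDl; apply: sumr_ge0 => j _.
by rewrite -expr2 sqr_ge0.
Qed.

Lemma omegaE m : volume [set v : 'rV[R]_m | dot v v <= 1] = (omega m)%:E.
Proof.
rewrite /omega lp_ball2 fineK // ge0_fin_numE ?volume_ge0 //.
apply: le_lt_trans (@vol_bounded _ _ 1 ltr01 _) (ltry _) => v /= h i.
rewrite -(@ler_pXn2r _ 2) ?nnegrE // expr1n real_normK ?num_real //.
exact: le_trans (sqr_coord_le_dot v i) h.
Qed.

Lemma omega_ge0 m : 0 <= omega m.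
Proof. by rewrite -lee_fin -omegaE volume_ge0. Qed.

Lemma volume_ball m (rho : R) : (0 < m)%N -> 0 <= rho ->
  volume [set v : 'rV[R]_m | dot v v <= rho] = (Num.sqrt rho ^+ m * omega m)%:E.
Proof.
move=> m0; rewrite le_eqVlt => /orP[/eqP <-|rho0].
  rewrite sqrtr0 expr0n gtn_eqF //= mul0r.
  (* The degenerate ball is invariant under doubling, so its finite volume is [2^-1 ^+ m] times
     itself and vanishes. *)
  pose Z : set 'rV[R]_m := [set v | dot v v <= 0].
  have ZE : (fun v : 'rV[R]_m => 2 *: v + 0) @^-1` Z = Z.
    apply/funext => v; apply/propext; rewrite /Z /= addr0 dotZ dotZl mulrA.
    by rewrite pmulr_rle0 //; lra.
  have two0 : (2 : R) != 0 by rewrite pnatr_eq0.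
  have [_] := vscale_homothety (0 : 'rV[R]_m) two0 (vmeas_ball m 0).
  rewrite -/Z ZE; have : (volume Z < +oo)%E.
    apply: le_lt_trans (le_volume (_ : Z `<=` [set v | dot v v <= 1])) _.
      by move=> v /le_trans; apply.
    by rewrite omegaE ltry.
  rewrite -ge0_fin_numE ?volume_ge0 // => /fineK <-.
  rewrite -EFinM => -[] /eqP; rewrite eq_sym -subr_eq0 -[X in _ - X]mul1r -mulrBl.
  rewrite mulf_eq0 => /orP[|/eqP -> //].
  rewrite subr_eq0 normr_nat => /eqP h; exfalso.
  have : (2^-1 : R) ^+ m < 1 by rewrite exprn_ilt1 ?gtn_eqF //; lra.
  by rewrite h ltxx.
have s0 : 0 < Num.sqrt rho by rewrite sqrtr_gt0.
have si0 : (Num.sqrt rho)^-1 != 0 by rewrite invr_eq0 gt_eqF.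
have [_] := vscale_homothety (0 : 'rV[R]_m) si0 (vmeas_ball m 1).
rewrite omegaE normfV invrK gtr0_norm // -EFinM => <-; congr volume.
apply/funext => v; apply/propext; rewrite /= addr0 dotZ dotZl mulrA -invfM -expr2.
by rewrite sqr_sqrtr; [rewrite mulrC ler_pdivrMr // mul1r|exact: ltW].
Qed.

Definition paraboloid m (b T : R) : set 'rV[R]_m.+1 :=
  [set x : 'rV[R]_m.+1 | [/\ 0 <= x ord0 ord_max, x ord0 ord_max <= T &
     dot (rbelast x) (rbelast x) <= b * x ord0 ord_max]].

Lemma vmeas_paraboloid m b T : vmeas (@paraboloid m b T).
Proof.
rewrite (_ : paraboloid b T = [set x : 'rV[R]_m.+1 | 0 <= x ord0 ord_max] `&`
   ([set x : 'rV[R]_m.+1 | x ord0 ord_max <= T] `&`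
   [set x : 'rV[R]_m.+1 | dot (rbelast x) (rbelast x) <= b * x ord0 ord_max])); last first.
  by apply/seteqP; split => x /=; [case|case=> ? []].
apply: vmeasI; first by apply: vmeas_le; [exact: vmfun_cst|exact: vmfun_coord].
apply: vmeasI; first by apply: vmeas_le; [exact: vmfun_coord|exact: vmfun_cst].
apply: vmeas_le; last by apply: vmfunM; [exact: vmfun_cst|exact: vmfun_coord].
apply: vmfun_sum => i; rewrite /vmfun.
rewrite (_ : _ \o _ = (fun x : 'rV[R]_m.+1 => x ord0 (lift ord_max i) * x ord0 (lift ord_max i)) \o @vec R m.+1).
  by apply: vmfunM; exact: vmfun_coord.
by apply/funext => z /=; rewrite !mxE.
Qed.

(** The slice at height [t] is a ball of squared radius [b * t], so the integrand is a multiple of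
    [t^(m/2)]. *)
Lemma volume_paraboloid m (b T : R) : (0 < m)%N -> 0 <= b -> 0 < T ->
  volume (@paraboloid m b T) =
    (omega m * Num.sqrt b ^+ m * (T `^ (m%:R / 2 + 1) / (m%:R / 2 + 1)))%:E.
Proof.
move=> m0 b0 T0; rewrite volume_rsnoc; last exact: vmeas_paraboloid.
have mp : 0 < (m%:R / 2 : R) by rewrite divr_gt0 // ltr0n.
transitivity (\int[lebesgue_measure]_(t in `[0%R, T])
   ((omega m * Num.sqrt b ^+ m)%:E * (t `^ (m%:R / 2))%:E))%E.
  rewrite [in RHS]integral_mkcond /=; apply: eq_integral => t _; rewrite patchE.
  case: ifPn => [|]; rewrite ?inE /=.
    rewrite in_itv /= => /andP[t0 tT].
    rewrite (_ : [set v | _] = [set v | dot v v <= b * t]); last first.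
      apply/seteqP; split => v /=; rewrite /paraboloid /= rsnocE_max rsnocK.
        by case.
      by split.
    rewrite volume_ball ?mulr_ge0 // sqrtrM // -EFinM; congr (_%:E).
    rewrite exprMn -(powR12_sqrt t0) -(powR_mulrn m (powR_ge0 t _)) -powRrM.
    by rewrite (mulrC 2^-1); ring.
  rewrite notin_setE /= in_itv /= => h; rewrite (_ : [set v | _] = set0) ?volume0 //.
  apply/seteqP; split => v //=; rewrite /paraboloid /= rsnocE_max => -[t0 tT _].
  by apply: h; rewrite t0 tT.
rewrite ge0_integralZl //.
- by rewrite integral_powR // -EFinM.
- by apply/measurable_EFinP; apply: measurable_funTS; exact: measurable_powR.
- by move=> t _; rewrite lee_fin powR_ge0.
- by rewrite lee_fin mulr_ge0 ?omega_ge0 // exprn_ge0 ?sqrtr_ge0.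
Qed.

End Solids.

(** * Volume of quadric caps *)

Section Quadric.
Context {R : realType}.

(** Model of a cap in coordinates [w = y - x] at a boundary point [x]: [u] stands for the outward
    gradient and [d] for the second order coefficients. *)
Definition quadric n (d : 'I_n -> R) (u : 'rV[R]_n) (tau : R) : set 'rV[R]_n :=
  [set w : 'rV[R]_n | 2^-1 * (\sum_i d i * w ord0 i ^+ 2) <= - dot u w <= tau].

(** Volume of the paraboloid cap [|v|^2 <= 2 t], [0 <= t <= 1], whose principal curvatures at the
    apex are all 1. *)
Definition kappa m : R := omega m * 2 `^ (m%:R / 2) / (m%:R / 2 + 1).

Lemma dot_rsnoc m (x y : 'rV[R]_m.+1) :
  dot x y = dot (rbelast x) (rbelast y) + x ord0 ord_max * y ord0 ord_max.
Proof.
rewrite /dot big_ord_recr /=; congr (_ + _).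
by apply: eq_bigr => i _; rewrite widen_lift !mxE.
Qed.

Lemma vmeas_quadric n (d : 'I_n -> R) (u : 'rV[R]_n) tau : vmeas (quadric d u tau).
Proof.
rewrite (_ : quadric d u tau =
  [set w : 'rV[R]_n | 2^-1 * (\sum_i d i * w ord0 i ^+ 2) <= (-1) * dot u w] `&`
  [set w : 'rV[R]_n | (-1) * dot u w <= tau]); last first.
  apply/seteqP; split => w; rewrite /quadric /= mulN1r; first by move=> /andP.
  by move=> [-> ->].
have mu1 : vmfun (fun w : 'rV[R]_n => -1 * dot u w).
  by apply: vmfunM; [exact: vmfun_cst|exact: vmfun_dotr].
apply: vmeasI; apply: vmeas_le => //; last exact: vmfun_cst.
apply: vmfunM; first exact: vmfun_cst.
apply: vmfun_sum => i; apply: vmfunM; first exact: vmfun_cst.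
by apply: vmfunM; exact: vmfun_coord.
Qed.

(* Scaling the axes by [sqrt (d i)] and rotating [u] onto the last axis turns
   the quadric into a cap of a Euclidean ball. *)
Lemma volume_quadric m (d : 'I_m.+1 -> R) (u : 'rV[R]_m.+1) (tau : R) :
  (forall i, 0 < d i) ->
  volume (quadric d u tau) =
    ((\prod_i Num.sqrt (d i))^-1%:E *
     volume [set y : 'rV[R]_m.+1 |
       (2^-1 * dot y y <= Num.sqrt (\sum_i u ord0 i ^+ 2 / d i) * y ord0 ord_max <= tau)%R])%E.
Proof.
move=> d0; pose s i := Num.sqrt (d i).
have s0 i : 0 < s i by rewrite sqrtr_gt0.
have s2 i : s i ^+ 2 = d i by rewrite sqr_sqrtr // ltW.
(* After the scaling [g] the functional [- dot u] is the scalar product with [a], which the isometry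
   turns into [t] times the last coordinate. *)
pose a : 'rV[R]_m.+1 := \row_i (- (u ord0 i / s i)).
have [f [vf df [t t0 fa]]] := orthogonal_to_last a.
have tE : t = Num.sqrt (\sum_i u ord0 i ^+ 2 / d i).
  rewrite -[LHS](ger0_norm t0) -sqrtr_sqr.
  congr Num.sqrt; transitivity (dot a a).
    rewrite -df fa dot_rsnoc rsnocK rsnocE_max.
    by rewrite /dot big1 ?add0r ?expr2 // => i _; rewrite mxE mul0r.
  by apply: eq_bigr => i _; rewrite !mxE mulrNN -expr2 expr_div_n s2.
pose g (w : 'rV[R]_m.+1) : 'rV[R]_m.+1 := \row_i (s i * w ord0 i + 0).
have vg : vscale g (\prod_i `|s i|^-1) by apply: vscale_diag => i; rewrite gt_eqF.
pose S := [set y : 'rV[R]_m.+1 | 2^-1 * dot y y <= t * y ord0 ord_max <= tau].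
have mS : vmeas S.
  rewrite (_ : S = quadric (fun=> 1) (rsnoc 0 (- t)) tau); first exact: vmeas_quadric.
  apply/funext => y; rewrite /S /quadric /= (dot_rsnoc (rsnoc 0 (- t))) rsnocK rsnocE_max.
  rewrite [dot 0 _]big1; last by move=> i _; rewrite mxE mul0r.
  rewrite add0r mulNr opprK; congr (is_true ((_ * _ <= _) && _)).
  by apply: eq_bigr => i _; rewrite mul1r expr2.
have [_] := vscale_comp vf vg mS.
rewrite mulr1 -/S -tE => vS.
have -> : \prod_i Num.sqrt (d i) = \prod_i `|s i|.
  by apply: eq_bigr => i _; rewrite gtr0_norm.
rewrite -prodfV -vS; congr volume; apply/funext => w; rewrite /quadric /S /= df.
have -> : t * f (g w) ord0 ord_max = - dot u w.
  transitivity (dot (f a) (f (g w))).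
    rewrite fa dot_rsnoc rsnocK rsnocE_max [dot 0 _]big1 ?add0r // => i _.
    by rewrite mxE mul0r.
  rewrite df -dotNl; apply: eq_bigr => i _; rewrite !mxE addr0.
  by rewrite mulNr mulrA divfK ?mulNr // gt_eqF.
congr (is_true ((_ * _ <= _) && _)); apply: eq_bigr => i _; rewrite !mxE addr0.
by rewrite -expr2 exprMn s2.
Qed.

Lemma sqrtr_prod n (d : 'I_n -> R) : (forall i, 0 <= d i) ->
  Num.sqrt (\prod_i d i) = \prod_i Num.sqrt (d i).
Proof.
move=> d0; rewrite -[RHS]ger0_norm; last by apply: prodr_ge0 => i _; exact: sqrtr_ge0.
rewrite -sqrtr_sqr -prodrXl; congr Num.sqrt; apply: eq_bigr => i _.
by rewrite sqr_sqrtr.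
Qed.

(** Common to the two bounds below: [theta = 1] is the circumscribed paraboloid, smaller values give
    inscribed ones. The powers of [A] in width and height combine to [A^(-1/2)]. *)
Lemma volume_paraboloid_quadric m (d : 'I_m.+1 -> R) (A tau theta : R) : (0 < m)%N ->
  (forall i, 0 < d i) -> 0 < A -> 0 < tau -> 0 <= theta ->
  ((\prod_i Num.sqrt (d i))^-1%:E *
     volume (@paraboloid R m (2 * Num.sqrt A * theta) (tau / Num.sqrt A)) =
   (kappa m * Num.sqrt theta ^+ m * tau `^ (m%:R / 2 + 1) /
      Num.sqrt (A * \prod_i d i))%:E)%E.
Proof.
move=> m0 d0 A0 tau0 th0; set al := Num.sqrt A.
have al0 : 0 < al by rewrite sqrtr_gt0.
have al2 : 0 <= 2 * al by rewrite mulr_ge0 // ltW.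
rewrite volume_paraboloid ?divr_gt0 ?(mulr_ge0 al2) // -EFinM; congr (_%:E).
rewrite sqrtrM // sqrtrM // !exprMn.
rewrite powRM ?invr_ge0; [|exact: ltW|exact: ltW].
rewrite -(powR_inv1 (ltW al0)) -powRrM mulN1r powRN.
rewrite [al `^ _]powRD; last by rewrite (gt_eqF al0) implybT.
rewrite [al `^ (_ / _)](_ : _ = Num.sqrt al ^+ m); last first.
  by rewrite mulrC powRrM powR12_sqrt ?powR_mulrn ?sqrtr_ge0 // ltW.
rewrite (powRr1 (ltW al0)).
rewrite sqrtrM ?(ltW A0) // sqrtr_prod => [|i]; last exact: ltW.
rewrite /kappa (mulrC m%:R) powRrM powR12_sqrt // powR_mulrn ?sqrtr_ge0 //.
rewrite -/al; set P := \prod_i _; set e := _ + 1.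
have P0 : P != 0.
  by rewrite gt_eqF //; apply: prodr_gt0 => i _; rewrite sqrtr_gt0.
have e0 : e != 0 by rewrite gt_eqF // /e addr_gt0 // mulr_gt0 ?invr_gt0 ?ltr0n.
have sal0 : Num.sqrt al ^+ m != 0 by rewrite expf_neq0 // gt_eqF // sqrtr_gt0.
field.
by rewrite e0 P0 sal0 gt_eqF.
Qed.

(** Dropping the square of the last coordinate turns the ball inequality into that of a
    paraboloid. *)
Lemma volume_quadric_le m (d : 'I_m.+1 -> R) (u : 'rV[R]_m.+1) (tau : R) :
  (0 < m)%N -> (forall i, 0 < d i) -> 0 < \sum_i u ord0 i ^+ 2 / d i -> 0 < tau ->
  (volume (quadric d u tau) <=
   (kappa m * tau `^ (m%:R / 2 + 1) /
     Num.sqrt ((\sum_i u ord0 i ^+ 2 / d i) * \prod_i d i))%:E)%E.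
Proof.
move=> m0 d0 A0 tau0; rewrite volume_quadric //.
have := volume_paraboloid_quadric m0 d0 A0 tau0 ler01.
rewrite sqrtr1 expr1n !mulr1 => <-; set al := Num.sqrt _.
have al0 : 0 < al by rewrite sqrtr_gt0.
apply: lee_wpmul2l.
  by rewrite lee_fin invr_ge0; apply: prodr_ge0 => i _; exact: sqrtr_ge0.
apply: le_volume => y /= /andP[h1 h2]; rewrite dot_rsnoc in h1.
have yy := dot_ge0 (rbelast y); have y2 := sqr_ge0 (y ord0 ord_max).
rewrite expr2 in y2; split.
- by rewrite -(pmulr_rge0 _ al0); lra.
- by rewrite ler_pdivlMr // mulrC.
- by lra.
Qed.

(** On the cap the last coordinate satisfies [t^2 <= (tau / sqrt A) * t], so its square is absorbed
    by shrinking the paraboloid by the factor [1 - tau / (2 * A)]. *)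
Lemma volume_quadric_ge m (d : 'I_m.+1 -> R) (u : 'rV[R]_m.+1) (tau : R) :
  (0 < m)%N -> (forall i, 0 < d i) -> 0 < \sum_i u ord0 i ^+ 2 / d i -> 0 < tau ->
  tau <= 2 * (\sum_i u ord0 i ^+ 2 / d i) ->
  ((kappa m * Num.sqrt (1 - tau / (2 * (\sum_i u ord0 i ^+ 2 / d i))) ^+ m *
     tau `^ (m%:R / 2 + 1) /
     Num.sqrt ((\sum_i u ord0 i ^+ 2 / d i) * \prod_i d i))%:E <= volume (quadric d u tau))%E.
Proof.
move=> m0 d0; set A := \sum_i _ => A0 tau0 tauA; rewrite volume_quadric // -/A.
have A20 : 0 < 2 * A by rewrite mulr_gt0.
have th0 : 0 <= 1 - tau / (2 * A) by rewrite subr_ge0 ler_pdivrMr // mul1r.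
rewrite -(volume_paraboloid_quadric m0 d0 A0 tau0 th0); set al := Num.sqrt A.
have al0 : 0 < al by rewrite sqrtr_gt0.
have alA : al ^+ 2 = A by rewrite sqr_sqrtr // ltW.
apply: lee_wpmul2l.
  by rewrite lee_fin invr_ge0; apply: prodr_ge0 => i _; exact: sqrtr_ge0.
apply: le_volume => y /= [t0 tT h]; rewrite dot_rsnoc; set t := y ord0 ord_max in t0 tT h *.
apply/andP; split; last by rewrite mulrC -ler_pdivlMr.
have -> : al * t = 2^-1 * (2 * al * (1 - tau / (2 * A)) * t + tau / al * t).
  by rewrite -alA; field; rewrite gt_eqF.
rewrite ler_pM2l ?invr_gt0 //; apply: lerD => //; exact: ler_wpM2r.
Qed.

End Quadric.

(** * Duality and caps of the lp balls *)

Section OneVariable.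
Context {R : realType}.

Section PointwiseRules.
Context {V : normedModType R} (x v : V).
Implicit Types f g : V -> R.

Lemma is_derive_mul f g (df dg : R) : is_derive x v f df -> is_derive x v g dg ->
  is_derive x v (fun y => f y * g y) (f x * dg + g x * df).
Proof. exact: is_deriveM. Qed.

Lemma is_derive_add f g (df dg : R) : is_derive x v f df -> is_derive x v g dg ->
  is_derive x v (fun y => f y + g y) (df + dg).
Proof. exact: is_deriveD. Qed.

Lemma is_derive_sub f g (df dg : R) : is_derive x v f df -> is_derive x v g dg ->
  is_derive x v (fun y => f y - g y) (df - dg).
Proof. exact: is_deriveB. Qed.

Lemma is_derive_opp f (df : R) : is_derive x v f df -> is_derive x v (fun y => - f y) (- df).
Proof. exact: is_deriveN. Qed.

Lemma is_derive_scal k f (df : R) : is_derive x v f df ->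
  is_derive x v (fun y => k * f y) (k * df).
Proof. exact: is_deriveZ. Qed.

Lemma is_derive_sumr (I : finType) (F : I -> V -> R) (dF : I -> R) :
  (forall i, is_derive x v (F i) (dF i)) ->
  is_derive x v (fun y => \sum_i F i y) (\sum_i dF i).
Proof.
move=> H; rewrite (_ : (fun y => _) = \sum_i F i); last first.
  by apply/funext => y; rewrite fct_sumE.
elim/big_ind2 : _ => [|f df g dg hf hg|i _] //; first exact: is_derive_cst.
exact: is_derive_add.
Qed.

End PointwiseRules.

Lemma powRB1_gt0 (x p : R) : 0 < x -> x `^ (p + 1) = x `^ p * x.
Proof. by move=> x0; rewrite powRD ?powRr1 ?ltW // (gt_eqF x0) implybT. Qed.

Lemma powR_norm_cvg0 (c : R) : 0 < c -> (`|h| `^ c) @[h --> (0 : R)^'] --> (0 : R).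
Proof.
move=> c0; apply/cvgrPdist_lt => e e0.
near=> h; rewrite sub0r normrN (ger0_norm (powR_ge0 _ _)).
rewrite -[e](@powRr1 _ e) ?ltW // -[X in e `^ X](mulVf (lt0r_neq0 c0)) powRrM.
apply: gt0_ltr_powR; rewrite ?nnegrE ?powR_ge0 //.
near: h; apply: dnbhs0_lt; exact: powR_gt0.
Unshelve. all: by end_near. Qed.

(** Away from 0 this is [powR] up to sign; at 0 the difference quotient is [|h|^c], which tends to
    0. With [c = p - 2] it makes [|s|^p] twice differentiable across the origin. *)
Lemma is_derive_spow (c t : R) : 0 < c ->
  is_derive t 1 (fun s : R => s * `|s| `^ c) ((c + 1) * `|t| `^ c).
Proof.
move=> c0; have [t0|t0|->] := ltgtP t 0.
- apply: (@near_eq_is_derive _ _ _ (fun s : R => - ((- s) `^ (c + 1)))).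
    near=> s; have s0 : s < 0 by near: s; exact: lt_nbhsl.
    by rewrite powRB1_gt0 ?oppr_gt0 // mulrN opprK ltr0_norm // mulrC.
  have nt0 : 0 < - t by rewrite oppr_gt0.
  have d1 := @is_derive1_powR _ (c + 1) _ nt0.
  have dN : is_derive t 1 (-%R : R -> R) (- 1) by apply: is_deriveNid.
  apply: is_derive_eq; first exact: is_deriveN (is_derive1_comp d1 dN).
  by rewrite /= addrK ltr0_norm // mulrN1 opprK.
- apply: (@near_eq_is_derive _ _ _ (fun s : R => s `^ (c + 1))).
    near=> s; have s0 : 0 < s by near: s; exact: lt_nbhsr.
    by rewrite powRB1_gt0 // gtr0_norm // mulrC.
  have d1 := @is_derive1_powR _ (c + 1) _ t0.
  by apply: is_derive_eq; rewrite addrK gtr0_norm.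
- rewrite normr0 powR0 ?gt_eqF // mulr0.
  have L : (h^-1 *: (((fun s : R => s * `|s| `^ c) \o shift 0) (h *: (1 : R)) - 0 * `|0 : R| `^ c))
     @[h --> (0 : R)^'] --> (0 : R).
    have := powR_norm_cvg0 c0; apply: cvg_trans; apply: near_eq_cvg.
    near=> h; have h0 : h != 0 by near: h; exact: nbhs_dnbhs_neq.
    by rewrite /= mul0r subr0 addr0 [h *: _]mulr1 [_ *: _]mulrA mulVf // mul1r.
  by apply: DeriveDef; [apply/cvg_ex; exists 0|apply: cvg_lim].
Unshelve. all: by end_near. Qed.

Lemma is_derive_normpow (p t : R) : 2 < p ->
  is_derive t 1 (fun s : R => `|s| `^ p) (p * (t * `|t| `^ (p - 2))).
Proof.
move=> p2; have c0 : 0 < p - 2 by lra.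
rewrite (_ : (fun s => _) = (fun s : R => s * (s * `|s| `^ (p - 2)))); last first.
  apply/funext => s; have [->|s0] := eqVneq s 0.
    by rewrite normr0 powR0 ?mul0r // gt_eqF //; lra.
  have ns : 0 < `|s| by rewrite normr_gt0.
  rewrite mulrA -expr2 -(real_normK (num_real s)) -powR_mulrn // -powRD.
    by congr (_ `^ _); ring.
  by rewrite (gt_eqF ns) implybT.
have d := is_derive_spow t c0.
apply: (is_derive_eq (is_derive_mul (is_derive_id t (1 : R)) d)).
by ring.
Qed.

Lemma is_derive_continuous_within (f df : R -> R) (a b : R) :
  (forall t, a <= t <= b -> is_derive t 1 f (df t)) -> {within `[a, b], continuous f}.
Proof.
move=> H; apply: continuous_in_subspaceT => t; rewrite inE /= in_itv /= => tab.
by apply: differentiable_continuous; apply/derivable1_diffP; have [] := H t tab.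
Qed.

Lemma MVT_le (f df : R -> R) (a b : R) : a <= b ->
  (forall t, a <= t <= b -> is_derive t 1 f (df t)) ->
  exists2 c, a <= c <= b & f b - f a = df c * (b - a).
Proof.
move=> ab H; have [| |c] := @MVT_segment R f df a b ab.
- by move=> t; rewrite in_itv /= => /andP[/ltW h1 /ltW h2]; apply: H; rewrite h1.
- exact: is_derive_continuous_within H.
- by rewrite in_itv /= => h1 h2; exists c.
Qed.

(** Subtracting the quadratic leaves [h] with [h' x = 0] and [h'' <= 0]; the mean value theorem,
    applied to [h] and then to [h'], gives [h y <= h x] on both sides of [x]. *)
Lemma taylor2_le (f f' f'' : R -> R) (a b M x y : R) :
  (forall t, a <= t <= b -> is_derive t 1 f (f' t)) ->
  (forall t, a <= t <= b -> is_derive t 1 f' (f'' t)) ->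
  (forall t, a <= t <= b -> f'' t <= M) ->
  a <= x <= b -> a <= y <= b ->
  f y <= f x + f' x * (y - x) + M / 2 * (y - x) ^+ 2.
Proof.
move=> df df' bf /andP[ax xb] /andP[ay yb].
pose h (t : R) := f t - f' x * t - M / 2 * ((t - x) * (t - x)).
pose h' (t : R) := f' t - f' x - M * (t - x).
pose h'' (t : R) := f'' t - M.
have dh t : a <= t <= b -> is_derive t 1 h (h' t).
  move=> /df d; have dx := is_derive_sub (is_derive_id t (1 : R)) (is_derive_cst x t 1).
  apply: (is_derive_eq (is_derive_sub
    (is_derive_sub d (is_derive_scal (f' x) (is_derive_id t (1 : R))))
    (is_derive_scal (M / 2) (is_derive_mul dx dx)))).
  by rewrite /h' /cst; field.
have dh' t : a <= t <= b -> is_derive t 1 h' (h'' t).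
  move=> /df' d; have dx := is_derive_sub (is_derive_id t (1 : R)) (is_derive_cst x t 1).
  apply: (is_derive_eq (is_derive_sub
    (is_derive_sub d (is_derive_cst (f' x) t (1 : R))) (is_derive_scal M dx))).
  by rewrite /h''; ring.
suff : h y <= h x by rewrite /h subrr mulr0 mulr0 subr0 expr2; lra.
have [xy|yx] := leP x y.
  have [|c /andP[xc cy] E] := @MVT_le h h' x y xy.
    by move=> t /andP[h1 h2]; apply: dh; lra.
  have [|e /andP[xe ec] E'] := @MVT_le h' h'' x c xc.
    by move=> t /andP[h1 h2]; apply: dh'; lra.
  have : h'' e <= 0 by rewrite /h'' subr_le0; apply: bf; lra.
  have h'x : h' x = 0 by rewrite /h'; ring.
  move=> he; rewrite -subr_le0 E; apply: mulr_le0_ge0; last by lra.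
  have -> : h' c = h' c - h' x by rewrite h'x subr0.
  by rewrite E'; apply: mulr_le0_ge0 => //; lra.
have [|c /andP[yc cx] E] := @MVT_le h h' y x (ltW yx).
  by move=> t /andP[h1 h2]; apply: dh; lra.
have [|e /andP[ce ex] E'] := @MVT_le h' h'' c x cx.
  by move=> t /andP[h1 h2]; apply: dh'; lra.
have : h'' e <= 0 by rewrite /h'' subr_le0; apply: bf; lra.
have h'x : h' x = 0 by rewrite /h'; ring.
move=> he; rewrite -subr_ge0 E; apply: mulr_ge0; last by lra.
have -> : h' c = - (h' x - h' c) by rewrite h'x; ring.
by rewrite E' oppr_ge0; apply: mulr_le0_ge0 => //; lra.
Qed.

Lemma taylor2_ge (f f' f'' : R -> R) (a b M x y : R) :
  (forall t, a <= t <= b -> is_derive t 1 f (f' t)) ->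
  (forall t, a <= t <= b -> is_derive t 1 f' (f'' t)) ->
  (forall t, a <= t <= b -> M <= f'' t) ->
  a <= x <= b -> a <= y <= b ->
  f x + f' x * (y - x) + M / 2 * (y - x) ^+ 2 <= f y.
Proof.
move=> df df' bf xab yab.
suff : - f y <= - f x + - f' x * (y - x) + - M / 2 * (y - x) ^+ 2 by lra.
apply: (@taylor2_le (fun t => - f t) (fun t => - f' t) (fun t => - f'' t) a b) => // t tab.
- exact/is_derive_opp/df.
- exact/is_derive_opp/df'.
- by rewrite lerN2; exact: bf.
Qed.

End OneVariable.

(** * Hölder duality of the lp balls *)

Section LpGeometry.
Context {R : realType}.

Definition lpsum n (p : R) (x : 'rV[R]_n) : R := \sum_(i < n) `|x ord0 i| `^ p.
(** The gradient of [lpsum p] divided by [p]. For [x] on the unit sphere it is the outward normal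
    scaled to pair to 1 with [x], and it lies on the sphere of the conjugate exponent. *)
Definition lpdual n (p : R) (x : 'rV[R]_n) : 'rV[R]_n :=
  \row_i (Num.sg (x ord0 i) * `|x ord0 i| `^ (p - 1)).

Lemma lpsum_ge0 n p (x : 'rV[R]_n) : 0 <= lpsum p x.
Proof. by apply: sumr_ge0 => i _; exact: powR_ge0. Qed.

Lemma lpsumZ n p c (x : 'rV[R]_n) : lpsum p (c *: x) = `|c| `^ p * lpsum p x.
Proof.
rewrite mulr_sumr; apply: eq_bigr => i _.
by rewrite mxE normrM powRM.
Qed.

Lemma lpsumN n p (x : 'rV[R]_n) : lpsum p (- x) = lpsum p x.
Proof. by apply: eq_bigr => i _; rewrite mxE normrN. Qed.

Lemma coord_le_lpsum n p (x : 'rV[R]_n) i : `|x ord0 i| `^ p <= lpsum p x.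
Proof.
by rewrite /lpsum (bigD1 i) //= lerDl; apply: sumr_ge0 => j _; exact: powR_ge0.
Qed.

Lemma lpsum_eq0 n p (x : 'rV[R]_n) : lpsum p x = 0 -> x = 0.
Proof.
move=> x0; apply/rowP => i; rewrite mxE.
apply/eqP; rewrite -normr_eq0; apply/eqP/(@powR_eq0_eq0 _ _ p)/le_anti.
by rewrite powR_ge0 andbT -x0 coord_le_lpsum.
Qed.

Lemma powR_le1 (a p : R) : 0 < p -> 0 <= a -> (a `^ p <= 1) = (a <= 1).
Proof.
move=> p0 a0; apply/idP/idP => h.
  rewrite leNgt; apply/negP => a1.
  have := @gt0_ltr_powR _ p p0 1 a; rewrite powR1 !nnegrE ler01 a0 => /(_ isT isT a1).
  by rewrite ltNge h.
by have := @ge0_ler_powR _ p (ltW p0) a 1; rewrite powR1 !nnegrE ler01 a0 => /(_ isT isT h).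
Qed.

Lemma coord_le1 n p (x : 'rV[R]_n) i : 0 < p -> lpsum p x <= 1 -> `|x ord0 i| <= 1.
Proof.
by move=> p0 x1; rewrite -(powR_le1 p0) //; exact: le_trans (coord_le_lpsum p x i) x1.
Qed.

Lemma dot_lpdual n p (x : 'rV[R]_n) : 0 < p -> dot (lpdual p x) x = lpsum p x.
Proof.
move=> p0; apply: eq_bigr => i _; rewrite !mxE mulrAC -normrEsg.
exact: mulr_powRB1.
Qed.

Section Conjugate.
Variables (n : nat) (p q : R).
Hypotheses (p1 : 1 < p) (q1 : 1 < q) (pq : p^-1 + q^-1 = 1).

Let p0 : 0 < p. Proof. exact: lt_trans p1. Qed.
Let q0 : 0 < q. Proof. exact: lt_trans q1. Qed.

Lemma conjM : (p - 1) * q = p.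
Proof.
have : p * q * (p^-1 + q^-1) = p * q by rewrite pq mulr1.
rewrite mulrDr mulrAC divff ?gt_eqF // mul1r mulfK ?gt_eqF // => h; lra.
Qed.

Lemma conjB : (p - 1) * (q - 1) = 1.
Proof. by rewrite mulrBr mulr1 conjM; ring. Qed.

Lemma lpsum_lpdual (x : 'rV[R]_n) : lpsum q (lpdual p x) = lpsum p x.
Proof.
apply: eq_bigr => i _; rewrite mxE.
have [->|x0] := eqVneq (x ord0 i) 0.
  by rewrite sgr0 mul0r normr0 !powR0 // gt_eqF.
by rewrite normrM normr_sg x0 mul1r (ger0_norm (powR_ge0 _ _)) -powRrM conjM.
Qed.

Lemma lpdualK (x : 'rV[R]_n) : lpdual q (lpdual p x) = x.
Proof.
apply/rowP => i; rewrite !mxE.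
have [->|x0] := eqVneq (x ord0 i) 0; first by rewrite sgr0 mul0r sgr0 mul0r.
have y0 : 0 < `|x ord0 i| `^ (p - 1) by rewrite powR_gt0 // normr_gt0.
rewrite sgrM (gtr0_sg y0) mulr1 sgr_id normrM normr_sg x0 mul1r (gtr0_norm y0).
by rewrite -powRrM conjB powRr1 // -numEsg.
Qed.

Lemma young_dot (x y : 'rV[R]_n) : dot x y <= lpsum p x / p + lpsum q y / q.
Proof.
rewrite /dot /lpsum !mulr_suml -big_split; apply: ler_sum => i _ /=.
apply: le_trans (ler_norm _) _; rewrite normrM.
exact: conjugate_powR.
Qed.

Lemma dot_le1 (x y : 'rV[R]_n) : lpsum p x <= 1 -> lpsum q y <= 1 -> dot x y <= 1.
Proof.
move=> x1 y1; apply: le_trans (young_dot x y) _; rewrite -[leRHS]pq.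
by apply: lerD; rewrite -[leRHS]mul1r ler_wpM2r // invr_ge0 ltW.
Qed.

End Conjugate.

Section Polarity.
Variables (n : nat) (p q : R).
Hypotheses (p1 : 1 < p) (q1 : 1 < q) (pq : p^-1 + q^-1 = 1).

Let q0 : 0 < q. Proof. exact: lt_trans q1. Qed.
Let qp : q^-1 + p^-1 = 1. Proof. by rewrite addrC. Qed.

Lemma lpnorm_gt0 (z : 'rV[R]_n) : z != 0 -> 0 < lpsum q z `^ q^-1.
Proof.
move=> z0; apply: powR_gt0; rewrite lt_def lpsum_ge0 andbT.
by apply: contra z0 => /eqP/lpsum_eq0 ->.
Qed.

(** Equality in Hölder, attained at the dual of the normalised [z]. By the last clause every nonzero
    functional is a positive multiple of some [lpdual p x], so every halfspace can be written like
    the one defining an [lpcap]. *)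
Lemma lp_support (z : 'rV[R]_n) : z != 0 -> exists x : 'rV[R]_n,
  [/\ lpsum p x = 1, dot x z = lpsum q z `^ q^-1 &
      z = (lpsum q z `^ q^-1) *: lpdual p x].
Proof.
move=> z0; have N0 := lpnorm_gt0 z0; set N := _ `^ _ in N0 *.
pose w := N^-1 *: z.
have zE : z = N *: w by rewrite /w scalerA mulfV ?scale1r // gt_eqF.
have w1 : lpsum q w = 1.
  rewrite lpsumZ normfV (gtr0_norm N0) -powR_inv1 ?ltW // -powRrM mulN1r powRN.
  rewrite -powRrM mulVf ?gt_eqF // powRr1 ?lpsum_ge0 // mulVf //.
  by rewrite gt_eqF // lt_def lpsum_ge0 andbT; apply: contra z0 => /eqP/lpsum_eq0 ->.
exists (lpdual q w); split; last by rewrite lpdualK.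
  by rewrite lpsum_lpdual.
by rewrite zE dotZ dot_lpdual // w1 mulr1.
Qed.

Lemma lpsum_le1 (z : 'rV[R]_n) : (lpsum q z `^ q^-1 <= 1) = (lpsum q z <= 1).
Proof. by rewrite powR_le1 ?invr_gt0 // lpsum_ge0. Qed.

(** Stands in for convexity of the ball: membership of hull points, floating body points and polars
    is tested against functionals. *)
Lemma lp_bipolar (z : 'rV[R]_n) :
  (forall x : 'rV[R]_n, lpsum p x <= 1 -> dot x z <= 1) -> lpsum q z <= 1.
Proof.
move=> H; have [->|z0] := eqVneq z 0.
  by rewrite /lpsum big1 // => i _; rewrite mxE normr0 powR0 // gt_eqF.
have [x [x1 xz _]] := lp_support z0.
by rewrite -lpsum_le1 -xz; apply: H; rewrite x1.
Qed.

Lemma polar_lp_ball : polar (lp_ball n p) = lp_ball n q.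
Proof.
apply/seteqP; split => y /= h; first exact: lp_bipolar.
by move=> x hx; exact: (dot_le1 p1 q1 pq).
Qed.

End Polarity.

Section ConvexHull.
Variables (n : nat).
Implicit Types (A : set 'rV[R]_n) (x y u : 'rV[R]_n).

Lemma sub_convex_hull A : A `<=` convex_hull A.
Proof. exact: sub_smallest. Qed.

Lemma convex_hull_conv A x y (t : R) : 0 <= t <= 1 ->
  convex_hull A x -> convex_hull A y -> convex_hull A (t *: x + (1 - t) *: y).
Proof.
move=> /andP[t0 t1] hx hy C [cC AC].
pose l : {i01 R} := Itv01 t0 t1.
have := cC x y l (mem_set (hx C (conj cC AC))) (mem_set (hy C (conj cC AC))).
by rewrite inE.
Qed.

Lemma convex_hull_halfspace A u c :
  (forall y, A y -> dot u y <= c) -> forall y, convex_hull A y -> dot u y <= c.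
Proof.
move=> H y hy; apply: (hy [set z | dot u z <= c]); split; last exact: H.
move=> a b l; rewrite !inE /= => ha hb.
rewrite -[X in dot u X]/(l%:num *: (a : 'rV[R]_n) + (1 - l%:num) *: (b : 'rV[R]_n)) dotD !dotZ.
have l1 : l%:num <= 1 by [].
have -> : c = l%:num * c + (1 - l%:num) * c by ring.
by apply: lerD; apply: ler_wpM2l => //; rewrite subr_ge0.
Qed.

End ConvexHull.

Section LpVolume.
Variables (n : nat) (p : R).
Hypotheses (n0 : (0 < n)%N) (p0 : 0 < p).

Lemma vmeas_lp_ball : vmeas (lp_ball n p).
Proof. by apply: vmeas_le; [exact: vmfun_lp|exact: vmfun_cst]. Qed.

Lemma volume_lp_ball_lty : (volume (lp_ball n p) < +oo)%E.
Proof.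
apply: le_lt_trans (vol_bounded ltr01 _) (ltry _) => x /= hx i.
exact: (@coord_le1 _ p).
Qed.

(** The cube of half-side [n^(-1/p)] is inscribed. *)
Lemma volume_lp_ball_gt0 : (0 < volume (lp_ball n p))%E.
Proof.
have np : 0 < (n%:R : R) by rewrite ltr0n.
have c0 : 0 < (n%:R : R) `^ (- p^-1) by rewrite powR_gt0.
have ci0 : ((n%:R : R) `^ (- p^-1))^-1 != 0 by rewrite invr_eq0 gt_eqF.
have [mI vI] := @volume_cube R n.
have [_ v] := vscale_homothety (0 : 'rV[R]_n) ci0 mI.
rewrite vI -EFinM in v.
have : (0 < (`|((n%:R : R) `^ (- p^-1))^-1|^-1 ^+ n * 2 ^+ n)%:E)%E.
  by rewrite lte_fin mulr_gt0 ?exprn_gt0 // invr_gt0 normr_gt0.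
rewrite -v => /lt_le_trans; apply; apply: le_volume => x /= h.
rewrite /lp_ball /=.
apply: le_trans (_ : \sum_(i < n) n%:R^-1 <= 1).
  apply: ler_sum => i _; have := h i.
  rewrite !mxE addr0 normrM normfV (gtr0_norm c0) mulrC ler_pdivrMr // mul1r => h1.
  have := @ge0_ler_powR _ p (ltW p0) _ _ (normr_ge0 _) _ h1.
  rewrite -powRrM mulNr mulVf ?gt_eqF // powR_inv1 ?ler0n //; apply.
  by rewrite nnegrE powR_ge0.
by rewrite sumr_const card_ord -[leLHS]mulr_natr mulVf // gt_eqF.
Qed.

End LpVolume.

End LpGeometry.

(** * Second order bounds for one coordinate *)

Section Caps.
Context {R : realType}.

Lemma sg_normpow (p x : R) : 1 < p -> Num.sg x * `|x| `^ (p - 1) = x * `|x| `^ (p - 2).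
Proof.
move=> p1; have [->|x0] := eqVneq x 0; first by rewrite sgr0 !mul0r.
rewrite {3}(numEsg x) -mulrA; congr (_ * _).
have -> : p - 2 = p - 1 - 1 by ring.
by rewrite mulr_powRB1 // subr_gt0.
Qed.

(** The second derivative [p (p-1) |t|^(p-2)] grows with [|t|] as [p > 2], so its bound is taken at
    [|x| + r]; this covers [x = 0] and both signs. *)
Lemma normpow_taylor_le (p x r w : R) : 2 < p -> `|w| <= r ->
  `|x + w| `^ p <= `|x| `^ p + p * (Num.sg x * `|x| `^ (p - 1)) * w +
    p / 2 * ((p - 1) * (`|x| + r) `^ (p - 2)) * w ^+ 2.
Proof.
move=> p2 wr; rewrite sg_normpow; last by lra.
have c0 : 0 < p - 2 by lra.
have r0 : 0 <= r := le_trans (normr_ge0 w) wr.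
have wE : w = x + w - x by ring.
rewrite {2 3}wE.
have -> : p / 2 * ((p - 1) * (`|x| + r) `^ (p - 2)) = p * ((p - 1) * (`|x| + r) `^ (p - 2)) / 2.
  by ring.
apply: (@taylor2_le _ (fun s : R => `|s| `^ p) (fun t => p * (t * `|t| `^ (p - 2)))
  (fun t => p * ((p - 2 + 1) * `|t| `^ (p - 2))) (- (`|x| + r)) (`|x| + r)).
- by move=> t _; exact: is_derive_normpow.
- by move=> t _; apply: is_derive_scal; exact: is_derive_spow.
- move=> t; rewrite -ler_norml => tx.
  apply: ler_wpM2l; first by lra.
  rewrite (_ : p - 2 + 1 = p - 1); last by ring.
  apply: ler_wpM2l; first by lra.
  by apply: ge0_ler_powR; rewrite ?nnegrE ?(ltW c0) ?(addr_ge0 (normr_ge0 x) r0) //.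
- by rewrite -ler_norml; lra.
- by rewrite -ler_norml; apply: le_trans (ler_normD _ _) _; lra.
Qed.

Lemma normpow_taylor_ge (p x r w : R) : 2 < p -> 0 <= r < x -> `|w| <= r ->
  x `^ p + p * x `^ (p - 1) * w +
    p / 2 * ((p - 1) * (x - r) `^ (p - 2)) * w ^+ 2 <= `|x + w| `^ p.
Proof.
move=> p2 /andP[r0 rx] wr; have c0 : 0 < p - 2 by lra.
have x0 : 0 < x by lra.
have -> : p / 2 * ((p - 1) * (x - r) `^ (p - 2)) = p * ((p - 1) * (x - r) `^ (p - 2)) / 2.
  by ring.
have -> : x `^ (p - 1) = x * `|x| `^ (p - 2).
  by rewrite -sg_normpow; [rewrite gtr0_sg // gtr0_norm // mul1r|lra].
have wE : w = x + w - x by ring.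
rewrite -{1}(gtr0_norm x0) {1 2}wE.
move: wr; rewrite ler_norml => /andP[w1 w2].
apply: (@taylor2_ge _ (fun s : R => `|s| `^ p) (fun t => p * (t * `|t| `^ (p - 2)))
  (fun t => p * ((p - 2 + 1) * `|t| `^ (p - 2))) (x - r) (x + r)).
- by move=> t _; exact: is_derive_normpow.
- by move=> t _; apply: is_derive_scal; exact: is_derive_spow.
- move=> t /andP[t1 t2]; have t0 : 0 < t by lra.
  apply: ler_wpM2l; first by lra.
  rewrite (_ : p - 2 + 1 = p - 1); last by ring.
  apply: ler_wpM2l; first by lra.
  by rewrite gtr0_norm //; apply: ge0_ler_powR; rewrite ?nnegrE //; lra.
- by lra.
- by lra.
Qed.

Lemma normpow_tangent (p x y : R) : 2 < p ->
  `|x| `^ p + p * (x * `|x| `^ (p - 2)) * (y - x) <= `|y| `^ p.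
Proof.
move=> p2; have c0 : 0 < p - 2 by lra.
have := @taylor2_ge _ (fun s : R => `|s| `^ p) (fun t => p * (t * `|t| `^ (p - 2)))
  (fun t => p * ((p - 2 + 1) * `|t| `^ (p - 2))) (Num.min x y) (Num.max x y) 0 x y.
rewrite mul0r mul0r addr0; apply.
- by move=> t _; exact: is_derive_normpow.
- by move=> t _; apply: is_derive_scal; exact: is_derive_spow.
- by move=> t _; rewrite !mulr_ge0 ?powR_ge0 //; lra.
- by rewrite ge_min le_max !lexx.
- by rewrite ge_min le_max !lexx !orbT.
Qed.

Lemma spow_homo (p : R) : 2 < p -> {homo (fun t : R => t * `|t| `^ (p - 2)) : x y / x <= y}.
Proof.
move=> p2 x y xy; have c0 : 0 < p - 2 by lra.
have [|c _] := @MVT_le _ (fun t : R => t * `|t| `^ (p - 2))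
   (fun t => (p - 2 + 1) * `|t| `^ (p - 2)) x y xy.
  by move=> t _; exact: is_derive_spow.
rewrite -subr_ge0 => ->; rewrite !mulr_ge0 ?powR_ge0 ?subr_ge0 //; lra.
Qed.

(** By convexity the quadratic gain reached at distance [r] is not lost further out: beyond [x + r]
    the slope is at least that at [x], and symmetrically on the left. *)
Lemma normpow_far (p x r w : R) : 2 < p -> 0 <= r < x -> r < `|w| ->
  x `^ p + p * x `^ (p - 1) * w +
    p / 2 * ((p - 1) * (x - r) `^ (p - 2)) * r ^+ 2 <= `|x + w| `^ p.
Proof.
move=> p2 /andP[r0 rx] rw; have x0 : 0 < x by lra.
have xE : x `^ (p - 1) = x * `|x| `^ (p - 2).
  by rewrite -sg_normpow; [rewrite gtr0_sg // gtr0_norm // mul1r|lra].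
have rr : `|r| <= r by rewrite ger0_norm.
have nrr : `|- r| <= r by rewrite normrN ger0_norm.
have rx' : 0 <= r < x by apply/andP.
have p0 : 0 < p by lra.
have [w0|w0] := leP 0 w.
  rewrite ger0_norm // in rw.
  have h1 := normpow_taylor_ge p2 rx' rr.
  have h2 := @normpow_tangent p (x + r) (x + w) p2.
  have h3 := @spow_homo p p2 x (x + r); rewrite lerDl r0 -xE in h3.
  have h4 := ler_wpM2r (_ : 0 <= p * (w - r)) (h3 isT); rewrite mulr_ge0 in h4; last 2 first.
  - exact: ltW.
  - by lra.
  move: (h4 isT) h1 h2; set F1 := _ * `|x + r| `^ _; set X := x `^ (p - 1).
  set D := (p - 1) * _; nra.
rewrite ltr0_norm // in rw.
have h1 := normpow_taylor_ge p2 rx' nrr.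
have h2 := @normpow_tangent p (x - r) (x + w) p2.
have h3 := @spow_homo p p2 (x - r) x; rewrite gerBl r0 -xE in h3.
have h4 := ler_wpM2r (_ : 0 <= p * (- r - w)) (h3 isT); rewrite mulr_ge0 in h4; last 2 first.
- exact: ltW.
- by lra.
rewrite sqrrN in h1; move: (h4 isT) h1 h2; set F1 := _ * `|x - r| `^ _; set X := x `^ (p - 1).
set D := (p - 1) * _; nra.
Qed.

(** For an exponent below 2 the second derivative blows up at 0 and decreases, so it is bounded by
    its value at [x / 2]. *)
Lemma powR_taylor_le (q x w : R) : 1 < q < 2 -> 0 < x -> `|w| <= x / 2 ->
  `|x + w| `^ q <= x `^ q + q * x `^ (q - 1) * w +
    q / 2 * ((q - 1) * (x / 2) `^ (q - 2)) * w ^+ 2.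
Proof.
move=> /andP[q1 q2] x0; rewrite ler_norml => /andP[w1 w2].
have wE : w = x + w - x by ring.
rewrite {2 3}wE gtr0_norm; last by lra.
have -> : q / 2 * ((q - 1) * (x / 2) `^ (q - 2)) = q * ((q - 1) * (x / 2) `^ (q - 2)) / 2.
  by ring.
apply: (@taylor2_le _ (fun s : R => s `^ q) (fun t => q * t `^ (q - 1))
  (fun t => q * ((q - 1) * t `^ (q - 1 - 1))) (x / 2) (x + x / 2)).
- by move=> t /andP[t1 t2]; apply: is_derive1_powR; lra.
- by move=> t /andP[t1 t2]; apply: is_derive_scal; apply: is_derive1_powR; lra.
- move=> t /andP[t1 t2]; have t0 : 0 < t by lra.
  apply: ler_wpM2l; first by lra.
  apply: ler_wpM2l; first by lra.
  have -> : q - 1 - 1 = - (2 - q) by ring.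
  have -> : q - 2 = - (2 - q) by ring.
  rewrite !powRN lef_pV2 ?posrE ?powR_gt0 //; last by lra.
  by apply: ge0_ler_powR; rewrite ?nnegrE //; lra.
- by lra.
- by lra.
Qed.

End Caps.

(** * Comparison of caps with quadrics *)

Section CapVolume.
Context {R : realType}.

Definition lpcap n (p : R) (x : 'rV[R]_n) (tau : R) : set 'rV[R]_n :=
  lp_ball n p `&` [set y | 1 - tau <= dot (lpdual p x) y].

Lemma vmeas_lpcap n p (x : 'rV[R]_n) tau : vmeas (lpcap p x tau).
Proof.
apply: vmeasI; first exact: vmeas_lp_ball.
by apply: vmeas_le; [exact: vmfun_cst|exact: vmfun_dotr].
Qed.

(** [2 * tau <= r ^+ 2 * dm] confines the quadric to [|w_i| <= r], where the coordinatewise Taylor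
    bounds hold; in their sum the linear term outweighs the quadratic one. *)
Lemma quadric_le_cap n (p : R) (x : 'rV[R]_n) (d : 'I_n -> R) (r dm tau : R) :
  0 < p -> lpsum p x = 1 -> 0 < dm -> (forall i, dm <= d i) -> 0 < r ->
  2 * tau <= r ^+ 2 * dm ->
  (forall i w, `|w| <= r -> `|x ord0 i + w| `^ p <=
     `|x ord0 i| `^ p + p * (lpdual p x) ord0 i * w + p / 2 * d i * w ^+ 2) ->
  (volume (quadric d (lpdual p x) tau) <= volume (lpcap p x tau))%E.
Proof.
move=> p0 x1 dm0 dmd r0 tr H.
have [_] := vscale_translate x (vmeas_lpcap p x tau); rewrite mul1e => <-.
apply: le_volume => w /andP[h1 h2].
have dw i : 0 <= d i * w ord0 i ^+ 2.
  by rewrite mulr_ge0 ?sqr_ge0 //; apply: le_trans (dmd i); exact: ltW.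
have wr i : `|w ord0 i| <= r.
  rewrite -(@ler_pXn2r _ 2) ?nnegrE ?(ltW r0) // real_normK ?num_real //.
  rewrite -(ler_pM2r dm0); apply: le_trans tr.
  apply: le_trans (_ : d i * w ord0 i ^+ 2 <= _).
    by rewrite mulrC; apply: ler_wpM2r; rewrite ?sqr_ge0.
  apply: le_trans (_ : \sum_i d i * w ord0 i ^+ 2 <= _); last by lra.
  by rewrite (bigD1 i) //= lerDl; apply: sumr_ge0.
split; rewrite /lp_ball /=; last first.
  by rewrite dotD dot_lpdual // x1; lra.
have -> : (1 : R) = \sum_(i < n) `|x ord0 i| `^ p by rewrite -x1.
apply: le_trans (_ : \sum_(i < n) (`|x ord0 i| `^ p +
   p * (lpdual p x ord0 i * w ord0 i + 2^-1 * (d i * w ord0 i ^+ 2))) <= _).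
  apply: ler_sum => i _; rewrite mxE [w ord0 i + _]addrC; apply: le_trans (H i _ (wr i)) _.
  by rewrite le_eqVlt; apply/orP; left; apply/eqP; field.
rewrite big_split /= gerDl -mulr_sumr big_split /= -mulr_sumr.
by apply: mulr_ge0_le0; [exact: ltW|rewrite /dot in h1; lra].
Qed.

(** On the cap the Taylor remainders of the coordinates are nonnegative with sum at most
    [p * tau < c], so none can reach [c] and no coordinate leaves the radius [r]. *)
Lemma cap_le_quadric n (p : R) (x : 'rV[R]_n) (d r c tau : R) :
  0 < p -> lpsum p x = 1 -> 0 < d -> 0 < c -> p * tau < c ->
  (forall i w, `|w| <= r ->
     `|x ord0 i| `^ p + p * (lpdual p x) ord0 i * w + p / 2 * d * w ^+ 2 <=
     `|x ord0 i + w| `^ p) ->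
  (forall i w, r < `|w| ->
     `|x ord0 i| `^ p + p * (lpdual p x) ord0 i * w + c <= `|x ord0 i + w| `^ p) ->
  (volume (lpcap p x tau) <= volume (quadric (fun=> d) (lpdual p x) tau))%E.
Proof.
move=> p0 x1 d0 c0 tc H1 H2.
have [_] := vscale_translate x (vmeas_lpcap p x tau); rewrite mul1e => <-.
apply: le_volume => w [/=]; rewrite dotD dot_lpdual // x1 => h1 h2.
pose rem i := `|x ord0 i + w ord0 i| `^ p - `|x ord0 i| `^ p - p * lpdual p x ord0 i * w ord0 i.
have rem0 i : 0 <= rem i.
  have [wr|wr] := leP `|w ord0 i| r.
    have := H1 i _ wr; rewrite /rem.
    have : 0 <= p / 2 * d * w ord0 i ^+ 2.
      by rewrite mulr_ge0 ?sqr_ge0 // mulr_ge0 ?divr_ge0 // ltW.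
    lra.
  by have := H2 i _ wr; rewrite /rem; lra.
have srem : \sum_i rem i <= - (p * dot (lpdual p x) w).
  have -> : \sum_i rem i = lpsum p (w + x) - lpsum p x - p * dot (lpdual p x) w.
    rewrite /dot mulr_sumr /lpsum -!sumrB; apply: eq_bigr => i _.
    rewrite /rem mulrA (_ : (w + x) ord0 i = x ord0 i + w ord0 i) //.
    by rewrite mxE addrC.
  by rewrite x1; move: h1; rewrite /lp_ball /= -/(lpsum p (w + x)); lra.
have remc i : rem i < c.
  apply: le_lt_trans (_ : p * tau < c) => //; apply: le_trans (_ : \sum_i rem i <= _).
    by rewrite (bigD1 i) //= lerDl; apply: sumr_ge0.
  apply: le_trans srem _; rewrite -mulrN; apply: ler_wpM2l; first exact: ltW.
  lra.
have wr i : `|w ord0 i| <= r.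
  rewrite leNgt; apply/negP => /(H2 i); have := remc i; rewrite /rem; lra.
apply/andP; split; last by lra.
rewrite -(ler_pM2l p0) mulrN; apply: le_trans srem.
rewrite mulrA mulr_sumr; apply: ler_sum => i _.
by have := H1 i _ (wr i); rewrite /rem; lra.
Qed.

End CapVolume.

(** * Sharp cap volumes: below everywhere, above at the diagonal point *)

Section UniformCaps.
Context {R : realType}.
Variables (m : nat) (p : R).
Hypotheses (m0 : (0 < m)%N) (p2 : 2 < p).
Local Notation n := m.+1.

Let p0 : 0 < p. Proof. by apply: lt_trans p2. Qed.
Let p1 : 1 < p. Proof. by apply: lt_trans p2; rewrite ltr1n. Qed.
Let p20 : 0 <= p - 2. Proof. by rewrite subr_ge0 ltW. Qed.
Let n0 : 0 < (n%:R : R). Proof. by rewrite ltr0n. Qed.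

Definition diag_coord : R := n%:R `^ (- p^-1).
Local Notation xi := diag_coord.

Lemma diag_coord_gt0 : 0 < xi. Proof. by rewrite powR_gt0. Qed.

Lemma diag_coord_pow : xi `^ p = n%:R^-1.
Proof. by rewrite /xi -powRrM mulNr mulVf ?gt_eqF // powR_inv1 ?ler0n. Qed.

Definition diag_point : 'rV[R]_n := const_mx xi.

Lemma lpsum_const (a q : R) : 0 <= a -> lpsum q (const_mx a : 'rV[R]_n) = n%:R * a `^ q.
Proof.
move=> a0; rewrite /lpsum; under eq_bigr do rewrite mxE ger0_norm //.
by rewrite sumr_const card_ord mulr_natl.
Qed.

Lemma lpsum_diag_point : lpsum p diag_point = 1.
Proof. by rewrite lpsum_const ?diag_coord_pow ?mulfV ?gt_eqF // ltW // diag_coord_gt0. Qed.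

(** Hölder against the constant vector with entries [xi^(p-1)], the dual of [diag_point]. *)
Lemma sum_coord_le (x : 'rV[R]_n) : lpsum p x = 1 -> \sum_i `|x ord0 i| <= n%:R * xi.
Proof.
move=> x1; pose q := p / (p - 1).
have p10 : 0 < p - 1 by (move: p2; lra).
have q1 : 1 < q by rewrite /q ltr_pdivlMr //; (move: p2; lra).
have pq : p^-1 + q^-1 = 1 by rewrite /q; field; rewrite !gt_eqF.
have xp0 : 0 < xi `^ (p - 1) by rewrite powR_gt0 // diag_coord_gt0.
have := @dot_le1 _ n p q p1 q1 pq (\row_i `|x ord0 i|) (const_mx (xi `^ (p - 1))).
rewrite lpsum_const ?(ltW xp0) // -powRrM (conjM p1 q1 pq) diag_coord_pow mulfV ?gt_eqF //.
move=> H; have : dot (\row_i `|x ord0 i|) (const_mx (xi `^ (p - 1)) : 'rV[R]_n) <= 1.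
  apply: H => //; rewrite -x1 le_eqVlt; apply/orP; left; apply/eqP.
  by apply: eq_bigr => i _; rewrite mxE normr_id.
rewrite /dot; under eq_bigr do rewrite !mxE.
rewrite -mulr_suml -(ler_pM2r diag_coord_gt0) mul1r -mulrA (mulrC _ xi).
rewrite mulr_powRB1 ?(ltW diag_coord_gt0) // diag_coord_pow.
by rewrite ler_pdivrMr // mulrC.
Qed.

Lemma prod_powR (I : finType) (f : I -> R) (c : R) : (forall i, 0 <= f i) ->
  \prod_i (f i `^ c) = (\prod_i f i) `^ c.
Proof.
move=> f0; suff : 0 <= \prod_i f i /\ \prod_i (f i `^ c) = (\prod_i f i) `^ c by case.
elim/big_ind2 : _ => [|a b a' b' [h1 ->] [h2 ->]|i _]; first by rewrite powR1.
  by rewrite mulr_ge0 // powRM.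
by [].
Qed.

(** The shift [r] is the same in all coordinates, so the diagonal point remains extremal after
    regularisation. *)
Lemma prod_coord_le (x : 'rV[R]_n) (r : R) : lpsum p x = 1 -> 0 <= r ->
  \prod_i ((`|x ord0 i| + r) `^ (p - 2)) <= ((xi + r) `^ (p - 2)) ^+ n.
Proof.
move=> x1 r0; have c0 : 0 <= p - 2 by (move: p2; lra).
have a0 i : 0 <= `|x ord0 i| + r by rewrite addr_ge0.
have xr0 : 0 <= xi + r by rewrite addr_ge0 // ltW // diag_coord_gt0.
rewrite prod_powR // -powR_mulrn ?powR_ge0 // powRAC powR_mulrn //.
apply: ge0_ler_powR; rewrite ?nnegrE ?exprn_ge0 ?prodr_ge0 //.
have [|] := @leif_AGM_scaled R 'I_n predT (fun i => `|x ord0 i| + r).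
  by move=> i _; rewrite mulrn_wge0.
rewrite cardT size_enum_ord => h _.
rewrite -(ler_pM2r (exprn_gt0 n n0)) -exprMn.
apply: le_trans (_ : (\sum_(i in 'I_n) (`|x ord0 i| + r)) ^+ n <= _).
  apply: le_trans h; rewrite -[X in _ * X]/(n%:R ^+ n).
  rewrite -[X in _ * _ ^+ X](card_ord n) -prodr_const -big_split /=.
  by rewrite le_eqVlt; apply/orP; left; apply/eqP/eq_bigr => i _; rewrite mulr_natr.
rewrite lerXn2r ?nnegrE ?mulr_ge0 ?ler0n // ?sumr_ge0 //.
rewrite big_split /= sumr_const card_ord mulrDl (mulrC xi) mulr_natr.
by rewrite lerD2r; exact: sum_coord_le.
Qed.

(* [p * weight r x i] bounds the second derivative of [`|t| `^ p] at distance at most [r]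
   from [x ord0 i]; the positive [r] keeps it away from [0] when [x ord0 i = 0]. *)
Definition weight (r : R) (x : 'rV[R]_n) i : R := (p - 1) * (`|x ord0 i| + r) `^ (p - 2).
(** Bounds the product of the [n] weights times the sum [A] below; the latter contributes a factor
    [(p - 1)^-1], whence the exponent [m]. *)
Definition Dbound (r : R) : R := (p - 1) ^+ m * ((xi + r) `^ (p - 2)) ^+ n.

Lemma sqr_lpdual (x : 'rV[R]_n) i :
  (lpdual p x ord0 i) ^+ 2 = `|x ord0 i| `^ p * `|x ord0 i| `^ (p - 2).
Proof.
rewrite mxE; have [->|x0] := eqVneq (x ord0 i) 0.
  by rewrite normr0 (@powR0 _ p) ?gt_eqF // sgr0 !mul0r expr0n.
have nx : 0 < `|x ord0 i| by rewrite normr_gt0.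
rewrite exprMn sqr_sg x0 mul1r expr2 -!powRD ?(gt_eqF nx) ?implybT //.
by congr (_ `^ _); ring.
Qed.

Section Weights.
Variables (r : R) (x : 'rV[R]_n).
Hypotheses (r0 : 0 < r) (r1 : r <= 1) (x1 : lpsum p x = 1).

Lemma weight_ge i : (p - 1) * r `^ (p - 2) <= weight r x i.
Proof.
apply: ler_wpM2l; first by (move: p2; lra).
by apply: ge0_ler_powR; rewrite ?p20 ?nnegrE ?addr_ge0 ?(ltW r0) // ?lerDr //; (move: p2; lra).
Qed.

Lemma weight_gt0 i : 0 < weight r x i.
Proof. by apply: lt_le_trans (weight_ge i); rewrite mulr_gt0 ?powR_gt0 //; (move: p2; lra). Qed.

Let A := \sum_i lpdual p x ord0 i ^+ 2 / weight r x i.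

Lemma weight_sum_le : A <= (p - 1)^-1.
Proof.
have p10 : 0 < p - 1 by (move: p2; lra).
have -> : (p - 1)^-1 = lpsum p x * (p - 1)^-1 by rewrite x1 mul1r.
rewrite mulr_suml; apply: ler_sum => i _.
rewrite ler_pdivrMr ?weight_gt0 // sqr_lpdual -mulrA; apply: ler_wpM2l.
  exact: powR_ge0.
rewrite /weight mulrA mulVf ?gt_eqF // mul1r.
by apply: ge0_ler_powR; rewrite ?p20 ?nnegrE ?addr_ge0 ?(ltW r0) // ?lerDl ?(ltW r0) //; (move: p2; lra).
Qed.

(** Some coordinate has [|x_i|^p >= 1/n], hence also [|x_i|^(p-2) >= 1/n], and its weight is at most
    [(p - 1) * 2^(p-2)] when [r <= 1]. The bound is uniform in [x], as the loss [tau / (2 * A)] must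
    be. *)
Definition Alow : R := n%:R^-1 ^+ 2 / ((p - 1) * 2 `^ (p - 2)).

Lemma Alow_gt0 : 0 < Alow.
Proof. by rewrite divr_gt0 ?exprn_gt0 ?invr_gt0 // mulr_gt0 ?powR_gt0 //; (move: p2; lra). Qed.

Lemma weight_sum_ge : Alow <= A.
Proof.
have [i hi] : exists i, n%:R^-1 <= `|x ord0 i| `^ p.
  apply: contrapT => H.
  suff : lpsum p x < 1 by rewrite x1 ltxx.
  rewrite -(mulfV (lt0r_neq0 n0)) mulr_natl -[X in _ *+ X](card_ord n) -sumr_const.
  apply: ltr_sum => [|i _]; first by apply/hasP; exists ord0 => //; exact: mem_index_enum.
  by rewrite ltNge; apply/negP => h; apply: H; exists i.
have xi1 : `|x ord0 i| <= 1 by apply: (@coord_le1 _ _ p) => //; rewrite x1.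
have ni : 0 < n%:R^-1 :> R by rewrite invr_gt0.
have hi2 : n%:R^-1 <= `|x ord0 i| `^ (p - 2).
  apply: le_trans hi _; have [->|x0] := eqVneq `|x ord0 i| 0.
    by rewrite !powR0 ?gt_eqF //; (move: p2; lra).
  by apply: ger_powR; [rewrite lt_def x0 normr_ge0|(move: p2; lra)].
rewrite /A (bigD1 i) //=; apply: ler_wpDr.
  by apply: sumr_ge0 => j _; rewrite divr_ge0 ?sqr_ge0 // ltW // weight_gt0.
rewrite /Alow ler_pdivlMr ?weight_gt0 // mulrAC ler_pdivrMr; last first.
  by rewrite mulr_gt0 ?powR_gt0 //; (move: p2; lra).
rewrite sqr_lpdual; apply: ler_pM.
- by rewrite exprn_ge0 // ltW.
- by rewrite ltW // weight_gt0.
- by rewrite expr2; apply: ler_pM => //; exact: ltW.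
- apply: ler_wpM2l; first by (move: p2; lra).
  by apply: ge0_ler_powR; rewrite ?p20 ?nnegrE ?addr_ge0 ?(ltW r0) //; (move: p2 r1 xi1; lra).
Qed.

Lemma weight_prod_le : A * \prod_i weight r x i <= Dbound r.
Proof.
have p10 : 0 < p - 1 by (move: p2; lra).
rewrite /weight big_split /= prodr_const card_ord /Dbound.
have P0 : 0 <= \prod_i ((`|x ord0 i| + r) `^ (p - 2)).
  by apply: prodr_ge0 => i _; exact: powR_ge0.
apply: le_trans (_ : (p - 1)^-1 * ((p - 1) ^+ n * \prod_i ((`|x ord0 i| + r) `^ (p - 2))) <= _).
  by apply: ler_wpM2r; [rewrite mulr_ge0 // exprn_ge0 // ltW|exact: weight_sum_le].
rewrite exprS !mulrA mulVf ?gt_eqF // mul1r; apply: ler_wpM2l.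
  by rewrite exprn_ge0 // ltW.
by apply: prod_coord_le => //; exact: ltW.
Qed.

End Weights.

(* Caps of height [tau] have volume at least about [capconst * tau `^ (m%:R / 2 + 1)], with
   equality in the limit at [diag_point]. *)
Definition capconst : R := kappa m / Num.sqrt (Dbound 0).
Local Notation e := (m%:R / 2 + 1 : R).

Lemma Dbound_gt0 r : - xi < r -> 0 < Dbound r.
Proof.
by move=> r0; rewrite mulr_gt0 // exprn_gt0 ?powR_gt0 //; [move: p2|]; lra.
Qed.

Lemma Dbound_cvg (f : R -> R) : f r @[r --> 0^'+] --> 0 ->
  Dbound (f r) @[r --> 0^'+] --> Dbound 0.
Proof.
move=> f0; have xi0 := diag_coord_gt0.
apply: cvgM; first exact: cvg_cst.
have h1 : xi + f r @[r --> 0^'+] --> xi + 0 by apply: cvgD; [exact: cvg_cst|exact: f0].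
have h2 : {for xi + 0, continuous (fun t : R => t `^ (p - 2))}.
  apply: differentiable_continuous; apply/derivable1_diffP.
  by apply: derivable_powR; rewrite addr0 in_itv /= xi0.
have h3 := cvg_comp _ _ h1 h2.
exact: (cvg_comp _ _ h3 (@exprn_continuous R n _)).
Qed.

Lemma sqrt_cvg (f : R -> R) (l : R) : f r @[r --> 0^'+] --> l ->
  Num.sqrt (f r) @[r --> 0^'+] --> Num.sqrt l.
Proof. by move=> f0; apply: (cvg_comp _ _ f0 (@sqrt_continuous R _)). Qed.

(** The order of choices gives uniformity: [r] is fixed from [c] alone, and [tau0] from [r], before
    [x] is known. *)
Lemma cap_lower (c : R) : c < capconst -> exists2 tau0, 0 < tau0 &
  forall (x : 'rV[R]_n) tau, lpsum p x = 1 -> 0 < tau <= tau0 ->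
  ((c * tau `^ e)%:E <= volume (lpcap p x tau))%E.
Proof.
move=> cc; have xi0 := diag_coord_gt0.
have D0 : 0 < Dbound 0 by apply: Dbound_gt0; rewrite oppr_lt0.
have idc : (r : R) @[r --> 0^'+] --> (0 : R) by apply: cvg_at_right_filter; exact: cvg_id.
have lim : kappa m * Num.sqrt (1 - r) ^+ m / Num.sqrt (Dbound r) @[r --> 0^'+] --> capconst.
  apply: cvgM; last first.
    by apply: cvgV; [rewrite gt_eqF // sqrtr_gt0|exact: (@sqrt_cvg Dbound _ (@Dbound_cvg id idc))].
  rewrite -[X in _ --> X]mulr1; apply: cvgM; first exact: cvg_cst.
  have h : Num.sqrt (1 - r : R) @[r --> 0^'+] --> Num.sqrt (1 - 0 : R).
    apply: (@sqrt_cvg (fun r => 1 - r)).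
    by apply: cvgB; [exact: cvg_cst|exact: idc].
  have := cvg_comp _ _ h (@exprn_continuous R m _).
  by rewrite subr0 sqrtr1 expr1n.
near (0 : R)^'+ => r.
have r0 : 0 < r by near: r; exact: nbhs_right_gt.
have r1 : r <= 1 by near: r; exact: nbhs_right_le.
have cr : c < kappa m * Num.sqrt (1 - r) ^+ m / Num.sqrt (Dbound r).
  by near: r; exact: (cvgr_gt capconst).
pose dm := (p - 1) * r `^ (p - 2).
have dm0 : 0 < dm by rewrite mulr_gt0 ?powR_gt0 //; move: p2; lra.
(* The first entry makes the loss [tau / (2 * A)] at most [r]; the second keeps the quadric within
   radius [r]. *)
exists (Num.min (2 * r * Alow) (r ^+ 2 * dm / 2)).
  have h1 : 0 < 2 * r by rewrite mulr_gt0.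
  by rewrite lt_min (mulr_gt0 h1 Alow_gt0) divr_gt0 // (mulr_gt0 _ dm0) // exprn_gt0.
move=> x tau x1 /andP[tau0]; rewrite le_min => /andP[t1 t2].
have wgt i := weight_gt0 x r0 i.
have Q : (volume (quadric (weight r x) (lpdual p x) tau) <= volume (lpcap p x tau))%E.
  apply: (@quadric_le_cap _ _ p x (weight r x) r dm tau p0 x1 dm0 (weight_ge x r0) r0).
    by move: t2; lra.
  by move=> i w wr; rewrite mxE /weight; exact: normpow_taylor_le.
apply: le_trans Q.
set A := \sum_i lpdual p x ord0 i ^+ 2 / weight r x i.
have A0 : Alow <= A := weight_sum_ge r0 r1 x1.
have Ap : 0 < A := lt_le_trans Alow_gt0 A0.
have rA : tau / (2 * A) <= r.
  rewrite ler_pdivrMr ?mulr_gt0 // (le_trans t1) // (_ : r * (2 * A) = 2 * r * A); last by ring.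
  by apply: ler_wpM2l => //; rewrite mulr_ge0 // ltW.
apply: le_trans (volume_quadric_ge m0 wgt Ap tau0 _); last first.
  have A2 : 0 < 2 * A by rewrite mulr_gt0.
  by have := le_trans rA r1; rewrite ler_pdivrMr // mul1r.
rewrite lee_fin -/A [leRHS]mulrAC; apply: ler_wpM2r; first exact: powR_ge0.
apply: (le_trans (ltW cr)).
have k0 : 0 <= kappa m :> R.
  by rewrite /kappa divr_ge0 ?mulr_ge0 ?omega_ge0 ?powR_ge0 // addr_ge0 // divr_ge0.
have P0 : 0 < A * \prod_i weight r x i by rewrite mulr_gt0 // prodr_gt0.
apply: ler_pM.
- by rewrite mulr_ge0 // exprn_ge0 // sqrtr_ge0.
- by rewrite invr_ge0 sqrtr_ge0.
- apply: ler_wpM2l => //; rewrite lerXn2r ?nnegrE ?sqrtr_ge0 //.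
  by rewrite ler_wsqrtr // lerD2l lerN2.
- rewrite lef_pV2 ?posrE ?sqrtr_gt0 //; last by apply: Dbound_gt0; lra.
  by rewrite ler_wsqrtr //; exact: weight_prod_le.
Unshelve. all: by end_near. Qed.

Lemma lpdual_const (a q : R) i : 0 < a -> lpdual q (const_mx a : 'rV[R]_n) ord0 i = a `^ (q - 1).
Proof. by move=> a0; rewrite !mxE gtr0_sg // gtr0_norm // mul1r. Qed.

Lemma cap_upper (c : R) : capconst < c -> exists2 tau0, 0 < tau0 &
  forall tau, 0 < tau <= tau0 ->
  (volume (lpcap p diag_point tau) <= (c * tau `^ e)%:E)%E.
Proof.
move=> cc; have xi0 := diag_coord_gt0.
have D0 : 0 < Dbound 0 by apply: Dbound_gt0; rewrite oppr_lt0.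
have idc : (r : R) @[r --> 0^'+] --> (0 : R) by apply: cvg_at_right_filter; exact: cvg_id.
have lim : kappa m / Num.sqrt (Dbound (- r)) @[r --> 0^'+] --> capconst.
  apply: cvgM; first exact: cvg_cst.
  apply: cvgV; [by rewrite gt_eqF // sqrtr_gt0|].
  apply: (@sqrt_cvg (fun r => Dbound (- r))); apply: (@Dbound_cvg (fun r => - r)).
  by rewrite -[X in _ --> X]oppr0; exact: cvgN.
near (0 : R)^'+ => r.
have r1 : r < xi by near: r; exact: nbhs_right_lt.
have cr : kappa m / Num.sqrt (Dbound (- r)) < c.
  by near: r; exact: (cvgr_lt capconst).
have rx : 0 <= r < xi by rewrite ltW.
pose d := (p - 1) * (xi - r) `^ (p - 2).
have d0 : 0 < d by rewrite mulr_gt0 ?powR_gt0 //; [move: p2|]; lra.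
pose cr2 := p / 2 * d * r ^+ 2.
have cr20 : 0 < cr2 by rewrite mulr_gt0 ?exprn_gt0 // mulr_gt0 // divr_gt0.
(* Ensures [p * tau < cr2], where [cr2] is the gain of a coordinate beyond radius [r] in
   [normpow_far]. *)
exists (cr2 / p / 2); first by rewrite !divr_gt0.
move=> tau /andP[tau0 t1].
set u := lpdual p diag_point.
have Q : (volume (lpcap p diag_point tau) <= volume (quadric (fun=> d) u tau))%E.
  apply: (@cap_le_quadric _ _ p diag_point d r cr2 tau p0 lpsum_diag_point d0 cr20).
  - move: t1; rewrite ler_pdivlMr // ler_pdivlMr // => t1.
    by apply: lt_le_trans t1; rewrite mulrAC (mulrC p) ltr_pMr ?mulr_gt0 // ltr1n.
  - move=> i w wr; rewrite lpdual_const // mxE (gtr0_norm xi0).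
    exact: normpow_taylor_ge.
  - move=> i w wr; rewrite lpdual_const // mxE (gtr0_norm xi0).
    exact: normpow_far.
apply: (le_trans Q).
have uE i : u ord0 i = xi `^ (p - 1) by rewrite lpdual_const.
have xp0 : 0 < xi `^ (p - 1) by rewrite powR_gt0.
have AE : \sum_i u ord0 i ^+ 2 / d = n%:R * (xi `^ (p - 1)) ^+ 2 / d.
  under eq_bigr do rewrite uE.
  by rewrite sumr_const card_ord -mulrA mulr_natl.
have A0 : 0 < \sum_i u ord0 i ^+ 2 / d.
  by rewrite AE divr_gt0 // mulr_gt0 // exprn_gt0.
apply: le_trans (volume_quadric_le m0 (fun=> d0) A0 tau0) _.
rewrite lee_fin mulrAC; apply: ler_wpM2r; first exact: powR_ge0.
apply: le_trans (ltW cr).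
have k0 : 0 <= kappa m :> R.
  by rewrite /kappa divr_ge0 ?mulr_ge0 ?omega_ge0 ?powR_ge0 // addr_ge0 // divr_ge0.
apply: ler_wpM2l => //.
have Dr0 : 0 < Dbound (- r) by apply: Dbound_gt0; lra.
have DA : Dbound (- r) <= (\sum_i u ord0 i ^+ 2 / d) * \prod_(i < n) d.
  rewrite AE prodr_const card_ord (exprS d) mulrA divfK ?gt_eqF //.
  (* Follows from [n * xi^p = 1]; it cancels the dimension from the gradient factor. *)
  have -> : n%:R * xi `^ (p - 1) ^+ 2 = xi `^ (p - 2).
    have h1 : xi * xi `^ (p - 1) = n%:R^-1 by rewrite mulr_powRB1 ?(ltW xi0) // diag_coord_pow.
    have h2 : xi * xi `^ (p - 2) = xi `^ (p - 1).
      have -> : p - 2 = p - 1 - 1 by ring.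
      by rewrite mulr_powRB1 ?(ltW xi0) // subr_gt0.
    apply: (mulfI (lt0r_neq0 xi0)); rewrite h2.
    transitivity (n%:R * (xi * xi `^ (p - 1)) * xi `^ (p - 1)); first by ring.
    by rewrite h1 mulfV ?mul1r // gt_eqF.
  rewrite /Dbound /d exprMn mulrCA; apply: ler_wpM2l.
    by rewrite exprn_ge0 //; move: p2; lra.
  rewrite exprS; apply: ler_wpM2r; first by rewrite exprn_ge0 // powR_ge0.
  by apply: ge0_ler_powR; rewrite ?p20 ?nnegrE //; lra.
rewrite lef_pV2 ?posrE ?sqrtr_gt0 //; last exact: lt_le_trans DA.
by rewrite ler_wsqrtr.
Unshelve. all: by end_near. Qed.

End UniformCaps.

(** * Asymptotics of the distance *)

Section Illumination.
Context {R : realType}.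

(** The midpoints of [z] and the points of the cap lie in the hull and outside [K]: there [dot x] is
    at least [((1 - eta/2) + (1 + eta)) / 2 > 1]. They form a copy of the cap scaled by one half. *)
Lemma volume_hull_ge n (K : set 'rV[R]_n) (x z : 'rV[R]_n) (eta : R) :
  vmeas K -> 0 < eta -> (forall y, K y -> dot x y <= 1) -> 1 + eta <= dot x z ->
  (volume K + (2^-1 ^+ n)%:E * volume (K `&` [set y | (1 - eta / 2 <= dot x y)%R]) <=
   volume (convex_hull (K `|` [set z])))%E.
Proof.
move=> mK eta0 Kx xz; pose A := K `&` [set y | 1 - eta / 2 <= dot x y].
have mA : vmeas A.
  by apply: vmeasI => //; apply: vmeas_le; [exact: vmfun_cst|exact: vmfun_dotr].
have two0 : (2 : R) != 0 by rewrite pnatr_eq0.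
have [mP vP] := vscale_homothety (- z) two0 mA.
rewrite normr_nat in vP; rewrite -vP -volumeU //; last first.
  apply/seteqP; split => v //= [Kv [_ /=]].
  have := Kx _ Kv; rewrite dotD dotZ dotN; lra.
apply: le_volume => v [Kv|[Kv _]]; first by apply: sub_convex_hull; left.
have -> : v = 2^-1 *: (2 *: v - z) + (1 - 2^-1) *: z.
  by apply/rowP => i; rewrite !mxE; field.
apply: convex_hull_conv; first by apply/andP; split; lra.
  by apply: sub_convex_hull; left.
by apply: sub_convex_hull; right.
Qed.

Section Dual.
Variables (n : nat) (p q : R).
Hypotheses (n0 : (0 < n)%N) (p1 : 1 < p) (q1 : 1 < q) (pq : p^-1 + q^-1 = 1).

Let p0 : 0 < p. Proof. exact: lt_trans p1. Qed.
Let q0 : 0 < q. Proof. exact: lt_trans q1. Qed.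
Let K : set 'rV[R]_n := lp_ball n q.

Lemma fin_volume_lp_ball : volume K = (fine (volume K))%:E.
Proof.
rewrite fineK // ge0_fin_numE ?volume_ge0 //; exact: volume_lp_ball_lty.
Qed.

Lemma fine_volume_lp_ball_gt0 : 0 < fine (volume K).
Proof. by rewrite -lte_fin -fin_volume_lp_ball; exact: volume_lp_ball_gt0. Qed.

Lemma illumination_body_small (eta : R) : 0 < eta <= 1 -> exists2 del : R, 0 < del &
  forall z, illumination_body del K z -> forall x : 'rV[R]_n, lpsum p x <= 1 -> dot x z <= 1 + eta.
Proof.
(* The cap in [volume_hull_ge] contains the copy of [K] shrunk by [k] towards the contact point
   [lpdual p y], on which [dot y] is at least [1 - 2 * k = 1 - eta / 2]. This bounds the added
   volume below by [c] times that of [K]. *)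
move=> /andP[eta0 eta1]; pose k := eta / 4.
have k0 : 0 < k by rewrite divr_gt0.
have k1 : k <= 1 by rewrite /k; lra.
pose c := 2^-1 ^+ n * k ^+ n.
have c0 : 0 < c by rewrite mulr_gt0 // exprn_gt0 // invr_gt0.
have V0 := fine_volume_lp_ball_gt0.
exists (c / 2); first by rewrite divr_gt0.
move=> z; rewrite /illumination_body /= => hz x x1.
have [->|z0] := eqVneq z 0.
  rewrite /dot big1 => [|i _]; last by rewrite mxE mulr0.
  by rewrite addr_ge0 // ltW.
have [y [y1 yz zE]] := lp_support p1 q1 pq z0.
have xy : dot x z <= dot y z.
  rewrite yz {1}zE dotZ; rewrite -[leRHS]mulr1; apply: ler_wpM2l; first exact: powR_ge0.
  by apply: (dot_le1 p1 q1 pq) => //; rewrite lpsum_lpdual // y1.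
apply: (le_trans xy); rewrite leNgt; apply/negP => h.
have Ky w : K w -> dot y w <= 1 by move=> Kw; apply: (dot_le1 p1 q1 pq) => //; rewrite y1.
have KN w : K w -> K (- w).
  by rewrite /K /lp_ball /= -/(lpsum q w) -/(lpsum q (- w)) lpsumN.
have := volume_hull_ge (vmeas_lp_ball n q) eta0 Ky (ltW h).
move=> /le_trans/(_ hz).
set S := _ `&` _.
have : ((k ^+ n)%:E * volume K <= volume S)%E.
  have ki0 : k^-1 != 0 by rewrite invr_eq0 gt_eqF.
  have [_] := vscale_homothety (- (k^-1 * (1 - k)) *: lpdual p y) ki0 (vmeas_lp_ball n q).
  rewrite normfV invrK gtr0_norm // => <-; apply: le_volume => v /=.
  set w := _ + _ => Kw.
  have vE : v = k *: w + (1 - k) *: lpdual p y.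
    by apply/rowP => i; rewrite /w !mxE; field; rewrite gt_eqF.
  have Kd : K (lpdual p y) by rewrite /K /lp_ball /= -/(lpsum q _) lpsum_lpdual // y1.
  split.
    apply: (lp_bipolar p1 q1 pq) => x' x'1; rewrite vE dotD !dotZ.
    have h1 := dot_le1 p1 q1 pq x'1 Kw; have h2 := dot_le1 p1 q1 pq x'1 Kd.
    have h3 : k * dot x' w <= k * 1 by rewrite ler_pM2l.
    have h4 : (1 - k) * dot x' (lpdual p y) <= (1 - k) * 1.
      by apply: ler_wpM2l => //; rewrite subr_ge0.
    lra.
  rewrite /= vE dotD !dotZ (dotC y (lpdual p y)) dot_lpdual // y1.
  have := Ky _ (KN _ Kw); rewrite dotN => h1.
  have h2 : k * - dot y w <= k * 1 by rewrite ler_pM2l.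
  by rewrite /k in h2 *; lra.
move=> hS; rewrite -/K.
apply/negP; rewrite -ltNge.
apply: (@lt_le_trans _ _ (volume K + (2^-1 ^+ n)%:E * ((k ^+ n)%:E * volume K))%E); last first.
  by rewrite leeD2l // lee_wpmul2l.
rewrite fin_volume_lp_ball -!EFinM -EFinD lte_fin mulrA -/c mulrDl mul1r ltrD2l ltr_pM2r //.
by rewrite ltr_pdivrMr // ltr_pMr // ltr1n.
Qed.

End Dual.

Lemma powR_onem_le (h p : R) : 0 <= h -> 0 < p -> 1 - p * h <= (1 + h) `^ (- p).
Proof.
move=> h0 p0; have h1 : 0 < 1 + h by lra.
rewrite /powR gt_eqF // mulNr; apply: le_trans (expR_ge1Dx _).
rewrite lerD2l lerN2 ler_pM2l //.
have := @le_ln1Dx R h; apply; lra.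
Qed.

Lemma volume_box m (a b c : R) : 0 < a -> 0 < b ->
  let A := [set z : 'rV[R]_m.+1 | `|z ord0 ord0 - c| <= a /\
      forall j, j != ord0 -> `|z ord0 j| <= b] in
  vmeas A /\ volume A = (a * b ^+ m * 2 ^+ m.+1)%:E.
Proof.
move=> a0 b0 A.
pose s (i : 'I_m.+1) : R := if i == ord0 then a^-1 else b^-1.
pose t (i : 'I_m.+1) : R := if i == ord0 then - (c / a) else 0.
have s0 i : s i != 0 by rewrite /s; case: ifP => _; rewrite invr_eq0 gt_eqF.
have [mI vI] := @volume_cube R m.+1.
have [mP vP] := vscale_diag t s0 mI.
suff AE : A = (fun x => \row_i (s i * x ord0 i + t i)) @^-1`
    [set x : 'rV[R]_m.+1 | forall i, `|x ord0 i| <= 1].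
  rewrite AE; split => //; rewrite vP vI -EFinM; congr (_%:E).
  congr (_ * _); rewrite big_ord_recl /s eqxx normfV invrK gtr0_norm //; congr (_ * _).
  under eq_bigr do rewrite eq_sym (negbTE (neq_lift _ _)) normfV invrK gtr0_norm //.
  by rewrite prodr_const card_ord.
have E0 (z : 'rV[R]_m.+1) : `|a^-1 * z ord0 ord0 - c / a| = `|z ord0 ord0 - c| / a.
  by rewrite [a^-1 * _]mulrC -mulrBl normrM normfV (gtr0_norm a0).
have E1 (u : R) : `|b^-1 * u + 0| = `|u| / b.
  by rewrite addr0 normrM normfV (gtr0_norm b0) mulrC.
apply/seteqP; split => z /=.
  move=> [h1 h2] i; rewrite mxE /s /t; case: eqP => [->|/eqP i0].
    by rewrite E0 ler_pdivrMr // mul1r.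
  by rewrite E1 ler_pdivrMr // mul1r; exact: h2.
move=> h; split => [|j j0].
  by have := h ord0; rewrite mxE /s /t eqxx E0 ler_pdivrMr // mul1r.
by have := h j; rewrite mxE /s /t (negbTE j0) E1 ler_pdivrMr // mul1r.
Qed.

(** * The spike over the axis point *)

Section Spike.
Variables (m : nat) (p q : R).
Hypotheses (p1 : 1 < p) (q1 : 1 < q) (pq : p^-1 + q^-1 = 1).

Let p0 : 0 < p. Proof. exact: lt_trans p1. Qed.
Let q0 : 0 < q. Proof. exact: lt_trans q1. Qed.
Let K : set 'rV[R]_m.+1 := lp_ball m.+1 q.

Definition axis_point : 'rV[R]_m.+1 := delta_mx ord0 ord0.

Lemma dot_axis_point (x : 'rV[R]_m.+1) : dot x axis_point = x ord0 ord0.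
Proof.
rewrite /dot (bigD1 ord0) //= big1 => [|i i0]; rewrite !mxE ?eqxx ?mulr1 ?addr0 //.
by rewrite (negbTE i0) mulr0.
Qed.

Lemma lpsum_axis_point r : 0 < r -> lpsum r axis_point = 1.
Proof.
move=> r0; rewrite /lpsum (bigD1 ord0) //= big1 => [|i i0]; rewrite !mxE ?eqxx.
  by rewrite normr1 powR1 addr0.
by rewrite (negbTE i0) normr0 powR0 // gt_eqF.
Qed.

(* The outer normal of [K] at the radial projection of a point of the hull
   outside [K] separates it from [K], so it must see the apex [(1 + h) e_1]. *)
Lemma spike_in_box (h : R) z : 0 < h <= 1 ->
  convex_hull (K `|` [set (1 + h) *: axis_point]) z ->
  K z \/ (`|z ord0 ord0 - 1| <= p * h /\
    forall j, j != ord0 -> `|z ord0 j| <= 2 * (p * h) `^ q^-1).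
Proof.
move=> /andP[h0 h1] hz; have [Kz|nKz] := pselect (K z); [by left|right].
have nz : 1 < lpsum q z by rewrite ltNge; apply/negP.
have z0 : z != 0.
  by apply: contraTneq nz => ->; rewrite -leNgt /lpsum big1 // => i _; rewrite mxE normr0 powR0 // gt_eqF.
have [x [x1 xz zE]] := lp_support p1 q1 pq z0.
set N := lpsum q z `^ q^-1 in xz zE.
have N1 : 1 < N by rewrite ltNge lpsum_le1 // -ltNge.
have hull u c : (forall y, K y -> dot u y <= c) -> (1 + h) * u ord0 ord0 <= c -> dot u z <= c.
  move=> H1 H2; apply: convex_hull_halfspace hz => y [/H1 //|->].
  by rewrite dotZ dot_axis_point.
have Kx y : K y -> dot x y <= 1 by move=> Ky; apply: (dot_le1 p1 q1 pq) => //; rewrite x1.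
have xx : 1 < (1 + h) * x ord0 ord0.
  by rewrite ltNge; apply/negP => /(hull _ _ Kx); rewrite xz leNgt N1.
have hp : 0 < 1 + h by lra.
have N2 : N <= 1 + h.
  rewrite -xz; apply: hull => [y Ky|].
    by apply: le_trans (Kx y Ky) _; lra.
  rewrite -[leRHS]mulr1; apply: ler_wpM2l; first exact: ltW.
  by apply: le_trans (ler_norm _) _; apply: (@coord_le1 _ _ p) => //; rewrite x1.
set a := x ord0 ord0 in xx.
have a0 : 0 < a by rewrite -(pmulr_rgt0 _ hp); lra.
have a1 : a <= 1.
  by apply: le_trans (ler_norm _) _; apply: (@coord_le1 _ _ p) => //; rewrite x1.
(* The visibility condition [(1 + h) * a > 1] leaves at most [p * h] for the [p]-th powers of the
   other coordinates of [x]; dually the spike has width of order [h^(1/q)]. *)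
have ap : 1 - p * h <= a `^ p.
  apply: le_trans (powR_onem_le (ltW h0) p0) _.
  rewrite -mulN1r powRrM powR_inv1 ?(ltW hp) //.
  apply: ge0_ler_powR; rewrite ?nnegrE ?invr_ge0 ?(ltW p0) ?(ltW hp) ?(ltW a0) //.
  by rewrite ltW // -(ltr_pM2l hp) divff // gt_eqF.
have dual_pow j : `|lpdual p x ord0 j| `^ q = `|x ord0 j| `^ p.
  rewrite mxE; have [->|xj] := eqVneq (x ord0 j) 0.
    by rewrite sgr0 mul0r normr0 !powR0 // gt_eqF.
  by rewrite normrM normr_sg xj mul1r (ger0_norm (powR_ge0 _ _)) -powRrM (conjM p1 q1 pq).
split => [|j j0].
  have wE : lpdual p x ord0 ord0 = a `^ (p - 1) by rewrite mxE gtr0_sg // gtr0_norm // mul1r.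
  have w1 : a `^ (p - 1) <= 1 by rewrite powR_le1 ?subr_gt0 // ltW.
  have w2 : a `^ p <= a `^ (p - 1) by apply: ger_powR; rewrite ?a0 // gerBl.
  have w0 := powR_ge0 a (p - 1).
  have -> : z ord0 ord0 = N * a `^ (p - 1) by rewrite {1}zE mxE wE.
  have hph : h <= p * h by rewrite ler_peMl // ltW.
  by rewrite ler_norml; apply/andP; split; nra.
have xj : `|x ord0 j| `^ p <= p * h.
  have : `|x ord0 j| `^ p + a `^ p <= 1.
    rewrite -x1 /lpsum (bigD1 ord0) //= (bigD1 j) //= -/a (gtr0_norm a0) addrA [leRHS]addrC.
    by rewrite (addrC (a `^ p)) lerDr; apply: sumr_ge0 => i _; exact: powR_ge0.
  lra.
have wj : `|lpdual p x ord0 j| <= (p * h) `^ q^-1.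
  rewrite -[leLHS](@powRr1 _ `|_|) // -(mulfV (lt0r_neq0 q0)) powRrM dual_pow.
  by apply: ge0_ler_powR; rewrite ?nnegrE ?powR_ge0 ?invr_ge0 ?mulr_ge0 // ltW.
rewrite {1}zE mxE normrM gtr0_norm; last by lra.
by apply: ler_pM => //; lra.
Qed.

(** Length of order [h], width of order [h^(1/q)] in each of [m] directions. For [q < 2] the
    exponent exceeds the [m/2 + 1] of an ordinary cap. *)
Lemma volume_spike : exists2 C : R, 0 < C & forall h, 0 < h <= 1 ->
  (volume (convex_hull (K `|` [set (1 + h) *: axis_point])) <=
   volume K + (C * h `^ (1 + m%:R / q))%:E)%E.
Proof.
exists (p * (2 * p `^ q^-1) ^+ m * 2 ^+ m.+1).
  by rewrite !mulr_gt0 // !exprn_gt0 // mulr_gt0 // powR_gt0.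
move=> h h01; have /andP[h0 h1] := h01.
have ph : 0 < p * h by rewrite mulr_gt0.
have b0 : 0 < 2 * (p * h) `^ q^-1 by rewrite mulr_gt0 // powR_gt0.
have [mB vB] := volume_box m 1 ph b0.
set B := [set z | _ /\ _] in mB vB.
apply: le_trans (_ : volume (K `|` B) <= _)%E.
  by apply: le_volume => z /(spike_in_box h01) [Kz|Bz]; [left|right].
have -> : K `|` B = K `|` (B `&` ~` K).
  apply/seteqP; split => z; last by case=> [|[]]; [left|right].
  by case=> [Kz|Bz]; [left|have [Kz|nKz] := pselect (K z); [left|right]].
have mK : vmeas K := vmeas_lp_ball m.+1 q.
rewrite volumeU //; last 2 first.
- by apply: vmeasI => //; exact: vmeasC.
- by apply/seteqP; split => z //= [? []].
rewrite leeD2l //; apply: (@le_trans _ _ (volume B)); first by apply: le_volume => z [].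
rewrite vB lee_fin le_eqVlt; apply/orP; left; apply/eqP.
have -> : h `^ (1 + m%:R / q) = h * (h `^ q^-1) ^+ m.
  rewrite powRD; last by rewrite (gt_eqF h0) implybT.
  by rewrite powRr1 ?(ltW h0) // (mulrC m%:R) powRrM powR_mulrn ?powR_ge0.
rewrite powRM ?(ltW p0) ?(ltW h0) //; set X := p `^ _; set Y := h `^ _.
by rewrite mulrA !exprMn; ring.
Qed.

End Spike.

End Illumination.

(** * Bounds for both bodies and the limit of the distance *)

Section Distance.
Context {R : realType}.
Variables (m : nat) (p : R).
Hypotheses (m0 : (0 < m)%N) (p2 : 2 < p).
Local Notation n := m.+1.
Local Notation e := (m%:R / 2 + 1 : R).
Local Notation x0 := (diag_point m p).

Definition conj_exp : R := p / (p - 1).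
Local Notation q := conj_exp.

Let p0 : 0 < p. Proof. by apply: lt_trans p2. Qed.
Let p1 : 1 < p. Proof. by apply: lt_trans p2; rewrite ltr1n. Qed.
Let q1 : 1 < q. Proof. by rewrite /q ltr_pdivlMr; move: p2; lra. Qed.
Let q2 : q < 2. Proof. by rewrite /q ltr_pdivrMr; move: p2; lra. Qed.
Let q0 : 0 < q. Proof. exact: lt_trans q1. Qed.
Let pq : p^-1 + q^-1 = 1.
Proof. by rewrite /q; field; rewrite !gt_eqF //; move: p2; lra. Qed.
Let qp : q^-1 + p^-1 = 1. Proof. by rewrite addrC. Qed.

Let B : set 'rV[R]_n := lp_ball n p.
Let K : set 'rV[R]_n := lp_ball n q.
Variables V W : R.
Hypotheses (VE : volume B = V%:E) (WE : volume K = W%:E) (V0 : 0 < V) (W0 : 0 < W).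

Let polarB : polar B = K. Proof. exact: (polar_lp_ball _ p1 q1 pq). Qed.

Lemma kappa_gt0 : 0 < kappa m :> R.
Proof.
have w0 : 0 < omega m :> R by apply: fine_volume_lp_ball_gt0; rewrite ?ltr1n.
by rewrite /kappa divr_gt0 ?(mulr_gt0 w0) ?powR_gt0.
Qed.

Lemma capconst_gt0 : 0 < capconst m p.
Proof.
rewrite divr_gt0 ?kappa_gt0 // sqrtr_gt0; apply: Dbound_gt0 => //.
by rewrite oppr_lt0 diag_coord_gt0.
Qed.

(** To leading order, the height in units of [s] of the cap at the diagonal point with volume
    [s^e * V]; identified with [G_fun] in [G_fun_diag_point]. *)
Definition Gdiag : R := (V / capconst m p) `^ e^-1.
Local Notation G := Gdiag.

Lemma Gdiag_gt0 : 0 < G.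
Proof. apply: powR_gt0; apply: divr_gt0; [exact: V0|exact: capconst_gt0]. Qed.

Lemma Gdiag_pow : capconst m p * G `^ e = V.
Proof.
have c0 := capconst_gt0.
rewrite /G -powRrM mulVf ?gt_eqF // powRr1; last by rewrite divr_ge0 ?(ltW V0) ?(ltW c0).
by rewrite mulrC divfK // gt_eqF.
Qed.

(** At the point [y0] of the dual sphere all coordinates equal [z > 0], so the second derivatives
    are bounded nearby although [q < 2]. Only the order [tau^e] matters. *)
Lemma dual_cap_lower : exists2 c : R, 0 < c & exists2 tau1 : R, 0 < tau1 &
  forall tau, 0 < tau <= tau1 ->
  ((c * tau `^ e)%:E <= volume (K `&` [set y | (1 - tau <= dot x0 y)%R]))%E.
Proof.
pose y0 := lpdual p x0; pose z := diag_coord m p `^ (p - 1).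
have xi0 : 0 < diag_coord m p := diag_coord_gt0 m p.
have z0 : 0 < z by rewrite powR_gt0.
have y0E i : y0 ord0 i = z by rewrite /y0 lpdual_const.
have y1 : lpsum q y0 = 1 by rewrite (lpsum_lpdual p1 q1 pq) lpsum_diag_point.
have yx : lpdual q y0 = x0 by exact: (lpdualK p1 q1 pq).
pose d := (q - 1) * (z / 2) `^ (q - 2).
have d0 : 0 < d by rewrite mulr_gt0 ?powR_gt0 ?divr_gt0 //; move: q1; lra.
pose A := \sum_i lpdual q y0 ord0 i ^+ 2 / d.
have A0 : 0 < A.
  rewrite /A yx; under eq_bigr do rewrite mxE.
  by rewrite sumr_const pmulrn_rgt0 ?card_ord // divr_gt0 // exprn_gt0.
pose c := kappa m * Num.sqrt (2^-1) ^+ m / Num.sqrt (A * \prod_(i < n) d).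
have P0 : 0 < A * \prod_(i < n) d by rewrite mulr_gt0 // prodr_gt0.
exists c.
  by rewrite divr_gt0 ?sqrtr_gt0 // mulr_gt0 ?kappa_gt0 // exprn_gt0 // sqrtr_gt0 invr_gt0.
(* [tau <= A] keeps the factor [1 - tau / (2 * A)] above one half; the second entry confines the
   quadric to radius [z / 2]. *)
exists (Num.min A ((z / 2) ^+ 2 * d / 2)).
  by rewrite lt_min A0 /= divr_gt0 // (mulr_gt0 _ d0) // exprn_gt0 // divr_gt0.
move=> tau /andP[tau0]; rewrite le_min => /andP[t1 t2].
have Q : (volume (quadric (fun=> d) (lpdual q y0) tau) <= volume (lpcap q y0 tau))%E.
  apply: (@quadric_le_cap _ _ q y0 (fun=> d) (z / 2) d tau q0 y1 d0) => //.
  - by rewrite divr_gt0.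
  - by move: t2; lra.
  - move=> i w wz; rewrite yx y0E (gtr0_norm z0) mxE.
    have -> : diag_coord m p = z `^ (q - 1).
      by rewrite /z -powRrM (conjB p1 q1 pq) powRr1 // ltW.
    by apply: powR_taylor_le => //; rewrite q1 q2.
rewrite -yx; apply: le_trans Q.
have tA : tau <= 2 * A by lra.
apply: le_trans (volume_quadric_ge m0 (fun=> d0) A0 tau0 tA).
rewrite lee_fin -/A [leRHS]mulrAC; apply: ler_wpM2r; first exact: powR_ge0.
apply: ler_wpM2r; first by rewrite invr_ge0 sqrtr_ge0.
apply: ler_wpM2l; first exact/ltW/kappa_gt0.
rewrite lerXn2r ?nnegrE ?sqrtr_ge0 // ler_wsqrtr //.
have : tau / (2 * A) <= 2^-1 by rewrite ler_pdivrMr //; lra.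
lra.
Qed.

(** A halfspace just beyond a supporting one cuts off the empty set, which is admissible for every
    [delta >= 0]. *)
Lemma floating_body_sub delta : 0 <= delta -> floating_body delta B `<=` B.
Proof.
move=> d0 y hy; apply: (lp_bipolar q1 p1 qp) => w w1.
have [->|nw] := eqVneq w 0.
  by rewrite /dot big1 // => i _; rewrite mxE mul0r.
apply/ler_addgt0Pr => eta eta0; apply: hy => //.
rewrite (_ : _ `&` _ = set0) ?volume0.
  by apply: mule_ge0; rewrite ?lee_fin ?volume_ge0.
apply/seteqP; split => v //= [Bv hv].
have := dot_le1 q1 p1 qp w1 Bv; lra.
Qed.

(** A halfspace excluding the shrunken point would cut off a full cap of height [g' * s], whose
    volume by [cap_lower] exceeds the admissible amount. *)
Lemma sub_floating_body (eps : R) : 0 < eps -> exists2 s0 : R, 0 < s0 &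
  forall s, 0 < s <= s0 -> forall x, B x ->
  floating_body (s `^ e) B ((1 + (G + eps) * s)^-1 *: x).
Proof.
(* [g'] lies strictly between [G] and [g]: the gap below makes the cap too large, the gap above
   absorbs the second order term in [(1 + g * s)^-1 <= 1 - g' * s]. *)
move=> eps0; have G0 := Gdiag_gt0; pose g := G + eps; pose g' := G + eps / 2.
have g0 : 0 < g by rewrite /g; lra.
have g'0 : 0 < g' by rewrite /g'; lra.
have gG : G `^ e < g' `^ e.
  by apply: gt0_ltr_powR; rewrite ?nnegrE ?(ltW G0) ?(ltW g'0) // /g'; lra.
have g'e : 0 < g' `^ e by rewrite powR_gt0.
have cc0 := capconst_gt0.
have c1 : V / g' `^ e < capconst m p by rewrite ltr_pdivrMr // -Gdiag_pow ltr_pM2l.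
pose c := (V / g' `^ e + capconst m p) / 2.
have cc : c < capconst m p by rewrite /c; lra.
have cV : V < c * g' `^ e by rewrite -ltr_pdivrMr // /c; lra.
have [tau0 tau00 Hcap] := cap_lower m0 p2 cc.
exists (Num.min (tau0 / g') (eps / 2 / (g * g'))).
  by rewrite lt_min !divr_gt0 // mulr_gt0.
move=> s /andP[s0]; rewrite le_min => /andP[s1 s2] x Bx u b u0 hvol.
have a0 : 0 < 1 + g * s by rewrite addr_gt0 // mulr_gt0.
have [y [y1 _ uE]] := lp_support p1 q1 pq u0; set N := _ `^ _ in uE.
have N0 : 0 < N := lpnorm_gt0 q u0.
have ux : dot u x <= N.
  rewrite uE dotZl -[leRHS]mulr1; apply: ler_wpM2l; first exact: ltW.
  by rewrite dotC; apply: (dot_le1 p1 q1 pq) => //; rewrite (lpsum_lpdual p1 q1 pq) y1.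
rewrite dotZ; apply: (@le_trans _ _ ((1 + g * s)^-1 * N)).
  by apply: ler_wpM2l => //; rewrite invr_ge0 ltW.
rewrite leNgt; apply/negP => hb.
have ts : 0 < g' * s <= tau0.
  by rewrite mulr_gt0 //=; move: s1; rewrite ler_pdivlMr // mulrC.
have := Hcap y _ y1 ts; apply/negP; rewrite -ltNge.
apply: (@le_lt_trans _ _ ((s `^ e)%:E * volume B)%E).
  apply: le_trans hvol; apply: le_volume => v [Bv hv]; split => //=.
  rewrite /= in hv; rewrite uE dotZl; apply: (le_trans (ltW hb)); rewrite mulrC.
  apply: ler_wpM2l; first exact: ltW.
  apply: le_trans hv; rewrite -[leLHS]mul1r ler_pdivrMr //.
  move: s2; rewrite ler_pdivlMr ?mulr_gt0 // => s2.
  have s3 : g * g' * s * s <= eps / 2 * s by rewrite ler_pM2r //; lra.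
  by rewrite /g /g' in s3 *; lra.
rewrite VE -EFinM lte_fin powRM ?(ltW g'0) ?(ltW s0) // mulrC mulrA ltr_pM2r //.
exact: powR_gt0.
Qed.

(** By [cap_upper] the cap of height [(G - eps) * s] at the diagonal point is small enough for its
    halfspace to take part in the intersection. *)
Lemma floating_body_diag (eps : R) : 0 < eps < G -> exists2 s0 : R, 0 < s0 &
  forall s, 0 < s <= s0 -> forall y, floating_body (s `^ e) B y ->
  dot (lpdual p x0) y <= 1 - (G - eps) * s.
Proof.
move=> /andP[eps0 epsG]; pose g := G - eps.
have g0 : 0 < g by rewrite subr_gt0.
have ge0 : 0 < g `^ e by rewrite powR_gt0.
have gG : g `^ e < G `^ e.
  by apply: gt0_ltr_powR; rewrite ?nnegrE ?(ltW g0) ?(ltW Gdiag_gt0) // /g; lra.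
pose c := V / g `^ e.
have cc : capconst m p < c.
  by rewrite /c ltr_pdivlMr // -Gdiag_pow ltr_pM2l // capconst_gt0.
have [tau0 tau00 Hcap] := cap_upper m0 p2 cc.
exists (tau0 / g); first by rewrite divr_gt0.
move=> s /andP[s0 s1] y; apply.
  apply/eqP => /rowP /(_ ord0); rewrite lpdual_const ?diag_coord_gt0 // mxE => h.
  by have := powR_gt0 (p - 1) (diag_coord_gt0 m p); rewrite h ltxx.
have ts : 0 < g * s <= tau0.
  by rewrite mulr_gt0 //=; move: s1; rewrite ler_pdivlMr // mulrC.
apply: le_trans (Hcap _ ts) _; rewrite VE -EFinM lee_fin powRM ?(ltW g0) ?(ltW s0) //.
by rewrite mulrA /c divfK ?gt_eqF // mulrC.
Qed.

Lemma hull_lp_ball z : K z -> convex_hull (K `|` [set z]) `<=` K.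
Proof.
move=> Kz w hw; apply: (lp_bipolar p1 q1 pq) => x x1.
by apply: (convex_hull_halfspace _ hw) => y [Ky|->]; apply: (dot_le1 p1 q1 pq).
Qed.

Lemma sub_illumination_body delta : 0 <= delta -> K `<=` illumination_body delta K.
Proof.
move=> d0 z Kz; rewrite /illumination_body /=.
apply: le_trans (le_volume (hull_lp_ball Kz)) _.
by rewrite WE -EFinM lee_fin mulrDl mul1r lerDl mulr_ge0 // ltW.
Qed.

Lemma polar_illumination_body_sub delta : 0 <= delta ->
  polar_illumination_body delta B `<=` B.
Proof.
move=> d0 w; rewrite /polar_illumination_body polarB => hw.
apply: (lp_bipolar q1 p1 qp) => x x1; apply: hw; exact: sub_illumination_body.
Qed.

(** The illumination parameter is chosen after [s], so that its body lies between [a^-1 B] and [B];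
    then only the depth of the floating body counts. *)
Lemma distance_upper (eps : R) : 0 < eps -> exists2 s0 : R, 0 < s0 &
  forall s, 0 < s <= s0 ->
  (floating_illumination_distance B (s `^ e) <= (1 + (G + eps) * s)%:E)%E.
Proof.
move=> eps0; have G0 := Gdiag_gt0; have [s0 s00 Hf] := sub_floating_body eps0.
have g0 : 0 < G + eps by lra.
exists (Num.min s0 (G + eps)^-1); first by rewrite lt_min s00 invr_gt0.
move=> s /andP[sp]; rewrite le_min => /andP[s1 s2].
have eta : 0 < (G + eps) * s <= 1.
  by rewrite mulr_gt0 //= -(mulfV (lt0r_neq0 g0)) ler_pM2l.
set a := 1 + (G + eps) * s.
have a0 : 0 < a by rewrite /a; have /andP[] := eta; lra.
have [del del0 Hdel] := illumination_body_small (ltn0Sn m) p1 q1 pq eta.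
have hs : 0 < s <= s0 by rewrite sp.
apply: (@le_trans _ _ (body_distance (floating_body (s `^ e) B) (polar_illumination_body del B))).
  by apply: ereal_inf_lbound; exists del.
apply: ereal_inf_lbound; exists a => //=; split.
- by rewrite /a; have /andP[] := eta; lra.
- move=> _ [y hy <-] z; rewrite polarB => hz.
  have By := floating_body_sub (powR_ge0 _ _) hy.
  by rewrite dotZ mulrC ler_pdivrMr // mul1r dotC; exact: Hdel.
- move=> w hw; exists (a^-1 *: w); last by rewrite scalerA mulfV ?scale1r // gt_eqF.
  by apply: (Hf _ hs); exact: (polar_illumination_body_sub (ltW del0)).
Qed.

Lemma small_power (c a : R) : 0 < c -> 0 < a -> exists2 s0 : R, 0 < s0 &
  forall s, 0 < s <= s0 -> s `^ a <= c.
Proof.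
move=> c0 a0; exists (c `^ a^-1); first exact: powR_gt0.
move=> s /andP[s0 s1].
have -> : c = (c `^ a^-1) `^ a by rewrite -powRrM mulVf ?gt_eqF // powRr1 // ltW.
by apply: ge0_ler_powR; rewrite ?nnegrE ?powR_ge0 ?(ltW a0) ?(ltW s0).
Qed.

(** By [volume_hull_ge] such a point [z] adds at least a fixed fraction of the dual cap of height
    [eps * s / 2], of order [s^e]. *)
Lemma dual_illumination_lower (eps : R) : 0 < eps -> exists2 c : R, 0 < c &
  exists2 s0 : R, 0 < s0 & forall s delta z, 0 < s <= s0 -> illumination_body delta K z ->
  1 + eps * s <= dot x0 z -> c * s `^ e <= delta.
Proof.
move=> eps0; have [c c0 [tau1 tau10 Hc]] := dual_cap_lower.
pose k := 2^-1 ^+ n * (c * (eps / 2) `^ e).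
have k0 : 0 < k.
  by rewrite mulr_gt0 ?exprn_gt0 ?invr_gt0 // mulr_gt0 // powR_gt0 // divr_gt0.
exists (k / W); first by rewrite divr_gt0.
exists (tau1 / (eps / 2)); first by rewrite divr_gt0 // divr_gt0.
move=> s delta z /andP[s0 s1] hz xz.
have Kx y : K y -> dot x0 y <= 1.
  by move=> Ky; apply: (dot_le1 p1 q1 pq) => //; rewrite lpsum_diag_point.
have es0 : 0 < eps * s by rewrite mulr_gt0.
have := volume_hull_ge (vmeas_lp_ball n q) es0 Kx xz.
move=> /le_trans/(_ hz) h.
have ts : 0 < eps * s / 2 <= tau1.
  rewrite divr_gt0 //=; move: s1; rewrite ler_pdivlMr ?divr_gt0 //; lra.
have := Hc _ ts => h2.
have : (volume K + (2^-1 ^+ n)%:E * (c * (eps * s / 2) `^ e)%:E <= (1 + delta)%:E * volume K)%E.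
  apply: le_trans h; apply: leeD2l; apply: lee_wpmul2l; last exact: h2.
  by rewrite lee_fin exprn_ge0.
rewrite WE -!EFinM -EFinD lee_fin mulrDl mul1r lerD2l => h3.
rewrite mulrAC ler_pdivrMr //; apply: le_trans h3.
rewrite (_ : eps * s / 2 = eps / 2 * s); last by ring.
by rewrite powRM ?(ltW s0) ?divr_ge0 ?(ltW eps0) // /k !mulrA.
Qed.

Lemma dual_illumination_upper (c M : R) : 0 < c -> 0 < M -> exists2 s0 : R, 0 < s0 &
  forall s delta, 0 < s <= s0 -> c * s `^ e <= delta ->
  illumination_body delta K ((1 + M * s) *: axis_point m).
Proof.
move=> c0 M0; have [C C0 HC] := @volume_spike _ m p q p1 q1 pq.
(* [a = m * (1/q - 1/2) > 0] is the gain of the spike over an ordinary cap; the factor [s^a] absorbs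
   all constants. *)
pose b := 1 + m%:R / q; pose a := b - e.
have mp : 0 < (m%:R : R) by rewrite ltr0n.
have a0 : 0 < a.
  rewrite /a /b (_ : 1 + _ - _ = m%:R * (q^-1 - 2^-1)); last by field; rewrite gt_eqF.
  by rewrite mulr_gt0 // subr_gt0 ltf_pV2 ?posrE.
have CM : 0 < C * M `^ b by rewrite mulr_gt0 // powR_gt0.
have [s0 s00 Hs] := small_power (divr_gt0 (mulr_gt0 c0 W0) CM) a0.
exists (Num.min s0 M^-1); first by rewrite lt_min s00 invr_gt0.
move=> s delta /andP[sp]; rewrite le_min => /andP[s1 s2] hd.
have Ms : 0 < M * s <= 1.
  by rewrite mulr_gt0 //= -(mulfV (lt0r_neq0 M0)) ler_pM2l.
rewrite /illumination_body /=; apply: le_trans (HC _ Ms) _.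
rewrite WE -EFinD -EFinM lee_fin mulrDl mul1r lerD2l.
apply: le_trans (_ : c * s `^ e * W <= _); last by rewrite ler_pM2r.
have := Hs s; rewrite sp s1 => /(_ isT); rewrite ler_pdivlMr // => h.
rewrite powRM ?(ltW M0) ?(ltW sp) //.
have -> : s `^ b = s `^ a * s `^ e.
  by rewrite -powRD ?(gt_eqF sp) ?implybT // /a; congr (_ `^ _); ring.
rewrite (_ : C * _ = s `^ a * (C * M `^ b) * s `^ e); last by ring.
by rewrite [leRHS]mulrAC; apply: ler_wpM2r => //; exact: powR_ge0.
Qed.

(* If the illumination body exceeded [K] by less than [eps / 2 * s] in the direction of [x0],
   the cut of the floating body at [x0] would be too deep for [a]. Otherwise [delta'] is at
   least of order [s `^ e], which pushes it beyond [K] by [M * s] at [axis_point]. *)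
Lemma distance_lower (eps : R) : 0 < eps < G -> exists2 s0 : R, 0 < s0 &
  forall s, 0 < s <= s0 ->
  ((1 + (G - eps) * s)%:E <= floating_illumination_distance B (s `^ e))%E.
Proof.
move=> /andP[eps0 epsG]; have G0 := Gdiag_gt0.
(* The slacks [eps / 4] for the floating body and [eps / 2] for the illumination body leave the
   linear term [(- eps + eps / 4 + eps / 2) * s < 0] in the case where no [z] exceeds [t]. *)
have e4 : 0 < eps / 4 < G by lra.
have e2 : 0 < eps / 2 by lra.
have [s1 s10 H1] := floating_body_diag e4.
have [c c0 [s2 s20 H2]] := dual_illumination_lower e2.
(* At the axis point the inclusion gives [1 + M * s <= (1 + (G + 1) * s) * a]. As [G * s <= 1], the
   quadratic term is at most [(G + 1) * s], so any slope from [3 * G + 2] on is contradictory. *)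
pose M := 4 * (G + 1).
have M0 : 0 < M by rewrite mulr_gt0 // addr_gt0.
have [s3 s30 H3] := dual_illumination_upper c0 M0.
(* Slope [G + 1] is crude at the axis point, but enough against [M]. *)
have [s4 s40 H4] := sub_floating_body ltr01.
exists (Num.min (Num.min s1 s2) (Num.min (Num.min s3 s4) G^-1)).
  by rewrite !lt_min s10 s20 s30 s40 invr_gt0.
move=> s /andP[s0]; rewrite !le_min => /andP[/andP[h1 h2] /andP[/andP[h3 h4] h5]].
have Gs : G * s <= 1 by rewrite -(mulfV (lt0r_neq0 G0)) ler_pM2l.
have Gs0 : 0 < G * s by rewrite mulr_gt0.
have es0 : 0 < eps * s by rewrite mulr_gt0.
have esG : eps * s < G * s by rewrite ltr_pM2r.
apply/ereal_infP => _ [del /= del0 <-].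
apply/ereal_infP => _ [a /= [a1 C1 C2] <-].
rewrite lee_fin leNgt; apply/negP => alt.
have a0 : 0 < a by lra.
set Z := polar_illumination_body del B in C1 C2.
have ZE w : Z w <-> forall z, illumination_body del K z -> dot z w <= 1.
  by rewrite /Z /polar_illumination_body polarB.
pose t := 1 + eps / 2 * s.
have t0 : 0 < t by rewrite /t; lra.
have [z hz xz] : exists2 z, illumination_body del K z & t < dot x0 z.
  apply: contrapT => H.
  have Zx : Z (t^-1 *: x0).
    apply/ZE => z hz; rewrite dotZ mulrC ler_pdivrMr // mul1r dotC.
    by rewrite leNgt; apply/negP => h; apply: H; exists z.
  have [v hv vE] := C2 _ Zx.
  have hs : 0 < s <= s1 by rewrite s0.
  have dv := H1 s hs v hv.
  have : dot (lpdual p x0) (t^-1 *: x0) = t^-1.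
    by rewrite dotZ dot_lpdual // lpsum_diag_point // mulr1.
  rewrite -vE dotZ => tE.
  have h6 : t^-1 <= a * (1 - (G - eps / 4) * s) by rewrite -tE ler_pM2l.
  have h7 : 1 <= a * (1 - (G - eps / 4) * s) * t by rewrite -ler_pdivrMr // div1r.
  have q0' : 0 <= 1 - (G - eps / 4) * s by lra.
  have h8 : a * (1 - (G - eps / 4) * s) <= (1 + (G - eps) * s) * (1 - (G - eps / 4) * s).
    by apply: ler_wpM2r => //; exact: ltW.
  have h9 : (1 + (G - eps) * s) * (1 - (G - eps / 4) * s) <= 1 - 3 / 4 * (eps * s).
    have : 0 <= ((G - eps) * s) * ((G - eps / 4) * s).
      by rewrite !mulr_ge0 ?(ltW s0) //; lra.
    lra.
  have h10 : (1 - 3 / 4 * (eps * s)) * t < 1.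
    have : 0 < (eps * s) * (eps * s) by rewrite mulr_gt0.
    by rewrite /t; lra.
  have h11 : a * (1 - (G - eps / 4) * s) * t <= (1 - 3 / 4 * (eps * s)) * t.
    by rewrite ler_pM2r //; apply: le_trans h8 h9.
  lra.
have hs2 : 0 < s <= s2 by rewrite s0.
have hs3 : 0 < s <= s3 by rewrite s0.
have hs4 : 0 < s <= s4 by rewrite s0.
have hdel := H2 s del z hs2 hz (ltW xz).
have hax := H3 s del hs3 hdel.
have Bax : B (axis_point m) by rewrite /B /lp_ball /= -/(lpsum p _) lpsum_axis_point.
have hfl := H4 s hs4 _ Bax.
have : Z (a^-1 *: ((1 + (G + 1) * s)^-1 *: axis_point m)) by apply: C1; exists ((1 + (G + 1) * s)^-1 *: axis_point m).
move=> /ZE/(_ _ hax); rewrite dotZl !dotZ dot_axis_point !mxE !eqxx mulr1.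
have b0 : 0 < 1 + (G + 1) * s by rewrite addr_gt0 // mulr_gt0 // addr_gt0.
rewrite mulrA ler_pdivrMr // mul1r ler_pdivrMr // => h6.
have h7 : (1 + (G + 1) * s) * a <= (1 + (G + 1) * s) * (1 + (G - eps) * s).
  by rewrite ler_pM2l // ltW.
have h8 : (G * s) * (G * s) <= G * s by rewrite ger_pMr.
have h9 : G * s * s <= s by rewrite ger_pMl.
have h10 : 0 <= (eps * s) * ((G + 1) * s) by rewrite !mulr_ge0 ?(ltW s0) //; lra.
move: h6; rewrite /M; lra.
Qed.

(** [S delta = delta^(2/(n+1))] inverts [delta = s^e]. The two bounds also force the extended real
    distance to be finite. *)
Lemma distance_cvg :
  ((floating_illumination_distance B delta - 1) /
     (delta `^ (2 / n.+1%:R))%:E)%E @[delta --> 0^'+] --> G%:E.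
Proof.
have G0 := Gdiag_gt0.
have ee : e^-1 = 2 / n.+1%:R.
  have -> : (n.+1%:R : R) = m%:R + 2 by rewrite -natrD addn2.
  by field; rewrite gt_eqF // ltr_wpDl.
pose S (delta : R) := delta `^ (2 / n.+1%:R).
have a0 : 0 < 2 / n.+1%:R :> R by rewrite divr_gt0.
have SE (delta : R) : 0 < delta -> S delta `^ e = delta.
  by move=> d0; rewrite /S -ee -powRrM mulVf ?gt_eqF // powRr1 // ltW.
have near_s (s0 : R) : 0 < s0 -> \forall delta \near (0 : R)^'+, 0 < S delta <= s0.
  move=> s00; have h := powR_cvg0 a0.
  near=> delta.
  have d0 : 0 < delta by near: delta; exact: nbhs_right_gt.
  rewrite powR_gt0 //=; near: delta; exact: (cvgr_le (0 : R)).
have bound (eps : R) : 0 < eps < G -> \forall delta \near (0 : R)^'+,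
    exists2 r : R, ((floating_illumination_distance B delta - 1) /
     (delta `^ (2 / n.+1%:R))%:E)%E = r%:E & `|G - r| <= eps.
  move=> epsG; have /andP[eps0 _] := epsG.
  have [s1 s10 H1] := distance_upper eps0; have [s2 s20 H2] := distance_lower epsG.
  near=> delta.
  have d0 : 0 < delta by near: delta; exact: nbhs_right_gt.
  have hs1 : 0 < S delta <= s1 by near: delta; exact: near_s.
  have hs2 : 0 < S delta <= s2 by near: delta; exact: near_s.
  have := H1 _ hs1; have := H2 _ hs2; rewrite SE // -/(S delta).
  have /andP[s0 _] := hs1.
  case: floating_illumination_distance => [d|//|//]; rewrite !lee_fin => h1 h2.
  exists ((d - 1) / S delta).
    by rewrite -EFinB inver gt_eqF // -EFinM.
  have h3 : G - eps <= (d - 1) / S delta by rewrite ler_pdivlMr //; lra.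
  have h4 : (d - 1) / S delta <= G + eps by rewrite ler_pdivrMr //; lra.
  by rewrite ler_norml; apply/andP; split; lra.
apply/fine_cvgP; split.
  have h : 0 < G / 2 < G by lra.
  by have := bound _ h; apply: filterS => delta [r -> _].
apply/cvgrPdist_le => eps eps0.
have h : 0 < Num.min eps (G / 2) < G.
  rewrite lt_min eps0 divr_gt0 //= gt_min; apply/orP; right; lra.
have := bound _ h; apply: filterS => delta [r /= -> /= hr].
by apply: le_trans hr _; rewrite ge_min lexx.
Unshelve. all: by end_near. Qed.

End Distance.

(** * Curvature of the lp sphere *)

Section LpBoundary.
Context {R : realType}.
Variables (n : nat) (p : R).
Hypothesis (p2 : 2 < p).

Let p0 : 0 < p. Proof. by apply: lt_trans p2. Qed.
Let p1 : 1 < p. Proof. by apply: lt_trans p2; rewrite ltr1n. Qed.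
Let B : set 'rV[R]_n := lp_ball n p.

Lemma continuous_normpow : continuous (fun t : R => `|t| `^ p).
Proof.
move=> t; apply: differentiable_continuous; apply/derivable1_diffP.
by have [] := is_derive_normpow t p2.
Qed.

Lemma continuous_lpsum : continuous (@lpsum R n p).
Proof.
apply: continuous_big; first exact: add_continuous.
move=> i _ x; exact: (@continuous_comp _ _ _ (fun y : 'rV[R]_n => y ord0 i) (fun t => `|t| `^ p) x
  (@coord_continuous _ _ _ ord0 i x) (@continuous_normpow _)).
Qed.

(** A point of the sphere is not interior because [(1 + t) *: x] leaves the ball for every
    [t > 0]. *)
Lemma boundary_lp_ball x : boundary B x <-> lpsum p x = 1.
Proof.
have Bcl : closed B.
  apply: (@preimage_closed _ _ (@lpsum R n p) [set t : R | t <= 1]); last exact: closed_le.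
  by move=> y _; exact: continuous_lpsum.
have Bo : open [set y : 'rV[R]_n | lpsum p y < 1].
  apply: (@open_comp _ _ (@lpsum R n p) [set t : R | t < 1]); last exact: open_lt.
  by move=> y _; exact: continuous_lpsum.
rewrite /boundary -(closure_id B).1 //; split => [[Bx nx]|x1].
  apply/eqP; rewrite eq_le; apply/andP; split; first exact: Bx.
  rewrite leNgt; apply/negP => x1; apply: nx.
  apply: filterS (open_nbhs_nbhs (conj Bo x1)) => y /ltW; exact.
split=> [|h]; first by rewrite /B /lp_ball /= -/(lpsum p x) x1.
have c : (1 + t) *: x @[t --> (0 : R)] --> (1 + 0) *: x.
  by apply: cvgZr_tmp; apply: cvgD; [exact: cvg_cst|exact: cvg_id].
rewrite addr0 scale1r in c.
have c' := cvg_at_right_filter c.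
have : \forall t \near (0 : R)^'+, B ((1 + t) *: x) by exact: c' B h.
move=> near_B; near (0 : R)^'+ => t.
have t0 : 0 < t by near: t; exact: nbhs_right_gt.
have : B ((1 + t) *: x) by near: t.
rewrite /B /lp_ball /= -/(lpsum p _) lpsumZ x1 mulr1 powR_le1 //.
by rewrite gtr0_norm; lra.
Unshelve. all: by end_near. Qed.

Lemma lpsum_diff_le (x w : 'rV[R]_n) (t : R) : 0 <= t <= 1 ->
  let C := \sum_i p / 2 * ((p - 1) * (`|x ord0 i| + `|w ord0 i|) `^ (p - 2)) * w ord0 i ^+ 2 in
  lpsum p (x + t *: w) <= lpsum p x + p * dot (lpdual p x) w * t + C * t ^+ 2.
Proof.
move=> /andP[t0 t1] /=; rewrite mulr_suml /dot mulr_sumr mulr_suml -!big_split.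
apply: ler_sum => i _; rewrite /= !mxE.
have h : `|t * w ord0 i| <= `|w ord0 i| by rewrite normrM (ger0_norm t0) ler_piMl.
apply: le_trans (normpow_taylor_le _ p2 h) _.
by rewrite le_eqVlt; apply/orP; left; apply/eqP; ring.
Qed.

Definition lpgrad_norm (x : 'rV[R]_n) : R := Num.sqrt (dot (lpdual p x) (lpdual p x)).

Section Normal.
Variable (x : 'rV[R]_n).
Hypothesis (x1 : lpsum p x = 1).

Lemma lpgrad_norm_gt0 : 0 < lpgrad_norm x.
Proof.
rewrite sqrtr_gt0 lt_def dot_ge0 andbT dot_eq0; apply/eqP => u0.
by have := dot_lpdual x p0; rewrite u0 x1 /dot big1 => [/eqP|i _];
  [rewrite eq_sym oner_eq0|rewrite mxE mul0r].
Qed.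

Let u := (lpgrad_norm x)^-1 *: lpdual p x.

Let uu : dot u u = 1.
Proof.
have N0 := lpgrad_norm_gt0.
rewrite dotZ dotZl -[dot _ _]sqr_sqrtr ?dot_ge0 // -/(lpgrad_norm x).
by field; rewrite gt_eqF.
Qed.

Let xu : dot x u = (lpgrad_norm x)^-1.
Proof. by rewrite dotZ dotC dot_lpdual // x1 mulr1. Qed.

(* Moving from [x] along [v - u] for a unit vector [v != u] enters [B]
   to first order, and increases [dot _ v]. *)
Lemma outer_unit_normals_lp_ball : outer_unit_normals B x = [set u].
Proof.
have N0 := lpgrad_norm_gt0.
apply/seteqP; split => [v /= [vv hv]|_ /= ->]; last first.
  split => // y By; rewrite xu dotZ -[leRHS]mulr1; apply: ler_wpM2l.
    by rewrite invr_ge0 ltW.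
  have p10 : 0 < p - 1 by move: p2; lra.
  have q1 : 1 < p / (p - 1) by rewrite ltr_pdivlMr //; move: p2; lra.
  have pq : p^-1 + (p / (p - 1))^-1 = 1 by field; rewrite !gt_eqF.
  by apply: (dot_le1 p1 q1 pq) => //; rewrite (lpsum_lpdual p1 q1 pq) x1.
apply: contrapT => nvu; pose w := v - u.
have ww : 0 < dot w w by rewrite lt_def dot_ge0 andbT dot_eq0 subr_eq0; apply/eqP.
have uv : dot u v < 1.
  by move: ww; rewrite /w dotB !dotBl vv uu (dotC v); lra.
have uw : dot (lpdual p x) w < 0.
  have -> : dot (lpdual p x) w = lpgrad_norm x * dot u w.
    by rewrite dotZl mulrA mulfV ?mul1r // gt_eqF.
  by rewrite pmulr_rlt0 // /w dotB uu; lra.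
have [C C0 HC] : exists2 C : R, 0 < C & forall t, 0 <= t <= 1 ->
    lpsum p (x + t *: w) <= lpsum p x + p * dot (lpdual p x) w * t + C * t ^+ 2.
  set C := \sum_i p / 2 * ((p - 1) * (`|x ord0 i| + `|w ord0 i|) `^ (p - 2)) * w ord0 i ^+ 2.
  exists (Num.max C 1); first by rewrite lt_max ltr01 orbT.
  move=> t t01; apply: le_trans (lpsum_diff_le x w t01) _.
  by rewrite lerD2l; apply: ler_wpM2r; rewrite ?sqr_ge0 // le_max lexx.
pose g := - (p * dot (lpdual p x) w).
have g0 : 0 < g by rewrite oppr_gt0 pmulr_rlt0.
pose t := Num.min 1 (g / C).
have t0 : 0 < t by rewrite lt_min ltr01 divr_gt0.
have t1 : t <= 1 by rewrite ge_min lexx.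
have t2 : C * t <= g by rewrite mulrC -ler_pdivlMr // ge_min lexx orbT.
have By : B (x + t *: w).
  rewrite /B /lp_ball /= -/(lpsum p _); apply: le_trans (HC t _) _.
    by rewrite (ltW t0).
  have : C * t * t <= g * t by rewrite ler_pM2r.
  by rewrite x1 /g expr2 mulrA; lra.
have := hv _ By; rewrite dotDl dotZl gerDl pmulr_rle0 //.
by rewrite /w dotBl vv; lra.
Qed.

Lemma outer_normal_lp_ball : outer_normal B x = u.
Proof.
rewrite /outer_normal; apply: xget_subset1.
  by rewrite /= outer_unit_normals_lp_ball.
by move=> a b /= -> /seteqP[+ _] => /(_ a erefl).
Qed.

Lemma dot_outer_normal : dot x (outer_normal B x) = (lpgrad_norm x)^-1.
Proof. by rewrite outer_normal_lp_ball xu. Qed.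

End Normal.

End LpBoundary.

(** * Directional derivatives through restriction to lines *)

Section DirectionalDerivatives.
Context {R : realType} {V : normedModType R}.

Lemma is_derive_line (g : V -> R) y v d :
  is_derive y v g d <-> is_derive (0 : R) 1 (fun h : R => g (h *: v + y)) d.
Proof.
have E : (fun h : R => h^-1 *: ((g \o shift y) (h *: v) - g y)) =
  (fun h : R => h^-1 *: (((fun h : R => g (h *: v + y)) \o shift 0) (h *: (1 : R)) -
     g (0 *: v + y))).
  by apply/funext => h /=; rewrite scale0r add0r addr0 [h *: 1]mulr1.
have D : derivable g y v <-> derivable (fun h : R => g (h *: v + y)) (0 : R) 1.
  by rewrite /derivable E.
have D' : 'D_v g y = 'D_1 (fun h : R => g (h *: v + y)) (0 : R) by rewrite /derive E.
by split => -[/D h1 h2]; apply: DeriveDef; rewrite // -?D' // D'.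
Qed.

Lemma is_derive_comp_dir (g : V -> R) (F : R -> R) y v (dg dF : R) :
  is_derive y v g dg -> is_derive (g y) 1 F dF -> is_derive y v (fun z => F (g z)) (dF * dg).
Proof.
move=> /is_derive_line h1 h2; apply/is_derive_line.
have h2' : is_derive ((fun h : R => g (h *: v + y)) 0) 1 F dF by rewrite scale0r add0r.
exact: is_derive1_comp h2' h1.
Qed.

Lemma is_derive_uniq (g : V -> R) y v (a b : R) :
  is_derive y v g a -> is_derive y v g b -> a = b.
Proof. by move=> [_ <-] [_ <-]. Qed.

End DirectionalDerivatives.

Section Coordinates.
Context {R : realType}.

Lemma is_derive_coord m (y v : 'rV[R]_m) i :
  is_derive y v (fun z : 'rV[R]_m => z ord0 i) (v ord0 i).
Proof.
apply/is_derive_line; rewrite (_ : (fun h : R => _) = fun h : R => v ord0 i * h + y ord0 i).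
  apply: (is_derive_eq (is_derive_add (is_derive_scal (v ord0 i) (is_derive_id (0 : R) 1))
    (is_derive_cst (y ord0 i) (0 : R) 1))).
  by rewrite mulr1 addr0.
by apply/funext => h; rewrite !mxE mulrC.
Qed.

Lemma is_derive_mulmx m n (A : 'M[R]_(m, n)) (y : 'rV[R]_m) j k :
  is_derive y (delta_mx ord0 j) (fun z : 'rV[R]_m => (z *m A) ord0 k) (A j k).
Proof.
rewrite (_ : (fun z : 'rV[R]_m => _) = fun z => \sum_l A l k * z ord0 l); last first.
  by apply/funext => z; rewrite mxE; apply: eq_bigr => l _; rewrite mulrC.
apply: (is_derive_eq (is_derive_sumr (fun l => is_derive_scal (A l k)
  (is_derive_coord y (delta_mx ord0 j) l)))).
rewrite (bigD1 j) //= big1 => [|l lj]; rewrite mxE !eqxx ?mulr1 ?addr0 //.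
by rewrite (negbTE lj) andbF mulr0.
Qed.

Lemma mulmx_continuous m n (A : 'M[R]_(m, n)) : continuous (fun y : 'rV[R]_m => y *m A).
Proof.
rewrite (_ : (fun y => _) = fun y : 'rV[R]_m => \sum_i y ord0 i *: row i A); last first.
  by apply/funext => y; rewrite mulmx_sum_row.
apply: continuous_big; first exact: add_continuous.
move=> i _ y; have h := cvgZr_tmp (@coord_continuous R 1 m ord0 i y); exact: h.
Qed.

Lemma dotE n (x y : 'rV[R]_n) : dot x y = (x *m y^T) ord0 ord0.
Proof. by rewrite mxE; apply: eq_bigr => i _; rewrite mxE. Qed.

End Coordinates.

(** * Hessian of an arbitrary graph representing the sphere *)

Section SecondFundamentalForm.
Context {R : realType}.
Variables (m : nat) (p : R).
Local Notation n := m.+1.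
Hypothesis (p2 : 2 < p).
Variables (x u : 'rV[R]_n) (N : R) (E : 'M[R]_(m, n)) (f : 'rV[R]_m -> R).
Hypotheses (x1 : lpsum p x = 1) (N0 : 0 < N) (uE : lpdual p x = N *: u) (uu : dot u u = 1).
Hypotheses (EE : E *m E^T = 1%:M) (Eu : E *m u^T = 0).
Hypotheses (f2 : twice_differentiable f 0).
Hypothesis fb : \forall z \near x,
  boundary (lp_ball n p) z <-> dot (x - z) u = f ((z - x) *m E^T).

Let p0 : 0 < p. Proof. by apply: lt_trans p2. Qed.
Let p1 : 1 < p. Proof. by apply: lt_trans p2; rewrite ltr1n. Qed.

(** The boundary point over the tangent vector [y]. [F1] and [F2] are the first and second
    derivatives of [|t|^p]. *)
Let Z (y : 'rV[R]_m) : 'rV[R]_n := x + y *m E - f y *: u.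
Let F1 (t : R) : R := p * (t * `|t| `^ (p - 2)).
Let F2 (t : R) : R := p * ((p - 2 + 1) * `|t| `^ (p - 2)).

Let f0 : f 0 = 0.
Proof.
have /nbhs_singleton [h _] := fb.
have := h (proj2 (boundary_lp_ball p2 x) x1).
by rewrite subrr mul0mx /dot big1 // => i _; rewrite mxE mul0r.
Qed.

Let Z0 : Z 0 = x.
Proof. by rewrite /Z mul0mx f0 scale0r addr0 subr0. Qed.

Let lpsum_Z : \forall y \near (0 : 'rV[R]_m), lpsum p (Z y) = 1.
Proof.
have cf : {for (0 : 'rV[R]_m), continuous f}.
  by apply: differentiable_continuous; have [/nbhs_singleton] := f2.
have cZ : Z y @[y --> (0 : 'rV[R]_m)] --> x.
  have h1 := cvgZr_tmp cf; have h2 := @mulmx_continuous R _ _ E 0.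
  have h3 := cvgB (cvgD (cvg_cst x) h2) (h1 _ (nbhs_filter _) u).
  by rewrite -[X in _ --> X]Z0; exact: h3.
have : \forall y \near (0 : 'rV[R]_m),
  boundary (lp_ball n p) (Z y) <-> dot (x - Z y) u = f ((Z y - x) *m E^T) by exact: cZ _ fb.
apply: filterS => y [_ h]; apply/(boundary_lp_ball p2)/h.
have yEu : (y *m E) *m u^T = 0 by rewrite -mulmxA Eu mulmx0.
have uET : u *m E^T = 0 by rewrite -[u *m _]trmxK trmx_mul trmxK Eu trmx0.
have -> : x - Z y = f y *: u - y *m E by rewrite /Z !opprD opprK addrA addrA subrr add0r addrC.
have -> : Z y - x = y *m E - f y *: u by rewrite /Z addrC !addrA addNr add0r.
rewrite mulmxBl -scalemxAl uET scaler0 subr0 -mulmxA EE mulmx1.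
by rewrite dotBl dotZl uu mulr1 [dot (y *m E) u]dotE yEu mxE subr0.
Qed.

Let is_derive_Z y j k : differentiable f y ->
  is_derive y (delta_mx ord0 j) (fun z => Z z ord0 k)
    (E j k - 'D_(delta_mx ord0 j) f y * u ord0 k).
Proof.
move=> df.
rewrite (_ : (fun z => _) = fun z => x ord0 k + (z *m E) ord0 k - u ord0 k * f z); last first.
  by apply/funext => z; rewrite !mxE (mulrC (f z)).
have dv : derivable f y (delta_mx ord0 j) by exact: diff_derivable.
have d := derivableP dv.
apply: (is_derive_eq (is_derive_sub (is_derive_add (is_derive_cst (x ord0 k) y (delta_mx ord0 j))
  (is_derive_mulmx E y j k)) (is_derive_scal (u ord0 k) d))).
by rewrite add0r (mulrC (u _ _)).
Qed.

Let is_derive_F1 (t : R) : is_derive t (1 : R) F1 (F2 t).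
Proof. by apply: is_derive_scal; apply: is_derive_spow; rewrite subr_gt0. Qed.

Let first_order j : \forall y \near (0 : 'rV[R]_m),
  \sum_k F1 (Z y ord0 k) * (E j k - 'D_(delta_mx ord0 j) f y * u ord0 k) = 0.
Proof.
have [df _] := f2; have h := nbhs_interior lpsum_Z.
near=> y.
have dfy : differentiable f y by near: y.
have hy : \forall z \near y, lpsum p (Z z) = 1 by near: y.
apply: (@is_derive_uniq _ _ (fun z => lpsum p (Z z)) y (delta_mx ord0 j)).
  apply: (@is_derive_sumr _ _ _ _ _ (fun k z => `|Z z ord0 k| `^ p)
    (fun k => F1 (Z y ord0 k) * (E j k - 'D_(delta_mx ord0 j) f y * u ord0 k))) => k.
  exact: is_derive_comp_dir (is_derive_Z j k dfy) (is_derive_normpow _ p2).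
apply: (@near_eq_is_derive _ _ _ (cst (1 : R))).
by apply: filterS hy => z ->.
Unshelve. all: by end_near. Qed.

Let grad_f0 j : 'D_(delta_mx ord0 j) f 0 = 0.
Proof.
have := nbhs_singleton (first_order j); rewrite Z0.
have F1E k : F1 (x ord0 k) = p * N * u ord0 k.
  rewrite /F1 -sg_normpow // -mulrA; congr (_ * _).
  by have /rowP /(_ k) := uE; rewrite !mxE.
under eq_bigr do rewrite F1E mulrBr.
rewrite sumrB.
have -> : \sum_k p * N * u ord0 k * E j k = 0.
  have /matrixP /(_ j ord0) := Eu; rewrite !mxE => h.
  transitivity (p * N * \sum_k E j k * u^T k ord0); last by rewrite h mulr0.
  by rewrite mulr_sumr; apply: eq_bigr => k _; rewrite mxE; ring.
have -> : \sum_k p * N * u ord0 k * ('D_(delta_mx ord0 j) f 0 * u ord0 k) =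
   p * N * 'D_(delta_mx ord0 j) f 0.
  rewrite -[RHS]mulr1 -uu mulr_sumr; apply: eq_bigr => k _; ring.
by move=> /eqP; rewrite sub0r oppr_eq0 mulf_eq0 (gt_eqF (mulr_gt0 p0 N0)) /= => /eqP.
Qed.

(** Implicit differentiation: differentiate [lpsum p (Z y) = 1] twice at 0. The gradient of [f]
    vanishes there, so only the Hessian, weighted by [p * N], and the terms with [F2] survive. *)
Lemma hessian_lp_ball :
  hessian f 0 = ((p - 1) / N) *: (E *m diag_mx (\row_k `|x ord0 k| `^ (p - 2)) *m E^T).
Proof.
apply/matrixP => i j; rewrite !mxE.
have [df d2f] := f2.
have dv : derivable (fun z => 'D_(delta_mx ord0 j) f z : R) 0 (delta_mx ord0 i).
  exact: diff_derivable.
have dH := derivableP dv.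
set H := 'D_(delta_mx ord0 i) _ 0 in dH *.
have F1E k : F1 (x ord0 k) = p * N * u ord0 k.
  rewrite /F1 -sg_normpow // -mulrA; congr (_ * _).
  by have /rowP /(_ k) := uE; rewrite !mxE.
have dZ k := @is_derive_Z 0 i k (nbhs_singleton df).
have D1 : is_derive (0 : 'rV[R]_m) (delta_mx ord0 i) (fun y => \sum_k F1 (Z y ord0 k) *
    (E j k - 'D_(delta_mx ord0 j) f y * u ord0 k))
  (\sum_k (F1 (Z 0 ord0 k) * (0 - u ord0 k * H) +
    (E j k - 'D_(delta_mx ord0 j) f 0 * u ord0 k) *
     (F2 (Z 0 ord0 k) * (E i k - 'D_(delta_mx ord0 i) f 0 * u ord0 k)))).
  apply: (@is_derive_sumr _ _ _ _ _ (fun k y => F1 (Z y ord0 k) *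
    (E j k - 'D_(delta_mx ord0 j) f y * u ord0 k)) (fun k => F1 (Z 0 ord0 k) * (0 - u ord0 k * H) +
    (E j k - 'D_(delta_mx ord0 j) f 0 * u ord0 k) *
     (F2 (Z 0 ord0 k) * (E i k - 'D_(delta_mx ord0 i) f 0 * u ord0 k)))) => k.
  apply: is_derive_mul; first exact: is_derive_comp_dir (dZ k) (is_derive_F1 _).
  rewrite (_ : (fun y => _) = fun y => E j k - u ord0 k * 'D_(delta_mx ord0 j) f y); last first.
    by apply/funext => y; rewrite mulrC.
  exact: is_derive_sub (is_derive_cst _ _ _) (is_derive_scal _ dH).
have D0 : is_derive (0 : 'rV[R]_m) (delta_mx ord0 i) (fun y => \sum_k F1 (Z y ord0 k) *
    (E j k - 'D_(delta_mx ord0 j) f y * u ord0 k)) 0.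
  apply: (@near_eq_is_derive _ _ _ (cst (0 : R))).
  by apply: filterS (first_order j) => y ->.
have := is_derive_uniq D1 D0; rewrite big_split /= !grad_f0 Z0.
have -> : \sum_k F1 (x ord0 k) * (0 - u ord0 k * H) = - (p * N * H).
  rewrite -[p * N * H]mulr1 -uu mulr_sumr -sumrN; apply: eq_bigr => k _.
  by rewrite F1E; ring.
have -> : \sum_k (E j k - 0 * u ord0 k) * (F2 (x ord0 k) * (E i k - 0 * u ord0 k)) =
   p * (p - 1) * \sum_k E i k * `|x ord0 k| `^ (p - 2) * E j k.
  by rewrite mulr_sumr; apply: eq_bigr => k _; rewrite /F2; ring.
have -> : \sum_k (E *m diag_mx (\row_k `|x ord0 k| `^ (p - 2))) i k * E^T k j =
   \sum_k E i k * `|x ord0 k| `^ (p - 2) * E j k.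
  by apply: eq_bigr => k _; rewrite mul_mx_diag !mxE.
set S := \sum_k _ => h; apply: (mulfI (lt0r_neq0 (mulr_gt0 p0 N0))).
have -> : p * N * ((p - 1) / N * S) = p * (p - 1) * S by field; rewrite gt_eqF.
lra.
Qed.

End SecondFundamentalForm.

(** * Gauss curvature of the lp sphere *)

Section GaussCurvature.
Context {R : realType}.

(* [u] being a multiple of [x *m diag_mx d], the rows [u] and [E *m diag_mx d]
   together are [diag_mx d] times the rows [x] and [E], up to scaling. *)
Lemma det_compression m (E : 'M[R]_(m, m.+1)) (u x d : 'rV[R]_m.+1) (N : R) :
  E *m E^T = 1%:M -> E *m u^T = 0 -> dot u u = 1 -> N != 0 ->
  x *m diag_mx d = N *: u ->
  \det (E *m diag_mx d *m E^T) = \prod_k d ord0 k * (dot x u / N).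
Proof.
move=> EE Eu uu N0 xd.
have uET : u *m E^T = 0 by rewrite -[u *m _]trmxK trmx_mul trmxK Eu trmx0.
have uuT : u *m u^T = 1%:M by apply/matrixP => i j; rewrite !ord1 -dotE uu mxE.
pose O : 'M[R]_m.+1 := col_mx u E.
pose M1 : 'M[R]_m.+1 := col_mx u (E *m diag_mx d).
pose M2 : 'M[R]_m.+1 := col_mx (N^-1 *: x) E.
have OT : O^T = row_mx u^T E^T := tr_col_mx u E.
have d1 : \det (M1 *m O^T) = \det (E *m diag_mx d *m E^T).
  rewrite OT /M1 (@mul_col_row _ 1 m m.+1 1 m) uuT uET.
  by rewrite (@det_lblock _ 1 m) det1 mul1r.
have d2 : \det (M2 *m O^T) = dot x u / N.
  rewrite OT /M2 (@mul_col_row _ 1 m m.+1 1 m) EE Eu.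
  rewrite (@det_ublock _ 1 m) det1 mulr1 det_mx11 -scalemxAl mxE -dotE mulrC.
  by [].
have M12 : M1 = M2 *m diag_mx d.
  by rewrite /M1 /M2 (@mul_col_mx _ 1 m) -scalemxAl xd scalerA mulVf // scale1r.
rewrite -d1 M12 -mulmxA !det_mulmx det_diag mulrCA -det_mulmx.
by rewrite -d2 !det_mulmx.
Qed.

Lemma prod_principal (m : nat) (A : 'M[R]_m) (k : 'I_m -> R) :
  char_poly A = \prod_(i < m) ('X - (k i)%:P) -> \prod_i k i = \det A.
Proof.
move=> h; have := char_poly_det A; rewrite h -horner_coef0 horner_prod.
under eq_bigr do rewrite hornerXsubC sub0r.
rewrite prodrN card_ord => /(mulfI _); apply.
by rewrite expf_neq0 // oppr_eq0 oner_eq0.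
Qed.

Section LpBall.
Variables (m : nat) (p : R).
Local Notation n := m.+1.
Hypothesis (p2 : 2 < p).
Let B : set 'rV[R]_n := lp_ball n p.
Let p1 : 1 < p. Proof. by apply: lt_trans p2; rewrite ltr1n. Qed.

(** Of the [m + 2] factors of the gradient norm, [m] come from the scalar in the Hessian and 2 from
    [det_compression]. Since [E] and [f] have disappeared, the choice in [gauss_curvature] is
    unambiguous. *)
Lemma principal_curvatures_prod (x : 'rV[R]_n) (k : 'I_n.-1 -> R) : lpsum p x = 1 ->
  principal_curvatures B x k ->
  \prod_i k i = (p - 1) ^+ m * \prod_i `|x ord0 i| `^ (p - 2) / lpgrad_norm p x ^+ m.+2.
Proof.
move=> x1 [E [f]]; rewrite /= outer_normal_lp_ball //.
set N := lpgrad_norm p x; set u := N^-1 *: _.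
have N0 : 0 < N := lpgrad_norm_gt0 p2 x1.
move=> [EE Eu f2 fb /prod_principal ->].
have uE : lpdual p x = N *: u by rewrite /u scalerA mulfV ?scale1r // gt_eqF.
have xu : dot x u = N^-1 by have := dot_outer_normal p2 x1; rewrite outer_normal_lp_ball.
have uu : dot u u = 1.
  rewrite /u dotZ dotZl -[dot _ _]sqr_sqrtr ?dot_ge0 // -/(lpgrad_norm p x) -/N.
  by field; rewrite gt_eqF.
rewrite (hessian_lp_ball p2 x1 N0 uE uu EE Eu f2 fb) detZ.
rewrite (@det_compression _ _ u x _ N) ?gt_eqF //; last first.
  rewrite -uE; apply/rowP => i; rewrite mul_mx_diag !mxE.
  by rewrite sg_normpow.
rewrite xu; under eq_bigr do rewrite mxE.
rewrite -[m.+2]addn2 exprD expr_div_n; field.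
by rewrite expf_neq0 gt_eqF.
Qed.

(* The value of [G_fun] when the principal curvatures exist. *)
Definition Gval (x : 'rV[R]_n) : R := G_const B *
  ((p - 1) ^+ m * \prod_i `|x ord0 i| `^ (p - 2)) `^ n.+1%:R^-1.

(** The root of order [n + 1] of the gradient power in the curvature cancels against [1 / dot x u].
    Without principal curvatures the default value of [gauss_curvature] is 0. *)
Lemma G_fun_lp_ball (x : 'rV[R]_n) : lpsum p x = 1 ->
  ((exists k, principal_curvatures B x k) -> G_fun B x = Gval x) /\
  (~ (exists k, principal_curvatures B x k) -> G_fun B x = 0).
Proof.
move=> x1; have N0 : 0 < lpgrad_norm p x := lpgrad_norm_gt0 p2 x1.
have P0 : 0 <= (p - 1) ^+ m * \prod_i `|x ord0 i| `^ (p - 2).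
  rewrite mulr_ge0 //; last by apply: prodr_ge0 => i _; exact: powR_ge0.
  by rewrite exprn_ge0 // subr_ge0 ltW.
split=> [[k hk]|nk]; rewrite /G_fun /Gval dot_outer_normal // invrK.
  congr (_ * _); rewrite /gauss_curvature.
  rewrite (@xget_subset1 _ _ _ (\prod_(i < n.-1) k i)); last 2 first.
  - by exists k.
  - by move=> _ _ [k1 h1 <-] [k2 h2 <-]; rewrite !(principal_curvatures_prod x1).
  rewrite (principal_curvatures_prod x1 hk) powRM ?invr_ge0 ?exprn_ge0 ?(ltW N0) //.
  rewrite -(powR_mulrn _ (ltW N0)) -powRN -powRrM mulNr mulfV ?pnatr_eq0 //.
  by rewrite powR_inv1 ?(ltW N0) // mulfVK // gt_eqF.
rewrite /gauss_curvature xgetPN; last by move=> t [k hk _]; case: nk; exists k.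
by rewrite powR0 // mul0r mulr0.
Qed.

End LpBall.
End GaussCurvature.

(** * Differentiability from quadratic remainders *)

Section QuadraticRemainder.
Context {R : realType}.

Lemma quadratic_remainder (V : normedModType R) (f : V -> R) (y : V) (C : R) :
  f y = 0 -> (\forall h \near (0 : V), `|f (h + y)| <= C * `|h| ^+ 2) ->
  differentiable f y /\ 'd f y = \0 :> (V -> R).
Proof.
move=> fy hf.
have c0 : continuous (\0 : V -> R) by move=> x; exact: cvg_cst.
have E : f \o shift y = cst (f y) + \0 +o_ (0 : V) id.
  apply/eqaddoP => eps eps0; rewrite fy.
  have hC : \forall h \near (0 : V), C * `|h| <= eps.
    have [C0|C0] := leP C 0.
      by apply: nearW => h; apply: (@le_trans _ _ 0); [rewrite mulr_le0_ge0|exact: ltW].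
    have e0 : 0 < eps / C by rewrite divr_gt0.
    by apply: filterS (nbhs0_le e0) => h; rewrite ler_pdivlMr // mulrC.
  apply: filterS2 hf hC => h h1 h2.
  have -> : (f \o shift y - (cst 0 + \0)) h = f (h + y).
    by rewrite -[LHS]/(f (h + y) - (0 + 0)) addr0 subr0.
  by apply: le_trans h1 _; rewrite expr2 mulrA; apply: ler_wpM2r.
have dE : 'd f y = \0 :> (V -> R) by exact: diff_unique c0 E.
split => //; apply/diff_locallyP; rewrite dE; split; first exact: c0.
exact: E.
Qed.

Lemma near_differentiable (V : normedModType R) (f g : V -> R) (y : V) :
  (\forall z \near y, f z = g z) -> differentiable f y -> differentiable g y.
Proof.
move=> fg df; rewrite (_ : g = f + (g - f)); last first.
  by apply/funext => z; rewrite -[RHS]/(f z + (g z - f z)) addrC subrK.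
apply: differentiableD => //; apply: proj1; apply: (@quadratic_remainder _ _ _ 0).
  by rewrite -[LHS]/(g y - f y) (nbhs_singleton fg) subrr.
have : \forall h \near (0 : V), f (h + y) = g (h + y).
  by move: fg; rewrite (near_shift 0 y) subr0.
apply: filterS => h fgh.
by rewrite -[(g - f) _]/(g (h + y) - f (h + y)) fgh subrr normr0 mul0r.
Qed.

Lemma coord_le_norm m (h : 'rV[R]_m) i : `|h ord0 i| <= `|h|.
Proof.
have -> : `|h| = mx_norm h by [].
rewrite mx_normrE; exact: (@le_bigmax _ _ _ _ (fun i : 'I_1 * 'I_m => `|h i.1 i.2|) (ord0, i)).
Qed.

Lemma dot_differentiable m (g : 'rV[R]_m) y : differentiable (fun z : 'rV[R]_m => dot g z) y.
Proof.
rewrite (_ : (fun z => _) = \sum_i (fun z : 'rV[R]_m => g ord0 i * z ord0 i)).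
  apply: differentiable_sum => i; apply: differentiableZ; exact: differentiable_coord.
by apply/funext => z; rewrite fct_sumE.
Qed.

Lemma quadratic_expansion m (f : 'rV[R]_m -> R) (y g : 'rV[R]_m) (C : R) :
  (\forall h \near (0 : 'rV[R]_m), `|f (h + y) - f y - dot g h| <= C * `|h| ^+ 2) ->
  differentiable f y /\ forall j, 'D_(delta_mx ord0 j) f y = g ord0 j.
Proof.
move=> H; pose r z := f z - f y - dot g (z - y).
have [dr d0] : differentiable r y /\ 'd r y = \0 :> ('rV[R]_m -> R).
  apply: (@quadratic_remainder _ _ _ C).
    by rewrite /r !subrr /dot big1 ?subrr // => i _; rewrite mxE mulr0.
  by apply: filterS H => h; rewrite /r addrK.
have fE : f = (fun z => dot g z) + (r + cst (f y - dot g y)).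
  apply/funext => z; rewrite -[RHS]/(dot g z + (r z + (f y - dot g y))) /r dotB; ring.
split.
  rewrite fE; apply: differentiableD; first exact: dot_differentiable.
  by apply: differentiableD => //; exact: differentiable_cst.
move=> j.
have dg : is_derive y (delta_mx ord0 j) (fun z => dot g z) (g ord0 j).
  have := is_derive_sumr (fun i => is_derive_scal (g ord0 i) (is_derive_coord y (delta_mx ord0 j) i)).
  rewrite (bigD1 j) //= big1 => [|i ij]; rewrite mxE !eqxx ?mulr1 ?addr0 //.
  by rewrite (negbTE ij) andbF mulr0.
have dr' : is_derive y (delta_mx ord0 j) r 0.
  by apply: DeriveDef; [exact: diff_derivable|rewrite deriveE // d0].
have := is_derive_add dg (is_derive_add dr' (is_derive_cst (f y - dot g y) y (delta_mx ord0 j))).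
by rewrite !addr0 => -[_ <-]; congr ('D__ _ _); exact: fE.
Qed.

End QuadraticRemainder.

Section OrthonormalComplement.
Context {R : realType}.

(** An isometry taking [u] to the last axis has first [m] coordinate functionals that are
    orthonormal and vanish on [u]. The isometry is known only through scalar products, so [M]
    collects the images of the basis vectors. *)
Lemma orthonormal_complement m (u : 'rV[R]_m.+1) :
  exists E : 'M[R]_(m, m.+1), E *m E^T = 1%:M /\ E *m u^T = 0.
Proof.
have [f [_ df [t _ fu]]] := orthogonal_to_last u.
pose M : 'M[R]_m.+1 := \matrix_(k, i) f (delta_mx ord0 k) ord0 i.
have dd (k l : 'I_m.+1) : dot (delta_mx ord0 k : 'rV[R]_m.+1) (delta_mx ord0 l) = (k == l)%:R.
  rewrite /dot (bigD1 k) //= big1 => [|i ik]; rewrite !mxE !eqxx /=.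
    by rewrite mul1r addr0.
  by rewrite (negbTE ik) mul0r.
have MM : M *m M^T = 1%:M.
  apply/matrixP => k l; rewrite !mxE -dd -df; apply: eq_bigr => i _.
  by rewrite !mxE.
have MtM : M^T *m M = 1%:M by exact: mulmx1C.
have fuM : f u *m M^T = u.
  apply/rowP => k; rewrite !mxE.
  have -> : u ord0 k = dot (delta_mx ord0 k) u.
    rewrite /dot (bigD1 k) //= big1 => [|i ik]; rewrite mxE !eqxx ?mul1r ?addr0 //=.
    by rewrite (negbTE ik) mul0r.
  by rewrite -df dotC; apply: eq_bigr => i _; rewrite !mxE.
have uM : u *m M = f u by rewrite -{1}fuM -mulmxA MtM mulmx1.
exists (\matrix_(i, k) M k (lift ord_max i)); split.
  apply/matrixP => i j; have /matrixP /(_ (lift ord_max i) (lift ord_max j)) := MtM.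
  rewrite !mxE (inj_eq lift_inj) => <-; apply: eq_bigr => k _; by rewrite !mxE.
apply/matrixP => i j; transitivity ((u *m M) ord0 (lift ord_max i)).
  by rewrite !mxE; apply: eq_bigr => k _; rewrite !mxE mulrC ord1.
by rewrite uM fu rsnocE_lift !mxE.
Qed.

End OrthonormalComplement.

Lemma graph_shift (R : comNzRingType) (x a b c s t : R) :
  x + (a + b) - c * t - (x + a - c * s) = b - c * (t - s).
Proof. ring. Qed.

(** * The sphere as a twice differentiable graph at the diagonal point *)

Section DiagonalGraph.
Context {R : realType}.
Variables (m : nat) (p : R).
Local Notation n := m.+1.
Hypothesis (p2 : 2 < p).
Local Notation xi := (diag_coord m p).
Local Notation x0 := (diag_point m p).
Variables (c : R) (E : 'M[R]_(m, n)).
Local Notation u := (const_mx c : 'rV[R]_n).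
Hypotheses (c0 : 0 < c) (uu : dot u u = 1).
Hypotheses (EE : E *m E^T = 1%:M) (Eu : E *m u^T = 0).

Let p0 : 0 < p. Proof. by apply: lt_trans p2. Qed.
Let xi0 : 0 < xi. Proof. exact: diag_coord_gt0. Qed.

Let l (y : 'rV[R]_m) k : R := (y *m E) ord0 k.
(** A common Lipschitz constant of the [l y k], made positive by the [+ 1]. [T] and [r] make both
    [c * t] and [l y k] at most [xi / 4], so that all coordinates stay in [[xi/2, 3 xi/2]], away
    from 0. *)
Let L : R := \sum_k \sum_j `|E j k| + 1.
Let T : R := xi / (4 * c).
Let r : R := xi / (4 * L).
Let g (y : 'rV[R]_m) (t : R) : R := \sum_k `|xi + l y k - c * t| `^ p.
Let F1 (t : R) : R := p * (t * `|t| `^ (p - 2)).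
Let F2 (t : R) : R := p * ((p - 2 + 1) * `|t| `^ (p - 2)).

Let L0 : 0 < L.
Proof.
by rewrite ltr_wpDl //; apply: sumr_ge0 => k _; apply: sumr_ge0 => j _.
Qed.

Let l_bound y k : `|l y k| <= L * `|y|.
Proof.
rewrite /l mxE; apply: le_trans (ler_norm_sum _ _ _) _.
apply: le_trans (_ : (\sum_j `|E j k|) * `|y| <= _).
  rewrite mulr_suml; apply: ler_sum => j _; rewrite normrM mulrC.
  by apply: ler_wpM2l => //; exact: coord_le_norm.
apply: ler_wpM2r => //; rewrite /L (bigD1 k) //= -addrA lerDl addr_ge0 //.
by apply: sumr_ge0 => i _; apply: sumr_ge0.
Qed.

Let r0 : 0 < r. Proof. by rewrite divr_gt0 // mulr_gt0. Qed.
Let T0 : 0 < T. Proof. by rewrite divr_gt0 // mulr_gt0. Qed.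
Let cT : c * T = xi / 4. Proof. by rewrite /T; field; rewrite gt_eqF. Qed.

Let l_small y k : `|y| < r -> `|l y k| <= xi / 4.
Proof.
move=> yr; apply: le_trans (l_bound y k) _.
have -> : xi / 4 = L * r by rewrite /r; field; rewrite gt_eqF.
by apply: ler_wpM2l; exact: ltW.
Qed.

Let arg_bounds y t k : `|y| < r -> `|t| <= T ->
  xi / 2 <= xi + l y k - c * t <= xi + xi / 2.
Proof.
move=> yr tT; have := l_small k yr.
have : `|c * t| <= xi / 4 by rewrite normrM gtr0_norm // -cT ler_pM2l.
rewrite !ler_norml => /andP[h1 h2] /andP[h3 h4]; apply/andP.
by move: xi0; split; lra.
Qed.

Let g_continuous y a b : {within `[a, b], continuous (g y)}.
Proof.
apply: (@is_derive_continuous_within _ _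
  (fun t => \sum_k (F1 (xi + l y k - c * t)) * (0 - c * 1))) => t _.
apply: (@is_derive_sumr _ _ _ _ _ (fun k t => `|xi + l y k - c * t| `^ p)
  (fun k => F1 (xi + l y k - c * t) * (0 - c * 1))) => k.
have d := is_derive_sub (is_derive_cst (xi + l y k) t (1 : R))
  (is_derive_scal c (is_derive_id t (1 : R))).
exact: is_derive_comp_dir d (is_derive_normpow _ p2).
Qed.

Let sum_xi : \sum_(k < n) xi `^ p = 1.
Proof.
by rewrite sumr_const card_ord diag_coord_pow // -[LHS]mulr_natl mulfV // pnatr_eq0.
Qed.

(** Since [|l y k| <= xi / 4 = c * T], every coordinate is at least [xi] for [t = - T] and at most
    [xi] for [t = T]; the intermediate value theorem applies. *)
Let root_exists y : `|y| < r -> exists t, `|t| <= T /\ g y t = 1.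
Proof.
move=> yr; have NTT : - T <= T by apply: le_trans (ltW T0); rewrite oppr_le0 ltW.
have hl k := l_small k yr.
have [|t] := @IVT _ (g y) (- T) T 1 NTT (@g_continuous y (- T) T).
  rewrite ge_min le_max; apply/andP; split; apply/orP; [right|left].
    rewrite -sum_xi; apply: ler_sum => k _; rewrite cT.
    have := hl k; rewrite ler_norml => /andP[h1 h2].
    by rewrite gtr0_norm; [apply: ge0_ler_powR; rewrite ?nnegrE ?(ltW p0) //|]; move: xi0; lra.
  rewrite -sum_xi; apply: ler_sum => k _; rewrite mulrN cT opprK.
  have := hl k; rewrite ler_norml => /andP[h1 h2].
  by rewrite gtr0_norm; [apply: ge0_ler_powR; rewrite ?nnegrE ?(ltW p0) //|]; move: xi0; lra.
by rewrite in_itv /= -ler_norml => tT gt; exists t.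
Qed.

(** Otherwise every coordinate would strictly decrease from [(y, t)] to [(y', t')], and the two sums
    could not both be 1. With [s = 0] this is uniqueness of the root. *)
Let root_lipschitz y y' t t' s : `|y| < r -> `|y'| < r -> `|t| <= T -> `|t'| <= T ->
  g y t = 1 -> g y' t' = 1 -> (forall k, `|l y' k - l y k| <= s) -> c * (t' - t) <= s.
Proof.
move=> yr yr' tT tT' h h' hs; rewrite leNgt; apply/negP => cs.
suff : g y' t' < g y t by rewrite h h' ltxx.
apply: ltr_sum => [|k _]; first by apply/hasP; exists ord0 => //; exact: mem_index_enum.
have /andP[a1 a2] := arg_bounds k yr tT; have /andP[b1 b2] := arg_bounds k yr' tT'.
have := hs k; rewrite ler_norml => /andP[h1 h2].
rewrite !gtr0_norm; [|lra|lra].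
by apply: gt0_ltr_powR; rewrite ?nnegrE //; lra.
Qed.

(* The sphere is a graph below its tangent plane at [diag_point]; the monotonicity of
   [g y] replaces the implicit function theorem. *)
Definition diag_graph (y : 'rV[R]_m) : R := xget 0 [set t | `|t| <= T /\ g y t = 1].
Local Notation f := diag_graph.

Let fP y : `|y| < r -> `|f y| <= T /\ g y (f y) = 1.
Proof.
by move=> yr; have := xgetPex 0 (root_exists yr).
Qed.

Let f_uniq y t : `|y| < r -> `|t| <= T -> g y t = 1 -> t = f y.
Proof.
move=> yr tT h; have [h1 h2] := fP yr.
have hs k : `|l y k - l y k| <= 0 by rewrite subrr normr0.
apply/eqP; rewrite eq_le -subr_le0 -(pmulr_rle0 _ c0) (root_lipschitz yr yr h1 tT h2 h hs) /=.
by rewrite -subr_le0 -(pmulr_rle0 _ c0) (root_lipschitz yr yr tT h1 h h2 hs).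
Qed.

Let f_lipschitz y h : `|y| < r -> `|h + y| < r -> c * `|f (h + y) - f y| <= L * `|h|.
Proof.
move=> yr hr; have [a1 a2] := fP yr; have [b1 b2] := fP hr.
have lh k : l (h + y) k - l y k = l h k by rewrite /l mulmxDl mxE addrK.
have hs k : `|l (h + y) k - l y k| <= L * `|h| by rewrite lh l_bound.
have hs' k : `|l y k - l (h + y) k| <= L * `|h| by rewrite distrC hs.
have k1 := root_lipschitz yr hr a1 b1 a2 b2 hs.
have k2 := root_lipschitz hr yr b1 a1 b2 a2 hs'.
rewrite -[X in X * _](gtr0_norm c0) -normrM ler_norml; apply/andP; split; last exact: k1.
by rewrite lerNl -mulrN opprB; exact: k2.
Qed.

Let z (y : 'rV[R]_m) k : R := xi + l y k - c * f y.
Let S y : R := \sum_k F1 (z y k).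
(** The implicit function formula: the derivative of [g] in [t] is [- c * S y]. *)
Definition diag_graph_grad (y : 'rV[R]_m) : 'rV[R]_m :=
  \row_j ((\sum_k F1 (z y k) * E j k) / (c * S y)).

Let S_gt0 y : `|y| < r -> 0 < S y.
Proof.
move=> yr; have [a1 _] := fP yr.
have zk k : 0 < z y k.
  by have /andP[h _] := arg_bounds k yr a1; apply: lt_le_trans h; rewrite divr_gt0.
have F0 k : 0 < F1 (z y k).
  by rewrite /F1 mulr_gt0 // mulr_gt0 // powR_gt0 // normr_gt0 gt_eqF.
rewrite /S (bigD1 ord0) //= ltr_wpDr //.
by apply: sumr_ge0 => k _; exact: ltW.
Qed.

Let M : R := p * ((p - 2 + 1) * (xi + xi / 2) `^ (p - 2)).

Let M_bound (t : R) : xi / 2 <= t <= xi + xi / 2 -> 0 <= F2 t <= M.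
Proof.
move=> /andP[h1 h2]; have t0 : 0 < t by apply: lt_le_trans h1; rewrite divr_gt0.
have p10 : 0 <= p - 2 + 1 by move: p2; lra.
rewrite /F2 mulr_ge0 ?(ltW p0) ?mulr_ge0 ?powR_ge0 //=.
rewrite /M; apply: ler_wpM2l; first exact: ltW.
apply: ler_wpM2l => //; rewrite gtr0_norm //.
by apply: ge0_ler_powR; rewrite ?nnegrE ?subr_ge0 ?(ltW p2) ?(ltW t0) //; apply: le_trans h2; exact: ltW.
Qed.

Let taylor (a b : R) : xi / 2 <= a <= xi + xi / 2 -> xi / 2 <= b <= xi + xi / 2 ->
  0 <= `|b| `^ p - `|a| `^ p - F1 a * (b - a) <= M / 2 * (b - a) ^+ 2.
Proof.
move=> ha hb; apply/andP; split.
  have := @taylor2_ge _ (fun s : R => `|s| `^ p) F1 F2 (xi / 2) (xi + xi / 2) 0 a b.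
  move=> h; rewrite mul0r mul0r addr0 in h.
  suff : `|a| `^ p + F1 a * (b - a) <= `|b| `^ p by lra.
  apply: h => // t ht; last by have /andP[] := M_bound ht.
    exact: is_derive_normpow.
  by apply: is_derive_scal; apply: is_derive_spow; rewrite subr_gt0.
suff : `|b| `^ p <= `|a| `^ p + F1 a * (b - a) + M / 2 * (b - a) ^+ 2 by lra.
apply: (@taylor2_le _ (fun s : R => `|s| `^ p) F1 F2 (xi / 2) (xi + xi / 2)) => // t ht.
- exact: is_derive_normpow.
- by apply: is_derive_scal; apply: is_derive_spow; rewrite subr_gt0.
- by have /andP[] := M_bound ht.
Qed.

(** Both points lie on the sphere, so the Taylor remainders of the coordinates sum to [c * S y]
    times the error to be bounded. Each is at most [M / 2] times a squared coordinate increment, and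
    [f_lipschitz] makes the increments at most [2 * L * |h|]. *)
Let expansion y h : `|y| < r -> `|h + y| < r ->
  `|f (h + y) - f y - dot (diag_graph_grad y) h| <=
     M / 2 * (n%:R * (2 * L) ^+ 2) / (c * S y) * `|h| ^+ 2.
Proof.
move=> yr hr; have [a1 a2] := fP yr; have [b1 b2] := fP hr.
have S0 := S_gt0 yr; have cS0 : 0 < c * S y by rewrite mulr_gt0.
have lh k : l (h + y) k = l y k + l h k by rewrite /l mulmxDl mxE addrC.
pose w k := l h k - c * (f (h + y) - f y).
have zE k : z (h + y) k - z y k = w k.
  by rewrite /z lh graph_shift.
have wb k : `|w k| <= 2 * L * `|h|.
  apply: le_trans (ler_normB _ _) _; rewrite normrM (gtr0_norm c0).
  by rewrite -mulrA mulr_natl mulr2n lerD ?l_bound // f_lipschitz.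
have wb2 k : w k ^+ 2 <= (2 * L) ^+ 2 * `|h| ^+ 2.
  rewrite -exprMn -real_normK ?num_real // lerXn2r ?nnegrE ?mulr_ge0 //.
  by rewrite (ltW L0).
have tk k := taylor (arg_bounds k yr a1) (arg_bounds k hr b1).
have dE : c * S y * dot (diag_graph_grad y) h = \sum_k F1 (z y k) * l h k.
  rewrite /dot mulr_sumr.
  transitivity (\sum_j \sum_k F1 (z y k) * E j k * h ord0 j).
    apply: eq_bigr => j _; rewrite mxE mulrA (mulrC (c * S y)) divfK ?gt_eqF //.
    by rewrite mulr_suml.
  rewrite exchange_big /=; apply: eq_bigr => k _.
  by rewrite /l mxE mulr_sumr; apply: eq_bigr => j _; ring.
have sumw : \sum_k F1 (z y k) * w k = - (c * S y * (f (h + y) - f y - dot (diag_graph_grad y) h)).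
  rewrite mulrBr dE opprB /w.
  under eq_bigr do rewrite mulrBr.
  by rewrite sumrB -mulr_suml mulrCA mulrA.
have rem : \sum_k (`|z (h + y) k| `^ p - `|z y k| `^ p - F1 (z y k) * (z (h + y) k - z y k)) =
  c * S y * (f (h + y) - f y - dot (diag_graph_grad y) h).
  rewrite !sumrB -[X in X - _ - _]/(g (h + y) (f (h + y))) -[X in _ - X - _]/(g y (f y)).
  rewrite a2 b2 subrr sub0r; under eq_bigr do rewrite zE.
  by rewrite sumw opprK.
have rem0 : 0 <= c * S y * (f (h + y) - f y - dot (diag_graph_grad y) h).
  by rewrite -rem; apply: sumr_ge0 => k _; have /andP[] := tk k.
have M0 : 0 <= M.
  rewrite mulr_ge0 ?(ltW p0) // mulr_ge0 ?powR_ge0 //.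
  by rewrite addr_ge0 ?ler01 // subr_ge0 ltW.
have remM : c * S y * (f (h + y) - f y - dot (diag_graph_grad y) h) <=
   M / 2 * (n%:R * (2 * L) ^+ 2) * `|h| ^+ 2.
  rewrite -rem; apply: le_trans (_ : \sum_(k < n) M / 2 * ((2 * L) ^+ 2 * `|h| ^+ 2) <= _).
    apply: ler_sum => k _; have /andP[_ h2] := tk k; apply: (le_trans h2).
    by apply: ler_wpM2l; [rewrite divr_ge0|rewrite zE; exact: wb2].
  by rewrite sumr_const card_ord -[leLHS]mulr_natl mulrCA -!mulrA lexx.
rewrite mulrAC ler_pdivlMr // mulrC -[X in X * _](gtr0_norm cS0) -normrM ger0_norm //.
Qed.

Let near_r y : `|y| < r -> \forall h \near (0 : 'rV[R]_m), `|h + y| < r.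
Proof.
move=> yr; have e0 : 0 < r - `|y| by rewrite subr_gt0.
apply: filterS (nbhs0_lt e0) => h hh; apply: le_lt_trans (ler_normD _ _) _.
by rewrite -ltrBrDr.
Qed.

Let f_diff y : `|y| < r ->
  differentiable f y /\ forall j, 'D_(delta_mx ord0 j) f y = diag_graph_grad y ord0 j.
Proof.
move=> yr; apply: quadratic_expansion.
by apply: filterS (near_r yr) => h hr; exact: (expansion yr hr).
Qed.

Let z_diff k : differentiable (fun y => z y k) (0 : 'rV[R]_m).
Proof.
have df : differentiable f (0 : 'rV[R]_m) by apply: (f_diff _).1; rewrite normr0.
rewrite (_ : (fun y => z y k) = (cst xi + (fun y => dot (col k E)^T y)) - c *: f); last first.
  apply/funext => y; rewrite -[RHS]/(xi + dot (col k E)^T y - c * f y); congr (_ + _ - _).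
  by rewrite /l mxE; apply: eq_bigr => j _; rewrite !mxE mulrC.
apply: differentiableB; last exact: differentiableZ.
by apply: differentiableD; [exact: differentiable_cst|exact: dot_differentiable].
Qed.

Let F1_diff k : differentiable (fun y => F1 (z y k)) (0 : 'rV[R]_m).
Proof.
apply: (@differentiable_comp _ _ _ _ (fun y => z y k) F1); first exact: z_diff.
apply/derivable1_diffP; have p20 : 0 < p - 2 by rewrite subr_gt0.
by have [] := is_derive_scal p (is_derive_spow (z 0 k) p20).
Qed.

(** Near 0 the partial derivatives are given by [diag_graph_grad], a quotient of expressions in [F1]
    and [f] that are already differentiable. *)
Lemma diag_graph_twice_differentiable : twice_differentiable f 0.
Proof.
split; first by apply: filterS (nbhs0_lt r0) => y yr; exact: (f_diff yr).1.
move=> j; apply: (@near_differentiable _ _ (fun y => diag_graph_grad y ord0 j)).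
  by apply: filterS (nbhs0_lt r0) => y yr; rewrite (f_diff yr).2.
pose Sf : 'rV[R]_m -> R := \sum_k (fun y => F1 (z y k)).
have SfE y : Sf y = S y by rewrite /Sf fct_sumE.
have dS : differentiable Sf (0 : 'rV[R]_m).
  by apply: differentiable_sum => k; exact: F1_diff.
have S00 : c * S 0 != 0 by rewrite mulf_neq0 ?gt_eqF // S_gt0 // normr0.
pose Nf : 'rV[R]_m -> R := \sum_k ((fun y => F1 (z y k)) * cst (E j k)).
have -> : (fun y => diag_graph_grad y ord0 j) = Nf * (fun y => ((c *: Sf) y)^-1).
  apply/funext => y; rewrite mxE -[RHS]/(Nf y * (c * Sf y)^-1) SfE /Nf fct_sumE.
  by [].
apply: differentiableM.
  by apply: differentiable_sum => k; apply: differentiableM; [exact: F1_diff|exact: differentiable_cst].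
apply: differentiableV; first exact: differentiableZ.
by rewrite -[X in X != 0]/(c * Sf 0) SfE.
Qed.

Let orthogonal_split (v : 'rV[R]_n) : v = dot v u *: u + v *m E^T *m E.
Proof.
pose O : 'M[R]_n := col_mx u E.
have OT : O^T = row_mx u^T E^T := tr_col_mx u E.
have uE : u *m E^T = 0 by rewrite -[u *m _]trmxK trmx_mul trmxK Eu trmx0.
have uu1 : u *m u^T = 1%:M by apply/matrixP => i j; rewrite !ord1 -dotE uu mxE.
have OO : O *m O^T = 1%:M.
  rewrite OT (@mul_col_row _ 1 m m.+1 1 m) uu1 uE EE Eu.
  exact/esym/(scalar_mx_block 1 m 1).
have := mulmx1C OO; rewrite OT (@mul_row_col _ m.+1 1 m) => h.
rewrite -{1}[v]mulmx1 -h mulmxDr !mulmxA; congr (_ + _).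
by rewrite [v *m _]mx11_scalar mul_scalar_mx dotE.
Qed.

(** A nearby point has tangential coordinate [y] and depth [t] within the bounds [r] and [T], and
    its [lpsum] is [g y t]; uniqueness of the root then gives [t = f y]. *)
Lemma boundary_diag_graph : \forall z \near x0,
  boundary (lp_ball n p) z <-> dot (x0 - z) u = f ((z - x0) *m E^T).
Proof.
have c1 : continuous (fun w : 'rV[R]_n => (w - x0) *m E^T).
  move=> w; apply: (@continuous_comp _ _ _ (fun w : 'rV[R]_n => w - x0) (fun y => y *m E^T)).
    by apply: (@continuousB _ _ _ id (cst x0)) => //; exact: cst_continuous.
  exact: mulmx_continuous.
have h1 : \forall w \near x0, `|(w - x0) *m E^T| < r.
  by apply: (cvgr_lt _ (cvg_norm (c1 x0))); rewrite subrr mul0mx normr0.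
have c2 : continuous (fun w : 'rV[R]_n => dot (x0 - w) u).
  move=> w; apply: (@continuous_comp _ _ _ (fun w : 'rV[R]_n => x0 - w) (fun y => dot y u)).
    by apply: (@continuousB _ _ _ (cst x0) id) => //; exact: cst_continuous.
  apply: differentiable_continuous.
  rewrite (_ : (fun y => dot y u) = (fun y => dot u y)); last by apply/funext => v; exact: dotC.
  exact: dot_differentiable.
have h2 : \forall w \near x0, `|dot (x0 - w) u| < T.
  apply: (cvgr_lt _ (cvg_norm (c2 x0))); rewrite subrr /dot big1 ?normr0 // => i _.
  by rewrite mxE mul0r.
apply: filterS2 h1 h2 => w h1 h2.
set y := (w - x0) *m E^T; set t := dot (x0 - w) u.
have wk k : w ord0 k = xi + l y k - c * t.
  have /rowP /(_ k) := orthogonal_split (w - x0); rewrite -/y !mxE -/(diag_coord m p).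
  have -> : dot (w - x0) u = - t by rewrite /t -opprB dotNl.
  have -> : \sum_j y ord0 j * E j k = l y k by rewrite /l mxE.
  by move=> /eqP; rewrite subr_eq => /eqP ->; rewrite mulNr (mulrC t) [LHS]addrC (addrC (- _)) addrA.
have gw : lpsum p w = g y t by apply: eq_bigr => k _; rewrite wk.
split=> [/(boundary_lp_ball p2)|].
  by rewrite gw => gt; apply: f_uniq => //; exact: ltW.
by move=> tf; apply/(boundary_lp_ball p2); rewrite gw tf; exact: (fP _).2.
Qed.

End DiagonalGraph.

(** * The value of [G_fun] at the diagonal point *)

Section DiagonalPoint.
Context {R : realType}.

Lemma char_poly_scalar_mx m (a : R) : char_poly (a%:M : 'M[R]_m) = ('X - a%:P) ^+ m.
Proof.
rewrite /char_poly /char_poly_mx map_scalar_mx /= -raddfB /= det_scalar.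
by [].
Qed.

(** With [e = (m + 2) / 2], the base contains [2^(-e)], whose root of order [e] is the factor [1/2]
    of [G_const], while the square root of [D] becomes a root of order [n + 1]. *)
Lemma G_scale (V w D : R) (m : nat) : 0 <= V -> 0 < w -> 0 <= D ->
  (V / (w * 2 `^ (m%:R / 2) / (m%:R / 2 + 1) / Num.sqrt D)) `^ (m%:R / 2 + 1)^-1 =
  m.+2%:R `^ (2 / m.+2%:R) / 2 * (V / w) `^ (2 / m.+2%:R) * D `^ m.+2%:R^-1.
Proof.
move=> V0 w0 D0; set e : R := m%:R / 2 + 1.
have wi0 : 0 <= w^-1 by rewrite invr_ge0 ltW.
have eE : e = m.+2%:R / 2 by rewrite /e -[m.+2]addn2 natrD; field.
have e0 : 0 < e by rewrite eE divr_gt0.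
have -> : V / (w * 2 `^ (m%:R / 2) / e / Num.sqrt D) =
    m.+2%:R * (V / w) * D `^ 2^-1 * 2 `^ (- e).
  have -> : 2 `^ (- e) = (2 `^ (m%:R / 2))^-1 / 2 :> R.
    by rewrite powRN /e powRD ?powRr1 ?invfM // pnatr_eq0 implybT.
  rewrite !invfM !invrK powR12_sqrt // eE; field.
  by rewrite !gt_eqF // ltr0n.
rewrite !powRM ?powR_ge0 ?mulr_ge0 ?divr_ge0 ?powR_ge0 ?(ltW w0) ?ler0n //.
rewrite -!powRrM mulNr divff ?gt_eqF // powR_inv1 ?ler0n //.
have -> : e^-1 = 2 / m.+2%:R by rewrite eE invf_div.
have -> : 2^-1 * (2 / m.+2%:R) = m.+2%:R^-1 :> R by field; rewrite gt_eqF.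
ring.
Qed.

Variables (m : nat) (p : R).
Local Notation n := m.+1.
Hypothesis (p2 : 2 < p).
Local Notation xi := (diag_coord m p).
Local Notation x0 := (diag_point m p).
Let B : set 'rV[R]_n := lp_ball n p.

(** An umbilic point: the diagonal weights coincide, so the Hessian is a scalar matrix. *)
Lemma principal_curvatures_diag_point :
  exists k, principal_curvatures B (x0 : 'rV[R]_n) k.
Proof.
have x1 : lpsum p (x0 : 'rV[R]_n) = 1 by exact: lpsum_diag_point p2.
have N0 := lpgrad_norm_gt0 p2 x1.
set N := lpgrad_norm p x0 in N0.
pose c := N^-1 * xi `^ (p - 1).
have c0 : 0 < c by rewrite mulr_gt0 ?invr_gt0 // powR_gt0 // diag_coord_gt0.
have uE : outer_normal B x0 = const_mx c.
  rewrite outer_normal_lp_ball //; apply/rowP => i.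
  by rewrite mxE lpdual_const ?diag_coord_gt0 // mxE.
have uE' : lpdual p x0 = N *: (const_mx c : 'rV[R]_n).
  by rewrite -uE outer_normal_lp_ball // scalerA mulfV ?scale1r // gt_eqF.
have uu : dot (const_mx c : 'rV[R]_n) (const_mx c) = 1.
  have -> : const_mx c = N^-1 *: lpdual p x0 by rewrite uE' scalerA mulVf ?scale1r // gt_eqF.
  rewrite dotZ dotZl -[dot _ _]sqr_sqrtr ?dot_ge0 // -/(lpgrad_norm p x0) -/N.
  by field; rewrite gt_eqF.
have [E [EE Eu]] := orthonormal_complement (const_mx c : 'rV[R]_n).
have f2 := diag_graph_twice_differentiable p2 E c0.
have fb := boundary_diag_graph p2 c0 uu EE Eu.
exists (fun=> (p - 1) / N * xi `^ (p - 2)), E, (diag_graph p c E).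
rewrite /= uE; split => //.
have -> : hessian (diag_graph p c E) 0 = ((p - 1) / N * xi `^ (p - 2))%:M.
  rewrite (hessian_lp_ball p2 x1 N0 uE' uu EE Eu f2 fb).
  have -> : diag_mx (\row_k `|(x0 : 'rV[R]_n) ord0 k| `^ (p - 2)) = (xi `^ (p - 2))%:M.
    rewrite -diag_const_mx; congr diag_mx; apply/rowP => i; rewrite !mxE gtr0_norm //.
    exact: diag_coord_gt0.
  by rewrite mul_mx_scalar -scalemxAl EE scale_scalar_mx mulr1 scale_scalar_mx.
by rewrite char_poly_scalar_mx prodr_const card_ord.
Qed.

Lemma G_fun_diag_point V : volume B = V%:E -> 0 <= V -> (0 < m)%N ->
  G_fun B x0 = Gdiag m p V.
Proof.
move=> VE V0 m0; have p1 : 1 < p by apply: lt_trans p2; rewrite ltr1n.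
have xi0 := diag_coord_gt0 m p.
have x1 : lpsum p (x0 : 'rV[R]_n) = 1 by exact: lpsum_diag_point p2.
rewrite ((G_fun_lp_ball p2 x1).1 principal_curvatures_diag_point).
rewrite /Gdiag /capconst /kappa G_scale //.
- rewrite /Gval /G_const VE /=; congr (_ * (_ * _) `^ _).
  rewrite addr0 (eq_bigr (fun=> xi `^ (p - 2))) ?prodr_const ?card_ord // => i _.
  by rewrite mxE gtr0_norm.
- by apply: fine_volume_lp_ball_gt0; rewrite ?ltr1n.
- by apply/ltW/Dbound_gt0 => //; rewrite oppr_lt0.
Qed.

End DiagonalPoint.

(** * Extrema of [G_fun] and the conclusion *)

Section Extrema.
Context {R : realType}.
Variables (m : nat) (p : R).
Local Notation n := m.+1.
Hypothesis (p2 : 2 < p).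
Let B : set 'rV[R]_n := lp_ball n p.

Let p1 : 1 < p. Proof. by apply: lt_trans p2; rewrite ltr1n. Qed.
Let p0 : 0 < p. Proof. exact: lt_trans p1. Qed.

Lemma G_const_ge0 : 0 <= G_const B.
Proof. by rewrite mulr_ge0 ?powR_ge0 // divr_ge0 ?powR_ge0. Qed.

Lemma G_fun_ge0 x : boundary B x -> 0 <= G_fun B x.
Proof.
move=> /(boundary_lp_ball p2) x1; have [h1 h2] := G_fun_lp_ball p2 x1.
have [/h1 ->|/h2 -> //] := pselect (exists k, principal_curvatures B x k).
by rewrite mulr_ge0 ?G_const_ge0 ?powR_ge0.
Qed.

Lemma G_fun_le_diag_point x : boundary B x -> G_fun B x <= G_fun B (diag_point m p).
Proof.
move=> Bx; move: (Bx) => /(boundary_lp_ball p2) x1.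
have d1 : lpsum p (diag_point m p : 'rV[R]_n) = 1 by exact: lpsum_diag_point p2.
rewrite ((G_fun_lp_ball p2 d1).1 (principal_curvatures_diag_point m p2)).
have [h1 h2] := G_fun_lp_ball p2 x1.
have [/h1 ->|/h2 ->] := pselect (exists k, principal_curvatures B x k); last first.
  by rewrite mulr_ge0 ?G_const_ge0 ?powR_ge0.
have p10 : 0 <= p - 1 by rewrite subr_ge0 ltW.
have P0 y : 0 <= (p - 1) ^+ m * \prod_i `|(y : 'rV[R]_n) ord0 i| `^ (p - 2).
  by rewrite mulr_ge0 ?exprn_ge0 // prodr_ge0 // => i _; exact: powR_ge0.
apply: ler_wpM2l; first exact: G_const_ge0.
apply: ge0_ler_powR; rewrite ?nnegrE ?P0 ?invr_ge0 //.
apply: ler_wpM2l; first by rewrite exprn_ge0.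
have := prod_coord_le p2 x1 (lexx 0).
under eq_bigr do rewrite addr0; move=> /le_trans; apply.
rewrite addr0 [leRHS](eq_bigr (fun=> diag_coord m p `^ (p - 2))).
  by rewrite prodr_const card_ord.
by move=> i _; rewrite mxE gtr0_norm // diag_coord_gt0.
Qed.

(** The last coordinate vanishes because [m > 0], which kills the product in [Gval]; the default
    branch is 0 as well. *)
Lemma G_fun_axis_point : (0 < m)%N -> G_fun B (axis_point m) = 0.
Proof.
move=> m0; have x1 : lpsum p (axis_point m : 'rV[R]_n) = 1 by exact: lpsum_axis_point.
have [h1 h2] := G_fun_lp_ball p2 x1.
have [/h1 ->|/h2 -> //] := pselect (exists k, principal_curvatures B (axis_point m) k).
have xm : (axis_point m : 'rV[R]_n) ord0 ord_max = 0.
  by rewrite mxE -(inj_eq val_inj ord_max) /= (gtn_eqF m0).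
rewrite /Gval (bigD1 ord_max) //= xm normr0 powR0 ?subr_eq0 ?gt_eqF //.
by rewrite mul0r mulr0 powR0 ?mulr0 // invr_eq0 pnatr_eq0.
Qed.

End Extrema.

Theorem theorem4p6 (R : realType) (n : nat) (p : R)
    (hn : (2 <= n)%N) (hp : 2 < p) :
  let B : set 'rV[R]_n := lp_ball n p in
  let G : 'rV[R]_n -> R := G_fun B in
  let x0 : 'rV[R]_n := const_mx (n%:R `^ (- p^-1)) in
  exists Gmax Gmin : R,
    [/\ is_maximum [set G x | x in boundary B] Gmax,
        is_minimum [set G x | x in boundary B] Gmin,
        ((floating_illumination_distance B delta - 1) /
          (delta `^ (2 / n.+1%:R))%:E)%E @[delta --> 0^'+] --> (G x0)%:E,
        G x0 = Gmax
      & Gmax = Gmax - Gmin].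
Proof.
case: n hn => // m m0 B G x0; have p1 : 1 < p by apply: lt_trans hp; rewrite ltr1n.
have p0 : 0 < p by exact: lt_trans p1.
exists (G x0), 0; split; rewrite ?subr0 //.
- split; last by move=> _ [x Bx <-]; exact: G_fun_le_diag_point.
  by exists x0 => //; apply/(boundary_lp_ball hp); exact: lpsum_diag_point hp.
- split; last by move=> _ [x Bx <-]; exact: G_fun_ge0.
  exists (axis_point m); last exact: G_fun_axis_point.
  by apply/(boundary_lp_ball hp); exact: lpsum_axis_point.
have q1 : 1 < conj_exp p by rewrite ltr_pdivlMr ?subr_gt0 // mul1r gtrBl.
have V0 : 0 < fine (volume B) by exact: fine_volume_lp_ball_gt0.
have VE : volume B = (fine (volume B))%:E by exact: fin_volume_lp_ball.
rewrite /G (G_fun_diag_point hp VE (ltW V0) m0).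
exact: (distance_cvg m0 hp VE (fin_volume_lp_ball _ q1) V0 (fine_volume_lp_ball_gt0 _ q1)).
Qed.
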